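(* Let $G$ be a finitely generated group that splits as a graph of groups, and consider a vertex group $V\leq G$. Suppose that all incident edge groups $E\leq V$ are finitely generated, undistorted in $G$, and relatively wide in $V$. Then: (1) $V$ is undistorted in $G$ and $(\partial_M V,G)=\partial_M V$; (2) the inclusion $\partial_M V\hookrightarrow\partial_M G$ is a topological embedding.
   Context: Splittings. A finitely generated group $G$ splits as a graph of groups if it acts without inversions and without a global fixed point (non-elliptically) on a simplicial tree $T$; we fix such an action. Vertex groups are the $G$-stabilisers of vertices of $T$, and edge groups are the $G$-stabilisers of edges of $T$. The edge groups incident to the stabiliser $V$ of a vertex $p$ are the stabilisers of edges of $T$ containing $p$. A finitely generated subgroup $H\leq G$ is undistorted if the inclusion is a quasi-isometric embedding with respect to word metrics. (If all incident edge groups are finitely generated and undistorted in $G$, then $V$ is finitely generated and $E$ is undistorted in $V$, so that relative wideness below makes sense.) Relative wideness. Let $H\leq K$ be finitely generated groups, with $H$ undistorted in $K$. $H$ is relatively wide in $K$ if, for every asymptotic cone $K_\omega$ of $K$ (with arbitrary non-principal ultrafilter, basepoints and scaling factors), no two points of the limit $H_\omega\subseteq K_\omega$ (the set of points represented by sequences in $H$) are separated by a cut point of $K_\omega$; i.e. there are no $x,y\in H_\omega$ and $z\in K_\omega\setminus\{x,y\}$ such that $x,y$ lie in distinct connected components of $K_\omega\setminus\{z\}$. Morse boundaries. A $C$-quasi-geodesic is a $(C,C)$-quasi-geodesic, i.e. a map $\gamma$ from an interval with $\frac1C|s-t|-C\leq d(\gamma(s),\gamma(t))\leq C|s-t|+C$.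 Let $X$ be a proper geodesic metric space. A quasi-geodesic $\gamma\subseteq X$ is $N$-Morse, for a function $N\colon[1,+\infty)\to[0,+\infty)$ (a Morse gauge), if every $C$-quasi-geodesic with endpoints on $\gamma$ is contained in the $N(C)$-neighbourhood of $\gamma$; it is Morse if it is $N$-Morse for some $N$. For a basepoint $p\in X$, $\partial_M^N X_p$ is the set of $N$-Morse geodesic rays based at $p$, identifying rays at finite Hausdorff distance, with the compact-open topology. Let $\partial_M X_p=\bigcup_N\partial_M^N X_p$, where a subset $U$ is open (resp. closed) if and only if $U\cap\partial_M^N X_p$ is open (resp. closed) in $\partial_M^N X_p$ for every $N$. Up to canonical homeomorphism this does not depend on $p$; it is denoted $\partial_M X$. For a finitely generated group $G$, $\partial_M G$ is the Morse boundary of a Cayley graph with respect to a finite generating set (well defined up to homeomorphism). Relative Morse boundary. Let $H\leq G$ be finitely generated groups with $H$ undistorted in $G$, and let $i\colon\Lambda\to\Gamma$ be a quasi-isometric embedding between Cayley graphs of $H$ and $G$ extending the inclusion. Then $(\partial_M H,G)$ is the subset of points $[\gamma]\in\partial_M H$ such that $i\circ\gamma$ is Morse in $\Gamma$, with the subspace topology from $\partial_M H$. The natural injection $(\partial_M H,G)\hookrightarrow\partial_M G$ maps $[\gamma]$ to the class of a Morse geodesic ray of $\Gamma$ at finite Hausdorff distance from $i\circ\gamma$. *)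

(* Defs.v *)
From HB Require Import structures.
From mathcomp Require Import all_boot all_order all_algebra.
From mathcomp Require Import all_classical all_reals all_analysis.
From mathcomp Require Import ring.

Set Implicit Arguments.
Unset Strict Implicit.
Unset Printing Implicit Defensive.

Import Order.TTheory GRing.Theory Num.Theory.
Import numFieldNormedType.Exports.

Local Open Scope classical_set_scope.
Local Open Scope ring_scope.

Section Infima.
Context {R : realType}.
Implicit Types A B C : set R.

Lemma nneg_has_lbound A : (forall a, A a -> 0 <= a) -> has_lbound A.
Proof. by move=> A0; exists 0 => a; exact: A0. Qed.

Lemma nneg_inf_ge0 A : (forall a, A a -> 0 <= a) -> 0 <= inf A.
Proof.
move=> A0; have [->|/set0P A_neq0] := eqVneq A set0; first by rewrite inf0.
exact: lb_le_inf.
Qed.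

Lemma nneg_inf_eq0 A : (forall a, A a -> 0 <= a) -> A 0 -> inf A = 0.
Proof.
move=> A0 A00; apply/eqP; rewrite eq_le nneg_inf_ge0// andbT.
by apply: ge_inf => //; exact: nneg_has_lbound.
Qed.

Lemma nneg_inf_triangle A B C : (forall a, C a -> 0 <= a) ->
  A !=set0 -> B !=set0 -> (forall a b, A a -> B b -> C (a + b)) ->
  inf C <= inf A + inf B.
Proof.
move=> C0 A_neq0 B_neq0 ABC.
rewrite -lerBlDr; apply: lb_le_inf => // a Aa.
rewrite lerBlDr -lerBlDl; apply: lb_le_inf => // b Bb.
rewrite lerBlDl; apply: ge_inf; last exact: ABC.
exact: nneg_has_lbound.
Qed.

End Infima.

Section WordMetric.
Context {G : groupType}.
Implicit Types (H S : set G) (w : seq G).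
Local Open Scope group_scope.

Definition generates S H : Prop :=
  finite_set S /\ smallest (fun K : set G => group_closed (mem K)) S = H.

Definition finitely_generated H : Prop := exists S, generates S H.

Record genset H := GenSet {
  gens :> set G;
  gensP : generates gens H }.

Definition word_over S w : Prop :=
  forall s, s \in w -> S s \/ S s^-1.

Definition word_length (R : realType) S (g : G) : R :=
  inf [set (size w)%:R%R | w in
        [set w | word_over S w /\ \prod_(s <- w) s = g]].

Lemma word_over_cat S w1 w2 :
  word_over S w1 -> word_over S w2 -> word_over S (w1 ++ w2).
Proof.
by move=> h1 h2 s; rewrite mem_cat => /orP[]; [exact: h1|exact: h2].
Qed.

Lemma word_over_inv S w :
  word_over S w -> word_over S [seq s^-1 | s <- rev w].
Proof.
move=> h s /mapP[t]; rewrite mem_rev => /h [|] tS ->.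
  by right; rewrite invgK.
by left.
Qed.

Lemma prodg_cat w1 w2 :
  \prod_(s <- w1 ++ w2) s = (\prod_(s <- w1) s) * (\prod_(s <- w2) s).
Proof.
elim: w1 => [|x w1 IH] /=; first by rewrite big_nil mul1g.
by rewrite !big_cons IH mulgA.
Qed.

Lemma prodg_inv w :
  \prod_(s <- [seq s^-1 | s <- rev w]) s = (\prod_(s <- w) s)^-1.
Proof.
elim: w => [|x w IH]; first by rewrite !big_nil invg1.
rewrite rev_cons map_rcons -cats1 prodg_cat IH !big_cons !big_nil.
by rewrite mulg1 invgM.
Qed.

Lemma generates_group S H : generates S H -> group_closed (mem H).
Proof.
case=> _ <-; split.
  by apply/mem_set => K [[K1 _] _]; apply/set_mem.
move=> x y /set_mem xS /set_mem yS; apply/mem_set => K KS.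
have [[_ KB] _] := KS; apply/set_mem; apply: KB; apply/mem_set.
  exact: xS.
exact: yS.
Qed.

Lemma generates_word S H g : generates S H -> H g ->
  exists w, word_over S w /\ \prod_(s <- w) s = g.
Proof.
case=> _ <-; move=> /(_ [set g | exists w, word_over S w /\ \prod_(s <- w) s = g]).
apply; split.
  split.
    by apply/mem_set; exists [::]; split; [move=> ?|rewrite big_nil].
  move=> x y /set_mem[w [wS <-]] /set_mem[w' [w'S <-]]; apply/mem_set.
  exists (w ++ [seq s^-1 | s <- rev w']); split.
    exact/word_over_cat/word_over_inv.
  by rewrite prodg_cat prodg_inv.
move=> s Ss; exists [:: s]; split; last by rewrite big_cons big_nil mulg1.
by move=> t; rewrite inE => /eqP ->; left.
Qed.

End WordMetric.

(* Carries the word metric of S; R and S are phantom parameters. *)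
Definition word_space (R : realType) (G : groupType) (H : set G)
  (S : genset H) : Type := set_type H.

Section WordSpace.
Context {R : realType} {G : groupType} {H : set G} (S : genset H).
Local Notation X := (word_space R S).

HB.instance Definition _ := Choice.on X.

Definition word_dist (x y : X) : R := word_length R S ((val x)^-1 * val y)%g.

Let words g := [set w : seq G | word_over S w /\ (\prod_(s <- w) s = g)%g].

Let words_neq0 (x y : X) :
  ([set (size w)%:R | w in words ((val x)^-1 * val y)%g] : set R) !=set0.
Proof.
have [_ HB] := generates_group (gensP S).
have Hxy : H ((val x)^-1 * val y)%g.
  apply/set_mem; apply: (group_closedM (generates_group (gensP S))).
    exact: (group_closedV (generates_group (gensP S))) (valP x).
  exact: valP y.
have [w hw] := generates_word (gensP S) Hxy.
by exists (size w)%:R; exists w.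
Qed.

Let words_ge0 g a : [set (size w)%:R | w in words g] a -> 0 <= a :> R.
Proof. by move=> [w _ <-]; exact: ler0n. Qed.

Let word_distxx x : word_dist x x = 0.
Proof.
apply: nneg_inf_eq0; first exact: words_ge0.
by exists [::] => //; split=> //; rewrite big_nil mulVg.
Qed.

Let word_dist_pos x y : word_dist x y = 0 -> x = y.
Proof.
move=> xy0; have [[w [wS wE] w0]|h] :=
  pselect (exists2 w, words ((val x)^-1 * val y)%g w & size w = 0%N).
  move: wE; rewrite (size0nil w0) big_nil => wE.
  by apply: val_inj; rewrite -[RHS](mulVKg (val x)) -wE mulg1.
suff : 1 <= word_dist x y by rewrite xy0 ler10.
apply: lb_le_inf; first exact: words_neq0.
move=> _ [w hw <-]; rewrite ler1n lt0n; apply/eqP => w0.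
by apply: h; exists w.
Qed.

Let word_dist_le x y : word_dist x y <= word_dist y x.
Proof.
apply: lb_le_inf; first exact: words_neq0.
move=> _ [w [wS wE] <-]; apply: ge_inf.
  by apply: nneg_has_lbound; exact: words_ge0.
exists [seq (s^-1)%g | s <- rev w]; last by rewrite size_map size_rev.
by split; [exact: word_over_inv|rewrite prodg_inv wE invgM invgK].
Qed.

Let word_dist_sym x y : word_dist x y = word_dist y x.
Proof. by apply/eqP; rewrite eq_le !word_dist_le. Qed.

Let word_dist_triangle y x z : word_dist x z <= word_dist x y + word_dist y z.
Proof.
apply: nneg_inf_triangle; [exact: words_ge0|exact: words_neq0..|].
move=> _ _ [w [wS wE] <-] [w' [w'S w'E] <-].
exists (w ++ w'); last by rewrite size_cat natrD.
split; first exact: word_over_cat.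
by rewrite prodg_cat wE w'E mulgA mulgK.
Qed.

HB.instance Definition _ := isMetric.Build R X
  word_distxx word_dist_pos word_dist_sym word_dist_triangle.

End WordSpace.

Section QuasiIsometry.
Context {R : realType}.

Definition quasi_isometric_embedding (X Y : metricType R) (f : X -> Y) : Prop :=
  exists2 C : R, 1 <= C & forall x y,
    C^-1 * mdist x y - C <= mdist (f x) (f y) <= C * mdist x y + C.

End QuasiIsometry.

Definition sub_incl (G : groupType) (H K : set G) (HK : H `<=` K)
  (x : set_type H) : set_type K := SigSub (mem_set (HK _ (set_mem (valP x)))).

(* The property does not depend on the generating sets SH and SK. *)
Definition undistorted (R : realType) (G : groupType) (H K : set G) : Prop :=
  finitely_generated H /\
  exists HK : H `<=` K, forall (SH : genset H) (SK : genset K),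
    quasi_isometric_embedding
      (sub_incl HK : word_space R SH -> word_space R SK).

(* The scaling factors tend to infinity along the ultrafilter. *)
Record cone_data (R : realType) (X : metricType R) := ConeData {
  cultra : set_system nat;
  cultra_ultra : UltraFilter cultra;
  cultra_nonprincipal : forall n, ~ cultra [set n];
  cbase : nat -> X;
  cscale : nat -> R;
  cscale_infty : cscale @ cultra --> +oo }.
#[global] Existing Instance cultra_ultra.

Section AsymptoticCone.
Context {R : realType} {X : metricType R} (D : cone_data X).
Local Notation w := (cultra D).

Definition admissible : set (nat -> X) := [set x | exists M : R,
  \forall n \near w, mdist (cbase D n) (x n) <= M * cscale D n].

Definition cone_dist (x y : set_type admissible) : R :=
  lim ((fun n => mdist (val x n) (val y n) / cscale D n) @ w).

Let scale_gt0 : \forall n \near w, 0 < cscale D n.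
Proof. exact: (cvgry_gt (cscale_infty D)). Qed.

Lemma cone_dist_cvg (x y : set_type admissible) :
  (fun n => mdist (val x n) (val y n) / cscale D n) @ w --> cone_dist x y.
Proof.
have [M hM] := set_mem (valP x); have [M' hM'] := set_mem (valP y).
set f := (fun n => _).
have fub : (f @ w) `[0, M + M']%classic.
  rewrite /= /fmap; near=> n; rewrite /= in_itv /=; apply/andP; split.
    apply: divr_ge0; first exact: mdist_ge0.
    by apply: ltW; near: n; exact: scale_gt0.
  have s0 : 0 < cscale D n by near: n; exact: scale_gt0.
  rewrite ler_pdivrMr// mulrDl.
  apply: (le_trans (metric_triangle _ (cbase D n) _)).
  by apply: lerD; first (rewrite metric_sym; near: n; exact: hM);
    near: n; exact: hM'.
have fu : UltraFilter (f @ w).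
  split; first exact: fmap_proper_filter.
  move=> F FF fF; apply/seteqP; split => // A FA.
  have [//|hA] := in_ultra_setVsetC (f @^-1` A) (cultra_ultra D).
  have /fF FCA : (f @ w) (~` A) by [].
  have : F (A `&` ~` A) by exact: filterI.
  by rewrite setICr => /filter_not_empty.
have := @segment_compact R 0 (M + M'); rewrite compact_ultra.
move=> /(_ _ fu fub) [l [_ fl]].
by apply: cvgP fl.
Unshelve. all: by end_near. Qed.

Let cone_distxx x : cone_dist x x = 0.
Proof.
rewrite /cone_dist (_ : (fun n => _) = cst 0) ?lim_cst//.
by apply/funext => n /=; rewrite mdistxx mul0r.
Qed.

Let cone_dist_sym x y : cone_dist x y = cone_dist y x.
Proof.
by rewrite /cone_dist; congr (lim (_ @ w)); apply/funext => n; rewrite metric_sym.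
Qed.

Let cone_dist_triangle y x z : cone_dist x z <= cone_dist x y + cone_dist y z.
Proof.
have hD := cvgD (@cone_dist_cvg x y) (@cone_dist_cvg y z).
apply: (ler_cvg_to (@cone_dist_cvg x z) (hD _)).
near=> n; rewrite /= -mulrDl ler_wpM2r//; last exact: metric_triangle.
by rewrite invr_ge0; apply: ltW; near: n; exact: scale_gt0.
Unshelve. all: by end_near. Qed.

Let cone_dist_ge0 x y : 0 <= cone_dist x y.
Proof.
have := cone_dist_triangle y x x; rewrite cone_distxx (cone_dist_sym y x).
by rewrite -mulr2n pmulrn_lge0.
Qed.

Definition cone_eq (x y : set_type admissible) : bool := cone_dist x y == 0.

Let cone_eq_refl : reflexive cone_eq.
Proof. by move=> x; rewrite /cone_eq cone_distxx. Qed.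

Let cone_eq_sym : symmetric cone_eq.
Proof. by move=> x y; rewrite /cone_eq cone_dist_sym. Qed.

Let cone_eq_trans : transitive cone_eq.
Proof.
move=> y x z /eqP xy /eqP yz; rewrite /cone_eq eq_le cone_dist_ge0 andbT.
by apply: (le_trans (cone_dist_triangle y _ _)); rewrite xy yz addr0.
Qed.

Canonical cone_equiv := EquivRel cone_eq cone_eq_refl cone_eq_sym cone_eq_trans.

Definition asymptotic_cone : Type := {eq_quot cone_equiv}%qT.
HB.instance Definition _ := Choice.on asymptotic_cone.

Definition cone_pt (x : set_type admissible) : asymptotic_cone :=
  (\pi_({eq_quot cone_equiv}%qT) x)%qT.

Definition cone_mdist (x y : asymptotic_cone) : R :=
  cone_dist (repr (x : {eq_quot cone_equiv}%qT))
            (repr (y : {eq_quot cone_equiv}%qT)).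

Let cone_mdistxx x : cone_mdist x x = 0. Proof. exact: cone_distxx. Qed.

Let cone_mdist_pos x y : cone_mdist x y = 0 -> x = y.
Proof.
move=> /eqP xy; rewrite -[x](@reprK _ {eq_quot cone_equiv}%qT).
by rewrite -[y](@reprK _ {eq_quot cone_equiv}%qT); exact/eqquotP.
Qed.

Let cone_mdist_sym x y : cone_mdist x y = cone_mdist y x.
Proof. exact: cone_dist_sym. Qed.

Let cone_mdist_triangle y x z : cone_mdist x z <= cone_mdist x y + cone_mdist y z.
Proof. exact: cone_dist_triangle. Qed.

HB.instance Definition _ := isMetric.Build R asymptotic_cone
  cone_mdistxx cone_mdist_pos cone_mdist_sym cone_mdist_triangle.

Definition cone_limit (A : set X) : set asymptotic_cone :=
  [set cone_pt x | x in [set x : set_type admissible | forall n, A (val x n)]].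

End AsymptoticCone.
Arguments cone_limit {R X} D A.

Definition separated_by_cut_point (T : topologicalType) (x y : T) : Prop :=
  exists z : T, [/\ z <> x, z <> y & ~ connected_component (~` [set z]) x y].

(* A statement about all finite generating sets of K: it is meant for finitely
   generated K, with H undistorted in K, but presupposes neither. *)
Definition relatively_wide (R : realType) (G : groupType) (H K : set G) : Prop :=
  forall (S : genset K) (D : cone_data (word_space R S))
    (x y : asymptotic_cone D),
    cone_limit D [set k | H (val k)] x -> cone_limit D [set k | H (val k)] y ->
    ~ separated_by_cut_point x y.

Section Morse.
Context {R : realType}.

Definition halfline : Type := set_type (`[0, +oo[%classic : set R).
HB.instance Definition _ := Topological.on halfline.

Lemma halfline0_subproof : (0 : R) \in (`[0, +oo[%classic : set R).
Proof. by apply/mem_set; rewrite /= in_itv /= lexx. Qed.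

Definition halfline0 : halfline := SigSub halfline0_subproof.

Context {X : metricType R}.

Definition quasi_geodesic (C : R) (I : set R) (f : set_type I -> X) : Prop :=
  forall s t : set_type I,
    C^-1 * `|val s - val t| - C <= mdist (f s) (f t) <= C * `|val s - val t| + C.

Definition morse_gauge (N : R -> R) : Prop := forall C, 1 <= C -> 0 <= N C.

Definition morse_for (N : R -> R) (I : set R) (g : set_type I -> X) : Prop :=
  forall C, 1 <= C ->
  forall (a b : R) (f : set_type (`[a, b]%classic : set R) -> X),
    a <= b -> quasi_geodesic C f ->
    (forall s, val s = a \/ val s = b -> range g (f s)) ->
    forall s, exists t, mdist (f s) (g t) <= N C.

Definition morse (I : set R) (g : set_type I -> X) : Prop :=
  exists2 N, morse_gauge N & morse_for N g.

Definition geodesic_ray (g : halfline -> X) : Prop :=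
  forall s t, mdist (g s) (g t) = `|val s - val t|.

Definition finite_hausdorff_distance (A B : set X) : Prop :=
  exists r : R, (forall a, A a -> exists2 b, B b & mdist a b <= r) /\
                (forall b, B b -> exists2 a, A a & mdist a b <= r).

Lemma fhd_refl A : finite_hausdorff_distance A A.
Proof. by exists 0; split=> a Aa; exists a => //; rewrite mdistxx. Qed.

Lemma fhd_sym A B :
  finite_hausdorff_distance A B -> finite_hausdorff_distance B A.
Proof.
by move=> [r [h1 h2]]; exists r; split=> [b /h2|a /h1] [c ? ?];
  exists c => //; rewrite metric_sym.
Qed.

Lemma fhd_trans A B C : finite_hausdorff_distance A B ->
  finite_hausdorff_distance B C -> finite_hausdorff_distance A C.
Proof.
move=> [r [h1 h2]] [r' [h1' h2']]; exists (r + r'); split.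
  move=> a /h1[b /h1'[c Cc bc] ab]; exists c => //.
  exact: le_trans (metric_triangle a b c) (lerD ab bc).
move=> c /h2'[b /h2[a Aa ab] bc]; exists a => //.
exact: le_trans (metric_triangle a b c) (lerD ab bc).
Qed.

Definition morse_ray (p : X) : Type := set_type
  [set g : {compact-open, halfline -> X} |
    [/\ geodesic_ray g, g halfline0 = p & morse g]].

Context (p : X).
HB.instance Definition _ := Choice.on (morse_ray p).

Definition morse_ray_fun (g : morse_ray p) : {compact-open, halfline -> X} :=
  val g.

Definition asymptotic (g h : morse_ray p) : bool :=
  `[< finite_hausdorff_distance (range (morse_ray_fun g))
                                (range (morse_ray_fun h)) >].

Let asymptotic_refl : reflexive asymptotic.
Proof. by move=> g; apply/asboolP; exact: fhd_refl. Qed.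

Let asymptotic_sym : symmetric asymptotic.
Proof. by move=> g h; apply/asboolP/asboolP => /fhd_sym. Qed.

Let asymptotic_trans : transitive asymptotic.
Proof.
by move=> h g k /asboolP gh /asboolP hk; apply/asboolP; exact: fhd_trans gh hk.
Qed.

Canonical asymptotic_equiv :=
  EquivRel asymptotic asymptotic_refl asymptotic_sym asymptotic_trans.

Definition morse_boundary : Type := {eq_quot asymptotic_equiv}%qT.
HB.instance Definition _ := Choice.on morse_boundary.

Definition ray_class (g : morse_ray p) : morse_boundary :=
  (\pi_({eq_quot asymptotic_equiv}%qT) g)%qT.

Definition stratum (N : R -> R) : set morse_boundary :=
  [set ray_class g | g in [set g | morse_for N (morse_ray_fun g)]].

(* The quotient of the compact-open topology on the N-Morse rays: the set of
   N-Morse rays whose class lies in W is relatively open. *)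
Definition stratum_open (N : R -> R) (W : set morse_boundary) : Prop :=
  exists2 O : set {compact-open, halfline -> X}, open O &
    forall g : morse_ray p, morse_for N (morse_ray_fun g) ->
      (W (ray_class g) <-> O (morse_ray_fun g)).

Definition boundary_open (U : set morse_boundary) : Prop :=
  forall N, morse_gauge N -> stratum_open N (U `&` stratum N).

Let in_stratum N g : morse_for N (morse_ray_fun g) -> stratum N (ray_class g).
Proof. by move=> h; exists g. Qed.

Let boundary_openT : boundary_open setT.
Proof.
by move=> N _; exists setT => [|g /in_stratum ?]; [exact: openT|].
Qed.

Let boundary_openI : setI_closed boundary_open.
Proof.
move=> U V oU oV N hN; have [P oP hP] := oU N hN; have [Q oQ hQ] := oV N hN.
exists (P `&` Q) => [|g gN]; first exact: openI.
split=> [[[Ug Vg] Ng]|[/(hP g gN)[Ug Ng] /(hQ g gN)[Vg _]]]; last by [].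
by split; [exact/(hP g gN)|exact/(hQ g gN)].
Qed.

Let boundary_open_bigU (I : Type) (f : I -> set morse_boundary) :
  (forall i, boundary_open (f i)) -> boundary_open (\bigcup_i f i).
Proof.
move=> of_ N hN.
have /choice [P hP] : forall i, exists O : set {compact-open, halfline -> X},
  open O /\ forall g : morse_ray p, morse_for N (morse_ray_fun g) ->
      ((f i `&` stratum N) (ray_class g) <-> O (morse_ray_fun g)).
  by move=> i; have [P oP h] := of_ i N hN; exists P.
exists (\bigcup_i P i) => [|g gN].
  by apply: bigcup_open => i _; exact: (hP i).1.
split=> [[[i _ fi] Ng]|[i _ /((hP i).2 g gN)[fi Ng]]].
  by exists i => //; exact/((hP i).2 g gN).
by split=> //; exists i.
Qed.

HB.instance Definition _ := @isOpenTopological.Build morse_boundary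
  boundary_open boundary_openT boundary_openI boundary_open_bigU.

End Morse.
Arguments halfline : clear implicits.

Definition topological_embedding (A B : topologicalType) (f : A -> B) : Prop :=
  [/\ injective f, continuous f &
    forall U : set A, open U ->
      exists2 W : set B, open W & f @` U = range f `&` W].

Record conn_graph := ConnGraph {
  vertex :> choiceType;
  adj : rel vertex;
  adj_sym : symmetric adj;
  adj_irr : irreflexive adj;
  adj_conn : forall x y, exists2 q, path adj x q & last x q = y }.

Section Realisation.
Context {R : realType} {Gr : conn_graph}.
Implicit Types a b v : Gr.

(* Points are given by their barycentric coordinates. *)
Definition edge_point a b (t : R) : Gr -> R :=
  fun v => (1 - t) * (v == a)%:R + t * (v == b)%:R.

(* The closed edge from a to b, reduced to a point if a = b. *)
Definition on_edge a b (x : Gr -> R) : Prop :=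
  ((a == b) || adj a b) /\ exists2 t, 0 <= t <= 1 & x = edge_point a b t.

Definition realisation : Type :=
  set_type [set x : Gr -> R | exists a b, on_edge a b x].
HB.instance Definition _ := Choice.on realisation.

(* Chains from x to y of total length l, whose steps are segments contained in
   closed edges; in the coordinate of a, a closed edge [a, b] is isometric to
   the unit interval. *)
Inductive chain : realisation -> realisation -> R -> Prop :=
| chain_refl x : chain x x 0
| chain_step x y z l a b : on_edge a b (val x) -> on_edge a b (val y) ->
    chain y z l -> chain x z (`|val x a - val y a| + l).

(* The length metric, in which every edge has length 1. *)
Definition real_dist (x y : realisation) : R := inf [set l | chain x y l].

Lemma on_edge_vertex a : on_edge a a (edge_point a a 0).
Proof. by rewrite /on_edge eqxx; split=> //; exists 0; rewrite // lexx ler01. Qed.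

Definition vertex_point a : realisation :=
  SigSub (mem_set (ex_intro _ a (ex_intro _ a (on_edge_vertex a)))).

Let edge_pointE a b t v : v != a -> edge_point a b t v = t * (v == b)%:R.
Proof. by move=> /negbTE va; rewrite /edge_point va /= mulr0 add0r. Qed.

Let on_edge_coord a b v (x y : Gr -> R) : on_edge a b x -> on_edge a b y ->
  `|x v - y v| <= `|x a - y a|.
Proof.
move=> [_ [s _ ->]] [_ [t _ ->]]; have [->//|va] := eqVneq v a.
rewrite !(edge_pointE _ _ va); have [vb|_] := eqVneq v b; last first.
  by rewrite /= !mulr0 subrr normr0.
have ab : (a == b) = false by rewrite -vb eq_sym (negbTE va).
rewrite /edge_point eqxx ab /= !mulr1 !mulr0 !addr0 distrC.
by rewrite le_eqVlt; apply/orP; left; apply/eqP; congr (Num.norm _); ring.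
Qed.

Let chain_ge0 x y l : chain x y l -> 0 <= l.
Proof. by elim=> // {}x {}y z {}l a b _ _ _ l0; rewrite addr_ge0. Qed.

Let chain_coord x y l v : chain x y l -> `|val x v - val y v| <= l.
Proof.
elim=> [{}x|{}x {}y z {}l a b xe ye _ IH]; first by rewrite subrr normr0.
apply: (le_trans (ler_distD (val y v) _ _)).
by apply: lerD => //; exact: on_edge_coord xe ye.
Qed.

Let chain_cat x y z l m : chain x y l -> chain y z m -> chain x z (l + m).
Proof.
elim=> [{}x|{}x {}y t {}l a b xe ye _ IH] h; first by rewrite add0r.
by rewrite -addrA; apply: chain_step xe ye (IH h).
Qed.

Let chain_sym x y l : chain x y l -> chain y x l.
Proof.
elim=> [{}x|{}x {}y z {}l a b xe ye _ IH]; first exact: chain_refl.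
rewrite addrC; apply: (chain_cat IH); rewrite distrC -[X in chain _ _ X]addr0.
by apply: chain_step ye xe _; exact: chain_refl.
Qed.

Let on_edge_left a b : (a == b) || adj a b -> on_edge a b (edge_point a a 0).
Proof.
move=> ab; split=> //; exists 0; first by rewrite lexx ler01.
by apply/funext => v; rewrite /edge_point !mul0r.
Qed.

Let on_edge_right a b : (a == b) || adj a b -> on_edge a b (edge_point b b 0).
Proof.
move=> ab; split=> //; exists 1; first by rewrite lexx ler01.
by apply/funext => v; rewrite /edge_point subr0 subrr !mul0r add0r addr0.
Qed.

Let chain_to_vertex x : exists a l, chain x (vertex_point a) l.
Proof.
have [a [b xab]] := set_mem (valP x); exists a; eexists.
apply: (chain_step (a := a) (b := b)) (chain_refl _) => //.
exact: on_edge_left xab.1.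
Qed.

Let chain_vertices a b : exists l, chain (vertex_point a) (vertex_point b) l.
Proof.
have [q] := adj_conn a b; elim: q a => [|c q IH] a /=.
  by move=> _ ->; exists 0; exact: chain_refl.
move=> /andP[ac /IH{}IH] /IH[l hl]; eexists.
apply: (chain_step (a := a) (b := c)) hl.
  by apply: on_edge_left; rewrite ac orbT.
by apply: on_edge_right; rewrite ac orbT.
Qed.

Let chain_neq0 x y : [set l | chain x y l] !=set0.
Proof.
have [a [l xa]] := chain_to_vertex x; have [b [m yb]] := chain_to_vertex y.
have [k ab] := chain_vertices a b; exists (l + (k + m)) => /=.
exact: chain_cat xa (chain_cat ab (chain_sym yb)).
Qed.

Let real_distxx x : real_dist x x = 0.
Proof. by apply: nneg_inf_eq0; [exact: chain_ge0|exact: chain_refl]. Qed.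

Let real_dist_pos x y : real_dist x y = 0 -> x = y.
Proof.
move=> xy0; apply: val_inj; apply/funext => v; apply/eqP.
rewrite -subr_eq0 -normr_le0 -xy0; apply: lb_le_inf; first exact: chain_neq0.
by move=> l h; exact: chain_coord h.
Qed.

Let real_dist_sym x y : real_dist x y = real_dist y x.
Proof. by congr inf; apply/seteqP; split=> l /= /chain_sym. Qed.

Let real_dist_triangle y x z : real_dist x z <= real_dist x y + real_dist y z.
Proof.
apply: nneg_inf_triangle; [exact: chain_ge0|exact: chain_neq0..|].
by move=> l m; exact: chain_cat.
Qed.

HB.instance Definition _ := isMetric.Build R realisation
  real_distxx real_dist_pos real_dist_sym real_dist_triangle.

End Realisation.
Arguments realisation : clear implicits.

Section CayleyGraph.
Context {G : groupType} {H : set G} (S : genset H).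
Implicit Types x y : set_type H.

(* The simple Cayley graph, without loops or multiple edges. *)
Definition cayley_adj x y : bool := (x != y) &&
  `[< gens S ((val x)^-1 * val y)%g \/ gens S ((val x)^-1 * val y)^-1%g >].

Let cayley_adj_sym : symmetric cayley_adj.
Proof.
move=> x y; rewrite /cayley_adj eq_sym; congr andb.
by apply/asboolP/asboolP; rewrite !invgM !invgK; tauto.
Qed.

Let cayley_adj_irr : irreflexive cayley_adj.
Proof. by move=> x; rewrite /cayley_adj eqxx. Qed.

Let H_letter s : gens S s \/ gens S s^-1%g -> s \in H.
Proof.
have [_ SH] := gensP S; have HG := generates_group (gensP S).
have sub t : gens S t -> t \in H.
  by move=> St; apply/mem_set; rewrite -SH; exact: sub_gen_smallest.
move=> [/sub//|/sub sH]; rewrite -[s]invgK.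
exact: (group_closedV HG) sH.
Qed.

Let cayley_adj_conn x y : exists2 q, path cayley_adj x q & last x q = y.
Proof.
have HG := generates_group (gensP S).
have xyH : ((val x)^-1 * val y)%g \in H.
  by apply: (group_closedM HG); [exact: (group_closedV HG) (valP x)|exact: valP y].
have [w [wS wE]] := generates_word (gensP S) (set_mem xyH).
have {wE xyH} : val y = (val x * \prod_(s <- w) s)%g by rewrite wE mulVKg.
elim: w x wS => [|s w IH] x wS.
  by rewrite big_nil mulg1 => yx; exists [::] => //=; apply: val_inj.
rewrite big_cons mulgA => yE.
have sS : gens S s \/ gens S s^-1%g by apply: wS; rewrite mem_head.
have xsH : (val x * s)%g \in H.
  by apply: (group_closedM HG); [exact: valP x|exact: H_letter].
pose z : set_type H := SigSub xsH.
have [|q zq qy] := IH z _ yE.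
  by move=> t tw; apply: wS; rewrite inE tw orbT.
have [xz|xz] := eqVneq x z; first by exists q; rewrite xz.
exists (z :: q) => //=; rewrite zq andbT /cayley_adj xz /=.
by apply/asboolP; rewrite /= mulKg.
Qed.

Definition cayley : conn_graph :=
  ConnGraph cayley_adj_sym cayley_adj_irr cayley_adj_conn.

Definition cayley1 : cayley :=
  SigSub (generates_group (gensP S)).1.

End CayleyGraph.

Section RelativeMorseBoundary.
Context {R : realType} {G : groupType}.

Definition cayley_space (H : set G) (S : genset H) : metricType R :=
  realisation R (cayley S).

Definition cayley_boundary (H : set G) (S : genset H) : topologicalType :=
  morse_boundary (vertex_point (cayley1 S) : cayley_space S).

Context {H K : set G} (HK : H `<=` K) {SH : genset H} {SK : genset K}.
Variable i : cayley_space SH -> cayley_space SK.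

Definition extends_inclusion : Prop := forall h : cayley SH,
  i (vertex_point h) = vertex_point (sub_incl HK h : cayley SK).

Definition ray_image (g : morse_ray (vertex_point (cayley1 SH) : cayley_space SH))
  : set_type (`[0, +oo[%classic : set R) -> cayley_space SK :=
  i \o morse_ray_fun g.

Definition relative_morse_boundary : set (cayley_boundary SH) :=
  [set ray_class g | g in [set g | morse (ray_image g)]].

(* The class of h does not depend on the representative g, so f is unique; its
   existence forces every ray_image g to be at finite distance from a Morse ray. *)
Definition boundary_inclusion (f : cayley_boundary SH -> cayley_boundary SK)
  : Prop := forall g, exists h, f (ray_class g) = ray_class h /\
    finite_hausdorff_distance (range (morse_ray_fun h)) (range (ray_image g)).

End RelativeMorseBoundary.
Arguments cayley_space R {G H} S.
Arguments cayley_boundary R {G H} S.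

Definition is_tree (T : conn_graph) : Prop :=
  forall c : seq T, ucycle (@adj T) c -> (size c <= 2)%N.

Section TreeAction.
Context {G : groupType} {T : conn_graph} (act : G -> T -> T).

Definition simplicial_action : Prop :=
  [/\ forall p, act 1%g p = p,
      forall g h p, act (g * h)%g p = act g (act h p) &
      forall g p q, adj (act g p) (act g q) = adj p q].

Definition without_inversions : Prop :=
  forall g p q, adj p q -> ~ (act g p = q /\ act g q = p).

(* Without inversions, a point of the realisation of T that is fixed by G lies
   in an edge whose endpoints are fixed by G. *)
Definition has_global_fixed_point : Prop := exists p, forall g, act g p = p.

Definition splitting : Prop :=
  [/\ is_tree T, simplicial_action, without_inversions
    & ~ has_global_fixed_point].

Definition vertex_group (p : T) : set G := [set g | act g p = p].

(* The setwise stabiliser, which fixes p and q if there are no inversions. *)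
Definition edge_group (p q : T) : set G :=
  [set g | act g @` [set p; q] = [set p; q]].

End TreeAction.

(* Main.v *)
(** A quasi-geodesic is Morse if and only if it diverges superlinearly: a path that
    joins two of its points outside of a ball of radius [r] around a point between
    them has length superlinear in [r]. This divergence passes from the vertex group
    [V] to [G]. Following a path of [G] in the tree, one cuts it into excursions away
    from the vertex, and by the tree property an excursion leaves and returns through
    the same edge, so that its endpoints lie near one coset of an edge group [E].
    Undistortion of [E] bounds the distance of the endpoints in [V] by the length of
    the excursion, whence [V] is finitely generated and undistorted. Since no cut
    point of an asymptotic cone of [V] separates points of the limit of [E], an
    excursion that stays far from a point of [V] can be replaced by a path of [V] of
    comparable length that stays proportionally far from it. So Morse rays of [V] are
    Morse in [G], with a gauge that depends only on the original gauge. A Morse ray of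
    [G] at finite distance from the image of a ray of [V] is at uniformly bounded
    distance from it, so by the Arzela-Ascoli theorem the map of Morse boundaries is
    continuous, and closed, on each stratum. *)

Require Import Defs.
From HB Require Import structures.
From mathcomp Require Import all_boot all_order all_algebra.
From mathcomp Require Import all_classical all_reals all_analysis.
From mathcomp Require Import ring lra zify.

Set Implicit Arguments.
Unset Strict Implicit.
Unset Printing Implicit Defensive.

Import Order.TTheory GRing.Theory Num.Theory.
Import numFieldNormedType.Exports.

Local Open Scope classical_set_scope.
Local Open Scope ring_scope.

(** * Morse sets *)

(** The tree may have infinitely many orbits of edges, and [p] infinitely many neighbours.
    Finiteness comes from the generators of [G]: each moves [p] along one fixed finite path, so up
    to translation only finitely many edges at [p] are ever crossed, and constants can be maximised
    over them. Relative wideness is qualitative and sees one scale at a time: it gives a detour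
    around [m] only when the distance of [m] from the ends of the chord is at least a fixed fraction
    of the chord. Superlinear divergence fits this, because refuting it starts from a path of length
    at most [K * r]; every chord of an excursion is then at most linear in [r]. The topology of the
    boundary is tested stratum by stratum, so each new gauge may depend on the old gauge and on the
    quasi-isometry constants, but not on the ray. This is why the gauges and constants below are
    quantified before the sets, sequences and rays. The geometry of groups is done in the discrete
    word metrics. Cayley graphs enter only where rays are needed. *)

Section MorseSets.
Context {R : realType}.
Implicit Types (X Y : metricType R) (N : R -> R) (C D L : R).

(** The function is total on [R] and constrained on [[a, b]] only, which avoids subtypes of
    intervals. *)
Definition qg_on X C (a b : R) (f : R -> X) : Prop :=
  forall s t, a <= s <= b -> a <= t <= b ->
    C^-1 * `|s - t| - C <= mdist (f s) (f t) <= C * `|s - t| + C.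

(** A single value of the gauge: divergence produces the bound for one constant [C] at a time. *)
Definition morse_at X C (n : R) (A : set X) : Prop :=
  forall a b (f : R -> X), a <= b -> qg_on C a b f -> A (f a) -> A (f b) ->
  forall s, a <= s <= b -> exists2 x, A x & mdist (f s) x <= n.

Definition morse_set X N (A : set X) : Prop :=
  forall C, 1 <= C -> morse_at C (N C) A.

Definition qie X Y L (phi : X -> Y) : Prop := forall x y,
  L^-1 * mdist x y - L <= mdist (phi x) (phi y) <= L * mdist x y + L.

Definition hausdorff_le X D (A B : set X) : Prop :=
  (forall a, A a -> exists2 b, B b & mdist a b <= D) /\
  (forall b, B b -> exists2 a, A a & mdist a b <= D).

Lemma morse_forP X N (I : set R) (g : set_type I -> X) :
  morse_for N g <-> morse_set N (range g).
Proof.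
split=> hN C C1 a b f ab.
  move=> qf fa fb s sab.
  pose f' (u : set_type (`[a, b]%classic : set R)) := f (val u).
  have inab (u : set_type (`[a, b]%classic : set R)) : a <= val u <= b.
    by have /set_mem := valP u; rewrite /= in_itv.
  have s_in : s \in (`[a, b]%classic : set R) by apply/mem_set; rewrite /= in_itv.
  have [||t ut] := hN C C1 a b f' ab _ _ (SigSub s_in).
  - by move=> u v; apply: qf; exact: inab.
  - by move=> u; rewrite /f' => -[->|->].
  by exists (g t) => //; exists t.
move=> qf fab s.
have a_in : a \in (`[a, b]%classic : set R).
  by apply/mem_set; rewrite /= in_itv /= lexx ab.
pose g0 u : set_type (`[a, b]%classic : set R) :=
  insubd (SigSub a_in) u.
have g0E u : a <= u <= b -> val (g0 u) = u.
  move=> uab; rewrite /g0 val_insubd ifT//.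
  by apply/mem_set; rewrite /= in_itv.
have sab : a <= val s <= b by have /set_mem := valP s; rewrite /= in_itv.
have [|||x [t _ <-]] := hN C C1 a b (f \o g0) ab _ _ _ (val s) sab.
- by move=> u v uab vab /=; have := qf (g0 u) (g0 v); rewrite !g0E.
- by apply: fab; left; rewrite g0E// lexx ab.
- by apply: fab; right; rewrite g0E// lexx ab.
have -> : (f \o g0) (val s) = f s by congr f; apply: val_inj; rewrite g0E.
by exists t.
Qed.

(** The step function [f (truncn t)] is a quasi-geodesic on the reals. Rounding changes a difference
    of parameters by at most 1, which the factor 2 in the constant absorbs. *)
Lemma morse_at_discrete X C (n : R) (A : set X) : 1 <= C ->
  morse_at (2 * C) n A -> forall k (f : nat -> X),
  (forall i j, (i <= j)%N -> (j <= k)%N ->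
    C^-1 * (j%:R - i%:R) - C <= mdist (f i) (f j) <= C * (j%:R - i%:R) + C) ->
  A (f 0%N) -> A (f k) ->
  forall i, (i <= k)%N -> exists2 x, A x & mdist (f i) x <= n.
Proof.
move=> C1 hA k f qf f0 fk i ik.
pose g (t : R) := f (Num.truncn t).
have gE j : g j%:R = f j by rewrite /g natrK.
have [|||||x] := hA 0 k%:R g _ _ _ _ i%:R.
- by [].
- move=> s t; wlog st : s t / s <= t.
    move=> W hs ht; have [/W|/ltW /W] := leP s t; first exact.
    by rewrite distrC metric_sym; exact.
  move=> /andP[s0 sk] /andP[t0 tk].
  rewrite distrC ger0_norm ?subr_ge0//.
  have /andP[s1 s2] := truncn_itv s0; have /andP[t1 t2] := truncn_itv t0.
  have le1 : (Num.truncn s <= Num.truncn t)%N by rewrite le_truncn.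
  have le2 : (Num.truncn t <= k)%N by rewrite -[leqRHS](@natrK R) le_truncn.
  have /andP[h1 h2] := qf _ _ le1 le2.
  rewrite -!natr1 in s2 t2.
  rewrite /g; set u := (Num.truncn s)%:R in s1 s2 h1 h2.
  set v := (Num.truncn t)%:R in t1 t2 h1 h2.
  have Ci : C^-1 <= 1 by rewrite invf_le1 ?(lt_le_trans ltr01).
  have Ci0 : 0 < C^-1 by rewrite invr_gt0 (lt_le_trans ltr01).
  apply/andP; split.
    apply: le_trans h1; rewrite invfM.
    have : C^-1 * (t - s - 1) <= C^-1 * (v - u).
      by apply: ler_wpM2l; [exact: ltW|lra].
    have : 0 <= C^-1 * (t - s) by rewrite mulr_ge0 ?subr_ge0// ltW.
    set w := C^-1 in Ci Ci0 *; set q := t - s; nra.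
  apply: le_trans h2 _.
  have : C * (v - u) <= C * (t - s + 1).
    by apply: ler_wpM2l; [exact: le_trans C1|lra].
  have : 0 <= C * (t - s) by rewrite mulr_ge0 ?subr_ge0// (le_trans _ C1).
  set q := t - s; nra.
- by rewrite (_ : 0 = 0%:R)// gE.
- by rewrite gE.
- by rewrite ler0n ler_nat.
by rewrite gE; exists x.
Qed.

Lemma morse_pullback X Y L (phi : X -> Y) N : 1 <= L -> qie L phi ->
  morse_gauge N -> exists2 N', morse_gauge N' &
    forall A, morse_set N (phi @` A) -> morse_set N' A.
Proof.
move=> L1 hphi gN; have L0 : 0 < L by exact: lt_le_trans L1.
have Li1 : L^-1 <= 1 by rewrite invf_le1.
have Li0 : 0 < L^-1 by rewrite invr_gt0.
exists (fun C => L * (N (2 * (L * C)) + L)).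
  move=> C C1; have : 1 <= L * C by rewrite mulr_ege1.
  move=> LC1; have : 0 <= N (2 * (L * C)) by apply: gN; lra.
  by move=> ?; rewrite mulr_ge0//; lra.
move=> A hA C C1 a b f ab qf fa fb s sab.
have LC1 : 1 <= L * C by rewrite mulr_ege1.
have C0 : 0 < C by exact: lt_le_trans C1.
have [|||||_ [x Ax <-]] := hA (2 * (L * C)) _ a b (phi \o f) ab _ _ _ s.
- lra.
- move=> u v ua va /=; have /andP[q1 q2] := qf u v ua va.
  have /andP[p1 p2] := hphi (f u) (f v).
  have n0 := normr_ge0 (u - v); set w := `|u - v| in q1 q2 n0 *.
  set d := mdist (f u) (f v) in q1 q2 p1 p2.
  have LCC : C <= L * C by rewrite ler_peMl// ltW.
  have LCL : L <= L * C by rewrite ler_peMr// ltW.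
  apply/andP; split.
    apply: le_trans p1; rewrite !invfM.
    have : L^-1 * (C^-1 * w - C) <= L^-1 * d by rewrite ler_wpM2l// ltW.
    have : 0 <= L^-1 * (C^-1 * w) by rewrite !mulr_ge0// ?invr_ge0 ltW.
    have : L^-1 * C <= C by rewrite ler_piMl// ltW.
    rewrite -!mulrA !mulrBr; lra.
  apply: le_trans p2 _.
  have : L * d <= L * (C * w + C) by rewrite ler_wpM2l// ltW.
  have : 0 <= L * (C * w) by rewrite !mulr_ge0// ltW.
  rewrite -!mulrA mulrDr; lra.
- by exists (f a).
- by exists (f b).
- exact: sab.
move=> h; exists x => //; have /andP[p1 _] := hphi (f s) x.
rewrite -ler_pdivrMl//; rewrite /= in h; lra.
Qed.

Lemma morse_close X D N : 0 <= D -> morse_gauge N ->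
  exists2 N', morse_gauge N' & forall A B : set X,
    hausdorff_le D A B -> morse_set N A -> morse_set N' B.
Proof.
move=> D0 gN; exists (fun C => N (C + 2 * D) + 2 * D) => [C C1|].
  by rewrite addr_ge0 ?mulr_ge0// gN//; lra.
move=> A B [AB BA] hA C C1 a b f ab qf fa fb s sab.
have [a' Aa' da] := BA _ fa; have [b' Ab' db] := BA _ fb.
have CD1 : 1 <= C + 2 * D by lra.
(* Only the two endpoints are moved onto [A], at the cost of [2 * D] in the constant. If [a = b]
   both tests give [b'], which also lies in [A]. *)
pose g u := if u == b then b' else if u == a then a' else f u.
have gf u : mdist (g u) (f u) <= D.
  rewrite /g; case: (eqVneq u b) => [->//|_].
  by case: (eqVneq u a) => [->//|_]; rewrite mdistxx.
have [||||x Ax dx] := hA _ CD1 a b g ab _ _ _ s.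
- move=> u v ua va; have /andP[q1 q2] := qf u v ua va.
  have gu := gf u; have gv := gf v.
  have t1 := metric_triangle (g u) (f u) (g v).
  have t2 := metric_triangle (f u) (f v) (g v).
  have t3 := metric_triangle (f u) (g u) (f v).
  have t4 := metric_triangle (g u) (g v) (f v).
  rewrite (metric_sym (f v) (g v)) in t2; rewrite (metric_sym (f u) (g u)) in t3.
  have n0 := normr_ge0 (u - v); set w := `|u - v| in q1 q2 n0 *.
  have Dw : 0 <= D * w by exact: mulr_ge0.
  have : (C + 2 * D)^-1 * w <= C^-1 * w.
    by rewrite ler_wpM2r// lef_pV2 ?posrE//; lra.
  rewrite mulrDl => ?; apply/andP; split; lra.
- by rewrite /g; case: eqVneq => // _; rewrite eqxx.
- by rewrite /g eqxx.
- exact: sab.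
have [y By dy] := AB _ Ax; exists y => //.
have t1 := metric_triangle (f s) (g s) y; have t2 := metric_triangle (g s) x y.
by have := gf s; rewrite metric_sym; lra.
Qed.
End MorseSets.

(** * Walks and divergence *)

Lemma morse_image (R : realType) (X Y : metricType R) (L : R) (phi : X -> Y)
    (N : R -> R) : 1 <= L -> qie L phi ->
  (forall y, exists x, mdist y (phi x) <= L) ->
  morse_gauge N -> exists2 N', morse_gauge N' &
    forall A, morse_set N A -> morse_set N' (phi @` A).
Proof.
move=> L1 hphi surj gN; have [psi hpsi] := choice surj.
have L0 : 0 < L by exact: lt_le_trans L1.
have L2 : L <= L ^+ 2 by rewrite expr2 ler_peMr// ltW.
have L1' : 1 <= 3 * L ^+ 2 by lra.
have qpsi : qie (3 * L ^+ 2) psi.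
  move=> y y'; have /andP[q1 q2] := hphi (psi y) (psi y').
  have hy := hpsi y; have hy' := hpsi y'.
  have t1 := metric_triangle (phi (psi y)) y (phi (psi y')).
  have t2 := metric_triangle y y' (phi (psi y')).
  have t3 := metric_triangle y (phi (psi y)) y'.
  have t4 := metric_triangle (phi (psi y)) (phi (psi y')) y'.
  rewrite (metric_sym (phi (psi y)) y) in t1.
  rewrite (metric_sym (phi (psi y')) y') in t4.
  set d := mdist (psi y) _ in q1 q2 *; have d0 : 0 <= d by exact: mdist_ge0.
  have d'0 : 0 <= mdist y y' by exact: mdist_ge0.
  set d' := mdist y y' in t2 t3 d'0 *.
  apply/andP; split.
    rewrite lerBlDr ler_pdivrMl; last exact: lt_le_trans L1'.
    have : d' <= L * d + 3 * L by lra.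
    have : L * d <= 3 * L ^+ 2 * d by apply: ler_wpM2r => //; lra.
    have : 3 * L <= 3 * L ^+ 2 * (3 * L ^+ 2).
      by rewrite (le_trans _ (ler_peMr _ L1'))//; lra.
    rewrite mulrDr; lra.
  have : L^-1 * d <= d' + 3 * L by lra.
  rewrite ler_pdivrMl// mulrDr => h; apply: (le_trans h).
  have : L * d' <= 3 * L ^+ 2 * d' by rewrite ler_wpM2r//; lra.
  lra.
have [N1 gN1 hN1] := morse_pullback L1' qpsi gN.
have D0 : 0 <= L * (2 * L) by nra.
have [N2 gN2 hN2] := morse_close X D0 gN.
have [N3 gN3 hN3] := morse_pullback L1' qpsi gN2.
exists N3 => // A hA; apply: hN3; apply: hN2 hA.
have near x : mdist (psi (phi x)) x <= L * (2 * L).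
  have /andP[q1 _] := hphi (psi (phi x)) x.
  have h := hpsi (phi x); rewrite metric_sym in h.
  by rewrite -ler_pdivrMl//; lra.
split=> [x Ax|_ [_ [x Ax <-] <-]].
  by exists (psi (phi x)); [exists (phi x) => //; exists x|rewrite metric_sym].
by exists x => //; rewrite metric_sym.
Qed.

Section Walks.
Context {R : realType}.

Definition step (X : metricType R) : rel X := fun x y => mdist x y <= 1.

Definition walk (X : metricType R) (A : set X) (n : nat) (x y : X) : Prop :=
  exists p, [/\ path (@step X) x p, last x p = y, (size p <= n)%N &
                forall z, z \in x :: p -> A z].

(** The discrete substitute for a geodesic space; the bound [n] need not be attained. *)
Definition graphlike (X : metricType R) : Prop :=
  forall (x y : X) n, mdist x y <= n%:R -> walk setT n x y.

Lemma walk_refl (X : metricType R) (A : set X) n x : A x -> walk A n x x.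
Proof.
by move=> Ax; exists [::]; split=> // z; rewrite inE => /eqP ->.
Qed.

Lemma walk_cat (X : metricType R) (A : set X) n m x y z :
  walk A n x y -> walk A m y z -> walk A (n + m) x z.
Proof.
move=> [p [xp py pn pA]] [q [yq qz qm qA]]; exists (p ++ q); split.
- by rewrite cat_path xp py.
- by rewrite last_cat py.
- by rewrite size_cat leq_add.
- move=> t; rewrite -cat_cons mem_cat => /orP[/pA//|tq].
  by apply: qA; rewrite inE tq orbT.
Qed.

Lemma walk_sub (X : metricType R) (A B : set X) n m x y :
  A `<=` B -> (n <= m)%N -> walk A n x y -> walk B m x y.
Proof.
move=> AB nm [p [xp py pn pA]]; exists p; split=> //.
  exact: leq_trans nm.
by move=> z /pA /AB.
Qed.

Lemma walk_sym (X : metricType R) (A : set X) n x y :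
  walk A n x y -> walk A n y x.
Proof.
move=> [p [xp py pn pA]]; exists (rev (belast x p)); split.
- rewrite -py rev_path; apply: sub_path xp => u v.
  by rewrite /step metric_sym.
- case: p {xp pn pA} py => [//|z p] _ /=.
  by rewrite rev_cons last_rcons.
- by rewrite size_rev size_belast.
- move=> z; rewrite -py inE mem_rev => h; apply: pA.
  by rewrite lastI mem_rcons inE.
Qed.

Lemma walk_map (X Y : metricType R) (f : X -> Y) (A : set X) (B : set Y) n x y :
  (forall u v, mdist u v <= 1 -> mdist (f u) (f v) <= 1) ->
  (forall z, A z -> B (f z)) -> walk A n x y -> walk B n (f x) (f y).
Proof.
move=> f1 fAB [p [xp py pn pA]]; exists (map f p); split.
- by rewrite path_map; apply: sub_path xp => u v; exact: f1.
- by rewrite last_map py.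
- by rewrite size_map.
- by move=> _ /(mapP (s := x :: p)) [z /pA Az ->]; exact: fAB.
Qed.

Lemma path_dist (X : metricType R) (x : X) p z :
  path (@step X) x p -> z \in x :: p -> mdist x z <= (size p)%:R.
Proof.
elim: p x => [|y p IH] x /=; first by rewrite inE => _ /eqP ->; rewrite mdistxx.
move=> /andP[xy yp]; rewrite inE => /orP[/eqP ->|/(IH y yp) yz].
  by rewrite mdistxx.
have := metric_triangle x y z; rewrite /step in xy; rewrite -natr1; lra.
Qed.

Lemma walk_dist (X : metricType R) (A : set X) n x y :
  walk A n x y -> walk (A `&` [set z | mdist x z <= n%:R]) n x y.
Proof.
move=> [p [xp py pn pA]]; exists p; split=> // z zp; split; first exact: pA.
by rewrite /= (le_trans (path_dist xp zp))// ler_nat.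
Qed.

Lemma walk_end (X : metricType R) (A : set X) n x y :
  walk A n x y -> A x /\ A y.
Proof.
move=> [p [xp <- pn pA]]; split; apply: pA; first exact: mem_head.
exact: mem_last.
Qed.

Lemma walk_near (X : metricType R) (x y : X) (r : R) : graphlike X ->
  mdist x y <= r ->
  exists2 n, n%:R <= r + 1 & walk [set z | mdist x z <= r + 1] n x y.
Proof.
move=> gX xyr; have r0 : 0 <= r by exact: le_trans (mdist_ge0 _ _) xyr.
have /andP[h1 h2] := truncn_itv r0; rewrite -natr1 in h2.
exists (Num.truncn r).+1; first by rewrite -natr1; lra.
have h : mdist x y <= (Num.truncn r).+1%:R by rewrite -natr1; lra.
apply: walk_sub (leqnn _) (walk_dist (gX _ _ _ h)) => z [_ /= hz].
by rewrite -natr1 in hz; lra.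
Qed.

Definition qg_seq (X : metricType R) (L : R) (sigma : nat -> X) : Prop :=
  forall i j, (i <= j)%N ->
    L^-1 * (j%:R - i%:R) - L <= mdist (sigma i) (sigma j)
      <= L * (j%:R - i%:R) + L.

(** Contrapositive form: beyond the radius [r0], a detour around [sigma t0] has more than [K * r]
    steps. Divergence is superlinear when every [K] admits such an [r0]. *)
Definition diverges_at (X : metricType R) (K r0 : R) (sigma : nat -> X) :=
  forall t1 t0 t2 r n, (t1 <= t0 <= t2)%N ->
    walk [set z | r <= mdist (sigma t0) z] n (sigma t1) (sigma t2) ->
    n%:R <= K * r -> r <= r0.

(** In a path of minimal weight, the part between two points cannot weigh more than a shortest walk
    between them. As weights lie between 1 and [M], this bounds its number of steps by
    [M * (d + 1)]. *)
Lemma weighted_geodesic (X : metricType R) (w : X -> nat) (M : nat) (x y : X)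
    (p0 : seq X) : graphlike X -> (forall z, (0 < w z <= M)%N) ->
  path (@step X) x p0 -> last x p0 = y ->
  exists p, [/\ path (@step X) x p, last x p = y,
    (\sum_(z <- p) w z <= \sum_(z <- p0) w z)%N &
    forall i j, (i <= j)%N -> (j <= size p)%N ->
      let d := mdist (nth x (x :: p) i) (nth x (x :: p) j) in
      d <= (j - i)%:R <= M%:R * (d + 1)].
Proof.
move=> gX wM xp0 p0y.
pose P c := `[< exists p, [/\ path (@step X) x p, last x p = y &
                 \sum_(z <- p) w z = c]%N >].
have exP : exists c, P c by exists (\sum_(z <- p0) w z)%N; apply/asboolP; exists p0.
case: (ex_minnP exP) => c /asboolP[p [xp py pc]] cmin.
exists p; split=> //.
  by rewrite pc; apply: cmin; apply/asboolP; exists p0.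
move=> i j ij jp /=; set d := mdist _ _.
have takeE k : (k <= size p)%N -> last x (take k p) = nth x (x :: p) k.
  move=> kp; rewrite (last_nth x) size_takel//.
  by case: k kp => [//|k] kp /=; rewrite nth_take.
pose p1 := take i p; pose p2 := drop i (take j p); pose p3 := drop j p.
have pE : p = p1 ++ p2 ++ p3.
  by rewrite catA /p1 -(take_takel p ij) cat_take_drop cat_take_drop.
have l1 : last x p1 = nth x (x :: p) i by rewrite takeE// (leq_trans ij).
have l2 : last (last x p1) p2 = nth x (x :: p) j.
  by rewrite -last_cat /p1 -(take_takel p ij) cat_take_drop takeE.
have := xp; rewrite {1}pE !cat_path => /and3P[xp1 xp2 xp3].
have sz2 : size p2 = (j - i)%N by rewrite size_drop size_takel.
apply/andP; split.
  by rewrite /d -l2 -l1 -sz2; apply: path_dist => //; exact: mem_last.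
have [k kd [q [xq qy qk _]]] := walk_near gX (lexx d).
have : (\sum_(z <- p) w z <= \sum_(z <- p1 ++ q ++ p3) w z)%N.
  rewrite pc; apply: cmin; apply/asboolP; exists (p1 ++ q ++ p3); split=> //.
    by rewrite !cat_path xp1 l1 xq/= qy -l2.
  by rewrite !last_cat l1 qy -l2 -!last_cat -pE.
rewrite {1}pE !big_cat/= leq_add2l leq_add2r => le2.
have szw : (size p2 <= \sum_(z <- p2) w z)%N.
  rewrite -sum1_size; apply: leq_sum => z _.
  by case/andP: (wM z).
have wsz : (\sum_(z <- q) w z <= M * size q)%N.
  rewrite -sum1_size big_distrr/=; apply: leq_sum => z _.
  by rewrite muln1; case/andP: (wM z).
have : (j - i <= M * k)%N.
  rewrite -sz2 (leq_trans szw)// (leq_trans le2)// (leq_trans wsz)//.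
  by rewrite leq_mul2l qk orbT.
rewrite -(ler_nat R) natrM => h; apply: (le_trans h).
by rewrite ler_wpM2l.
Qed.

End Walks.

Lemma seq_max_le (D : nat -> nat) t1 t2 : (t1 <= t2)%N ->
  exists t0, (t1 <= t0 <= t2)%N /\
    forall t, (t1 <= t <= t2)%N -> (D t <= D t0)%N.
Proof.
elim: t2 => [|t2 IH].
  rewrite leqn0 => /eqP ->; exists 0%N; split=> // t.
  by rewrite leqn0 => /andP[_ /eqP ->].
rewrite leq_eqVlt => /orP[/eqP ->|].
  by exists t2.+1; rewrite leqnn; split=> // t; rewrite -eqn_leq => /eqP ->.
rewrite ltnS => /[dup] t12 /IH[t0 [t0b h]].
have [le|gt] := leqP (D t2.+1) (D t0).
  exists t0; split; first by lia.
  move=> t; have [->//|ne] := eqVneq t t2.+1 => ht; apply: h; lia.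
exists t2.+1; split; first by lia.
move=> t; have [->//|ne] := eqVneq t t2.+1 => ht.
by apply: leq_trans (ltnW gt); apply: h; lia.
Qed.

Section Divergence.
Context {R : realType} {X : metricType R}.
Variables (L : R).
Hypotheses (gX : graphlike X) (L1 : 1 <= L).

(* Give weight [M] to the points of the ball of radius [r] and weight 1 to the others.
   A path of minimal weight is a quasi-geodesic with constant [M], and it avoids the
   ball of radius [r / 2], because entering it costs more than the path outside. *)
Lemma morse_diverges (N : R -> R) : morse_gauge N ->
  forall K, exists r0, forall sigma : nat -> X, qg_seq L sigma ->
    morse_set N (range sigma) -> diverges_at K r0 sigma.
Proof.
(* Going from distance [r] down to [r / 2] costs more than [M * (r / 2)], which exceeds [K * r]
   because [M > 2 * |K|]. *)
move=> gN K; pose M := (Num.truncn (2 * `|K|)).+1.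
have K0 : 0 <= 2 * `|K| by rewrite mulr_ge0.
have MK : 2 * `|K| < M%:R by have /andP[] := truncn_itv K0.
have M1 : 1 <= M%:R :> R by rewrite ler1n.
set n2 := N (2 * M%:R); have n20 : 0 <= n2 by apply: gN; lra.
have L0 : 0 < L by exact: lt_le_trans L1.
pose R1 := n2 + 1 + L * (L * (2 * n2 + 1 + L)) + L.
have R10 : 0 <= R1 by rewrite /R1; nra.
exists (2 * R1) => sigma qs mo t1 t0 t2 r n /andP[t10 t02] wk nK.
have [r0|r0] := leP r 0; first lra.
set m := sigma t0 in wk; set x := sigma t1 in wk; set y := sigma t2 in wk.
have [xm _] := walk_end wk.
move: wk => [p0 [xp0 p0y p0n p0A]].
pose w z := if mdist m z < r then M else 1%N.
have wM z : (0 < w z <= M)%N by rewrite /w; case: ifP; rewrite /M ?leqnn.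
have [p [xp py pp0 pq]] := weighted_geodesic gX wM xp0 p0y.
have cp : (\sum_(z <- p) w z <= n)%N.
  rewrite (leq_trans pp0)// (leq_trans _ p0n)// -sum1_size.
  rewrite big_seq [leqRHS]big_seq leq_sum// => z zp0.
  by rewrite /w ltNge p0A// inE zp0 orbT.
(* A potential that grows along a step by at most the weight of the new point, so [phi] bounds from
   below the weight spent to come close to [m]. *)
pose phi z : R := M%:R * Num.max 0 (r - mdist m z).
have phi_le q u : path (@step R X) u q ->
    phi (last u q) <= phi u + (\sum_(z <- q) w z)%:R.
  elim: q u => [|v q IH] u /=; first by rewrite big_nil addr0.
  move=> /andP[uv /IH h]; rewrite big_cons natrD.
  apply: (le_trans h); rewrite addrA lerD2r /phi /w.
  rewrite /step in uv; have tr := metric_triangle m v u.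
  rewrite (metric_sym v u) in tr.
  case: ltP => hv.
    rewrite -[X in _ <= _ + X]mulr1 -mulrDr ler_wpM2l//.
    have : 0 <= Num.max 0 (r - mdist m u) by rewrite le_max lexx.
    have : r - mdist m u <= Num.max 0 (r - mdist m u) by rewrite le_max lexx orbT.
    rewrite ge_max; lra.
  have /max_idPl -> : r - mdist m v <= 0 by lra.
  have : 0 <= M%:R * Num.max 0 (r - mdist m u) by rewrite mulr_ge0// le_max lexx.
  lra.
have phix : phi x = 0.
  rewrite /phi; have /max_idPl -> : r - mdist m x <= 0 by rewrite /= in xm; lra.
  by rewrite mulr0.
pose alpha i := nth x (x :: p) i.
have far i : (i <= size p)%N -> r / 2 <= mdist m (alpha i).
  move=> ip; rewrite leNgt; apply/negP => hlt.
  have xpi : path (@step R X) x (take i p).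
    by move: xp; rewrite -{1}(cat_take_drop i p) cat_path => /andP[].
  have := phi_le _ _ xpi; rewrite phix add0r.
  have -> : last x (take i p) = alpha i.
    rewrite (last_nth x) size_takel//.
    by rewrite /alpha; case: i ip {hlt xpi} => [//|k] kp /=; rewrite nth_take.
  have h1 : M%:R * (r - mdist m (alpha i)) <= phi (alpha i).
    by rewrite ler_wpM2l// le_max lexx orbT.
  have h2 : (\sum_(z <- take i p) w z)%:R <= n%:R :> R.
    rewrite ler_nat (leq_trans _ cp)// -{2}(cat_take_drop i p) big_cat/=.
    exact: leq_addr.
  have h3 : M%:R * (r / 2) < M%:R * (r - mdist m (alpha i)).
    by rewrite ltr_pM2l ?(lt_le_trans ltr01)//; lra.
  have h4 : K * r <= `|K| * r by apply: ler_wpM2r; [exact: ltW|exact: ler_norm].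
  have h5 : 2 * `|K| * r < M%:R * r by rewrite ltr_pM2r.
  by move=> h6; lra.
have close i : (i <= size p)%N -> exists2 t, True & mdist (alpha i) (sigma t) <= n2.
  move=> ip.
  have [|i1 j1 ij jp|||v [t _ <-]] := @morse_at_discrete _ X M%:R n2 (range sigma)
    M1 _ (size p) alpha _ _ _ i ip.
  - by apply: mo; lra.
  - have /andP[h1 h2] := pq _ _ ij jp; rewrite -/(alpha _) -/(alpha _) in h1 h2.
    rewrite natrB// in h1 h2; have ij' : i1%:R <= j1%:R :> R by rewrite ler_nat.
    set d := mdist _ _ in h1 h2 *; apply/andP; split.
      rewrite lerBlDr ler_pdivrMl ?(lt_le_trans ltr01)//.
      apply: (le_trans h2); rewrite ler_wpM2l//; lra.
    have : j1%:R - i1%:R <= M%:R * (j1%:R - i1%:R) :> R by rewrite ler_peMl//; lra.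
    lra.
  - by exists t1.
  - by exists t2 => //; rewrite -/y -py (last_nth x).
  by exists t.
(* Discrete connectedness: the first point of [p] close to the part of [sigma] after [t0] is also,
   up to one step, close to the part before [t0]. The two parameters are then close to each other
   and enclose [t0], so [m] is near [p], and [R1] bounds the distance. *)
pose right i := `[< exists t, (t0 <= t)%N /\ mdist (alpha i) (sigma t) <= n2 >].
have exr : exists i, right i.
  exists (size p); apply/asboolP; exists t2; split=> //.
  by rewrite /alpha -(last_nth x) py mdistxx.
have [j /asboolP[t' [t0t' dt']] jmin] := ex_minnP exr.
have js : (j <= size p)%N.
  apply: jmin; apply/asboolP; exists t2; split=> //.
  by rewrite /alpha -(last_nth x) py mdistxx.
have [t [tt0 dt]] : exists t, (t <= t0)%N /\ mdist (alpha j) (sigma t) <= n2 + 1.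
  case: j js jmin dt' => [|j] js jmin dt'.
    by exists t1; split=> //; rewrite /alpha mdistxx; lra.
  have [t _ dt] := close j (ltnW js).
  exists t; split.
    rewrite leqNgt; apply/negP => tt0; suff : (j.+1 <= j)%N by rewrite ltnn.
    by apply: jmin; apply/asboolP; exists t; split=> //; exact: ltnW.
  have /andP[h1 _] := pq _ _ (leqnSn j) js.
  rewrite -/(alpha j) -/(alpha j.+1) subSnn in h1.
  have := metric_triangle (alpha j.+1) (alpha j) (sigma t).
  rewrite (metric_sym (alpha j.+1) (alpha j)); lra.
have tt' : (t <= t')%N by exact: leq_trans t0t'.
have /andP[q1 _] := qs _ _ tt'.
have /andP[_ q2] := qs _ _ tt0; rewrite -/m in q2.
have tr := metric_triangle (sigma t) (alpha j) (sigma t').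
rewrite (metric_sym (sigma t) (alpha j)) in tr.
have b1 : t'%:R - t%:R <= L * (2 * n2 + 1 + L) :> R.
  rewrite -ler_pdivrMl//; lra.
have b2 : t0%:R <= t'%:R :> R by rewrite ler_nat.
have b3 : L * (t0%:R - t%:R) <= L * (L * (2 * n2 + 1 + L)).
  by apply: ler_wpM2l; [exact: ltW|lra].
have := far j js; have := metric_triangle m (sigma t) (alpha j).
rewrite (metric_sym m (sigma t)) (metric_sym (sigma t) (alpha j)) /R1; lra.
Qed.

(** The parameter advances by at most 1 at a time; the images of two such parameters are at most
    [2 * C] apart and are joined by a short walk. *)
Lemma qg_walk C a b (f : R -> X) s s' : 1 <= C -> qg_on C a b f ->
  a <= s -> s <= s' -> s' <= b ->
  exists2 n, n%:R <= (2 * C + 1) * (s' - s + 1) &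
    walk [set z | exists2 u, a <= u <= b & mdist (f u) z <= 2 * C + 1] n (f s) (f s').
Proof.
move=> C1 qf as_ ss' s'b.
have : exists k, s' - s <= k%:R.
  exists (Num.truncn (s' - s)).+1; apply: ltW.
  by have /andP[] := truncn_itv (x := s' - s) ltac:(lra).
move=> [k0]; have : 0 <= s' - s by lra.
elim: k0 s as_ ss' => [|k IH] s as_ ss' h0 hk.
  have -> : s = s' by lra.
  exists 0%N; first by rewrite mulr_ge0//; lra.
  by apply: walk_refl; exists s'; rewrite ?mdistxx; lra.
have step1 u : s <= u -> u <= s' -> u <= s + 1 -> exists2 n, n%:R <= 2 * C + 1 &
    walk [set z | exists2 u, a <= u <= b & mdist (f u) z <= 2 * C + 1] n (f s) (f u).
  move=> su us' us1; have /andP[_ h] : _ && _ := qf s u ltac:(lra) ltac:(lra).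
  have su1 : `|s - u| <= 1 by rewrite ler_norml; lra.
  have h' : mdist (f s) (f u) <= 2 * C.
    have : C * `|s - u| <= C * 1 by rewrite ler_wpM2l//; lra.
    lra.
  have [n n1 wn] := walk_near gX h'; exists n => //.
  by apply: walk_sub wn => // z /= hz; exists s => //; lra.
have [le1|gt1] := leP s' (s + 1).
  have [|n n1 wn] := step1 s' ss' _ le1; first by [].
  exists n => //; apply: (le_trans n1).
  have : 0 <= (2 * C + 1) * (s' - s) by rewrite mulr_ge0//; lra.
  lra.
rewrite -natr1 in hk.
have [||||n n1 wn] := IH (s + 1); try lra.
have [|||m m1 wm] := step1 (s + 1); try lra.
exists (m + n)%N; first by rewrite natrD; lra.
exact: walk_cat wm wn.
Qed.

End Divergence.

(** Going from [t] towards [s] for [j] steps, but not beyond [s]. The walk of [diverges_morse]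
    either reaches the required distance or ends on the quasi-geodesic. *)
Lemma clamp_toward (s t j : nat) : exists t',
  [/\ (minn s t <= t' <= maxn s t)%N,
      t' = s \/ (t' = t + j)%N \/ (t' + j = t)%N,
      (t' <= t + j)%N & (t <= t' + j)%N].
Proof.
exists (if (s <= t)%N then maxn s (t - j) else minn s (t + j)).
by case: ifP => ?; split; lia.
Qed.

Lemma between_sub (s t t' t1 t2 : nat) : (t1 <= s <= t2)%N ->
  (t1 <= t <= t2)%N -> (minn s t <= t' <= maxn s t)%N -> (t1 <= t' <= t2)%N.
Proof. lia. Qed.

Lemma between_meet (t t' t'' t1 t2 : nat) : (t1 <= t <= t2)%N ->
  (minn t1 t <= t' <= maxn t1 t)%N -> (minn t2 t <= t'' <= maxn t2 t)%N ->
  (t' <= t <= t'')%N.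
Proof. lia. Qed.

Section DivergenceMorse.
Context {R : realType} {X : metricType R}.
Variables (L : R).
Hypotheses (gX : graphlike X) (L1 : 1 <= L).

(* Around a point of [sigma] farthest from the quasi-geodesic, at distance [r] from it,
   two points of [sigma] at distance comparable to [r] are joined through the
   quasi-geodesic outside of the ball of radius [r / 2]. *)
Lemma diverges_morse C : 1 <= C -> exists K, forall r0, exists2 n, 0 <= n &
  forall sigma : nat -> X, qg_seq L sigma -> diverges_at K r0 sigma ->
    morse_at C n (range sigma).
Proof.
move=> C1; have L0 : 0 < L by exact: lt_le_trans L1.
have C0 : 0 < C by exact: lt_le_trans C1.
have C21 : 0 <= 2 * C + 1 by lra.
have C2C : 0 <= C * (2 + C) by nra.
pose J := L * (L * (3 + L) + 1) + L.
have J0 : 0 <= J by rewrite /J; nra.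
pose K := 4 + (2 * C + 1) * (C * (4 + 2 * J + C) + 1).
exists (2 * K) => r0; pose Rb := 2 * `|r0| + 4 * C + 8.
have r0n := normr_ge0 r0.
have Rb0 : 0 <= Rb by rewrite /Rb; lra.
exists (C * (C * (2 * Rb + 2 * L + C)) + C + Rb).
  by rewrite !addr_ge0// ?mulr_ge0//; lra.
move=> sigma qs dv.
suff main a b (f : R -> X) t1 t2 : a <= b -> qg_on C a b f ->
    f a = sigma t1 -> f b = sigma t2 -> (t1 <= t2)%N ->
    forall s, a <= s <= b -> exists2 x, range sigma x &
      mdist (f s) x <= C * (C * (2 * Rb + 2 * L + C)) + C + Rb.
  move=> a b f ab qf [t1 _ fa] [t2 _ fb] s sab.
  have [t12|t21] := leqP t1 t2; first exact: main ab qf (esym fa) (esym fb) t12 s sab.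
  have [|||//||x xs] := main a b (fun u => f (a + b - u)) t2 t1 ab _ _ _ _ (a + b - s).
  - move=> u v ua va; have := qf (a + b - u) (a + b - v) ltac:(lra) ltac:(lra).
    by rewrite (_ : a + b - u - (a + b - v) = v - u) 1?distrC//; lra.
  - by rewrite -[RHS]/(sigma t2) fb; congr f; lra.
  - by rewrite -[RHS]/(sigma t1) fa; congr f; lra.
  - exact: ltnW.
  - lra.
  by rewrite (_ : a + b - (a + b - s) = s); [exists x|lra].
move=> ab qf fa fb t12.
(* [h t] is the distance from [sigma t] to the quasi-geodesic rounded up to an integer, so that
   minima and maxima exist without any continuity of [f]. *)
have [h [hP hmin]] : exists h : nat -> nat,
    (forall t, exists2 u, a <= u <= b & mdist (sigma t) (f u) <= (h t)%:R) /\
    (forall t k, (exists2 u, a <= u <= b & mdist (sigma t) (f u) <= k%:R) ->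
      (h t <= k)%N).
  have /choice [h hh] : forall t, exists k, (exists2 u, a <= u <= b &
      mdist (sigma t) (f u) <= k%:R) /\
      forall k', (exists2 u, a <= u <= b & mdist (sigma t) (f u) <= k'%:R) ->
      (k <= k')%N.
    move=> t; pose P k := `[< exists2 u, a <= u <= b &
      mdist (sigma t) (f u) <= k%:R >].
    have exP : exists k, P k.
      exists (Num.truncn (mdist (sigma t) (f a))).+1; apply/asboolP.
      exists a; first by rewrite lexx ab.
      by have /andP[_ /ltW] := truncn_itv (mdist_ge0 (sigma t) (f a)).
    have [k /asboolP kP kmin] := ex_minnP exP.
    by exists k; split=> // k' hk'; apply: kmin; exact/asboolP.
  by exists h; split=> t; have [] := hh t.
have [t0 [t0b hmax]] := seq_max_le h t12.
move: (h t0) hmax (hmin t0) => r hmax hrmin.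
have rRb : r%:R <= Rb.
  rewrite leNgt; apply/negP => rgt.
  have r1 : 1 <= r%:R :> R by rewrite /Rb in rgt; lra.
  set m := sigma t0.
  have far u : a <= u <= b -> r%:R - 1 < mdist m (f u).
    move=> ua; rewrite ltNge; apply/negP => le1.
    have rpos : (0 < r)%N by rewrite -(ler_nat R).
    suff : (r <= r.-1)%N by rewrite leqNgt prednK ?leqnn.
    apply: hrmin; exists u => //.
    by move: le1; rewrite -{1}(prednK rpos) -natr1 addrK.
  have qs' i j : mdist (sigma i) (sigma j) <= L * `|i%:R - j%:R| + L /\
      L^-1 * `|i%:R - j%:R| - L <= mdist (sigma i) (sigma j).
    have [ij|/ltnW ij] := leqP i j; have /andP[q1 q2] := qs _ _ ij.
      by rewrite distrC ger0_norm// subr_ge0 ler_nat.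
    by rewrite metric_sym ger0_norm// subr_ge0 ler_nat.
  (* The number of steps along [sigma] is chosen so that [sigma t'] is at distance at least
     [2 * r + 1] from [m]. A walk of length at most [r + 1] from there to [f] stays outside of the
     ball of radius [r / 2]. If [sigma] ends earlier, it ends on [f]. *)
  have half te ue : (t1 <= te <= t2)%N -> a <= ue <= b -> f ue = sigma te ->
      exists t' u n, [/\ (minn te t0 <= t' <= maxn te t0)%N, a <= u <= b,
        n%:R <= r%:R + 1 :> R, mdist (sigma t') m <= J * r%:R &
        walk [set z | r%:R / 2 <= mdist m z] n (sigma t') (f u)].
    move=> te12 ueab fue.
    have l0 : 0 <= L * (2 * r%:R + 1 + L) by rewrite mulr_ge0//; lra.
    have /andP[j1 j2] := truncn_itv l0; rewrite -natr1 in j2.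
    set j := (Num.truncn _) in j1 j2.
    have Jr : L * (L * (2 * r%:R + 1 + L) + 1) + L <= J * r%:R.
      have : L * (L * (1 + L)) <= L * (L * (1 + L)) * r%:R.
        by rewrite ler_peMr// !mulr_ge0//; lra.
      have : 2 * L <= 2 * L * r%:R by rewrite ler_peMr//; lra.
      rewrite /J; lra.
    have Lj : L * (j.+1%:R) <= L * (L * (2 * r%:R + 1 + L) + 1).
      by rewrite -natr1 ler_pM2l//; lra.
    have [t' [t'b e b1 b2]] := clamp_toward te t0 j.+1.
    have [[t'e|t'd] tb] : (t' = te \/ `|t'%:R - t0%:R| = j.+1%:R :> R) /\
        `|t'%:R - t0%:R| <= j.+1%:R :> R.
      rewrite -!(ler_nat R) !natrD in b1 b2.
      split; last by rewrite ler_norml; lra.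
      case: e => [->|e]; [by left|right].
      case: e => [->|<-]; rewrite natrD; [rewrite addrAC subrr add0r|].
        by rewrite ger0_norm.
      by rewrite opprD addNKr ?normrN ?ger0_norm//.
    - exists te, ue, 0%N; split=> //.
      + by rewrite geq_minl leq_maxl.
      + by rewrite addr_ge0.
      + have [q1 _] := qs' te t0; rewrite -t'e in q1 *.
        have : L * `|t'%:R - t0%:R| <= L * j.+1%:R by rewrite ler_pM2l.
        rewrite /m; lra.
      + rewrite -fue; apply: walk_refl => /=.
        by have := far _ ueab; rewrite /Rb in rgt; lra.
    - have ht' : (h t' <= r)%N by apply: hmax; exact: between_sub t'b.
      have [u uab du] := hP t'.
      have du' : mdist (sigma t') (f u) <= r%:R.
        by apply: (le_trans du); rewrite ler_nat.
      have [n nr wn] := walk_near gX du'.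
      have [q1 q2] := qs' t' t0; rewrite t'd in q1 q2.
      exists t', u, n; split=> //; first by rewrite /m; lra.
      apply: walk_sub wn => // z /= hz.
      have tr := metric_triangle (sigma t') z m; rewrite (metric_sym z) in tr.
      have : L^-1 * (L * (2 * r%:R + 1 + L)) <= L^-1 * j.+1%:R.
        by rewrite ler_pM2l ?invr_gt0// -natr1 ltW.
      rewrite mulKf ?gt_eqF// /m in tr *; lra.
  have [||t' [u [n1 [t'b uab n1r d1 w1]]]] := half t1 a _ _ fa.
  - by rewrite leqnn t12.
  - by rewrite lexx ab.
  have [||t'' [u' [n2 [t''b u'ab n2r d2 w2]]]] := half t2 b _ _ fb.
  - by rewrite leqnn t12.
  - by rewrite lexx ab.
  have e1 : mdist (sigma t') (f u) <= r%:R + 1.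
    case: w1 => p [xp <- pn _]; apply: (le_trans (path_dist xp (mem_last _ _))).
    by apply: le_trans n1r; rewrite ler_nat.
  have e2 : mdist (sigma t'') (f u') <= r%:R + 1.
    case: w2 => p [xp <- pn _]; apply: (le_trans (path_dist xp (mem_last _ _))).
    by apply: le_trans n2r; rewrite ler_nat.
  have duu : mdist (f u) (f u') <= 2 * (r%:R + 1) + 2 * (J * r%:R).
    have := metric_triangle (f u) (sigma t') (f u').
    have := metric_triangle (sigma t') m (f u').
    have := metric_triangle m (sigma t'') (f u').
    rewrite (metric_sym (f u) (sigma t')) (metric_sym m (sigma t'')); lra.
  have nuu : `|u - u'| <= C * (2 * (r%:R + 1) + 2 * (J * r%:R) + C).
    have /andP[q _] := qf u u' uab u'ab.
    rewrite -ler_pdivrMl//; lra.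
  have [n3 n3r w3] : exists2 n, n%:R <= (2 * C + 1) * (`|u - u'| + 1) &
      walk [set z | r%:R / 2 <= mdist m z] n (f u) (f u').
    have sub : [set z | exists2 v, a <= v <= b & mdist (f v) z <= 2 * C + 1] `<=`
        [set z | r%:R / 2 <= mdist m z].
      move=> z [v vab dv'] /=; have := far v vab.
      have := metric_triangle m z (f v); rewrite (metric_sym z).
      rewrite /Rb in rgt; lra.
    have /andP[au ub] := uab; have /andP[au' u'b] := u'ab.
    have [uu|/ltW uu] := leP u u'.
      have [n nn wn] := qg_walk gX C1 qf au uu u'b.
      exists n; last by apply: walk_sub wn.
      by rewrite distrC ger0_norm// subr_ge0.
    have [n nn wn] := qg_walk gX C1 qf au' uu ub.
    exists n; last by apply/walk_sym; apply: walk_sub wn.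
    by rewrite ger0_norm// subr_ge0.
  have := dv t' t0 t'' (r%:R / 2) (n1 + n3 + n2)%N _ _ _.
  rewrite (between_meet t0b t'b t''b).
  move=> /(_ isT (walk_cat (walk_cat w1 w3) (walk_sym w2))).
  suff : (n1 + n3 + n2)%:R <= 2 * K * (r%:R / 2).
    by move=> -> /(_ isT); have := ler_norm r0; rewrite /Rb in rgt; lra.
  rewrite !natrD (_ : 2 * K * (r%:R / 2) = K * r%:R); last by field.
  have : (2 * C + 1) * (`|u - u'| + 1) <=
      (2 * C + 1) * (C * (2 * (r%:R + 1) + 2 * (J * r%:R) + C) + 1).
    by apply: ler_wpM2l; [exact: C21|rewrite lerD2r].
  have : (2 * C + 1) * (C * (2 * (r%:R + 1) + 2 * (J * r%:R) + C) + 1) <=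
      (2 * C + 1) * (C * (4 + 2 * J + C) + 1) * r%:R.
    rewrite -[leRHS]mulrA ler_wpM2l//.
    have : C * (2 + C) <= C * (2 + C) * r%:R.
      by apply: ler_peMr.
    lra.
  rewrite /K; lra.
move=> s sab.
(* Now [sigma] stays near [f] between [t1] and [t2]; the converse is by connectedness. The first
   [sigma t] near a point [f u'] with [s <= u'] is also, via its predecessor, near some [f u] with
   [u <= s], which bounds [u' - u]. *)
pose right t := `[< (t1 <= t)%N /\ exists2 u, s <= u <= b &
                    mdist (sigma t) (f u) <= Rb >].
have r2 : right t2.
  apply/asboolP; split=> //; exists b; first lra.
  by rewrite fb mdistxx.
have exr : exists t, right t by exists t2.
have [t /asboolP[t1t [u' u'b du']] tmin] := ex_minnP exr.
have tt2 := tmin _ r2.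
have [u [uas du]] : exists u, a <= u <= s /\ mdist (sigma t) (f u) <= Rb + 2 * L.
  move: t1t; rewrite leq_eqVlt => /orP[/eqP t1t|t1t].
    by exists a; split; [lra|rewrite -t1t fa mdistxx; lra].
  have tE : t = t.-1.+1 by rewrite prednK// (leq_ltn_trans _ t1t).
  have [u uab du] := hP t.-1.
  have hr : (h t.-1 <= r)%N.
    by apply: hmax; rewrite -ltnS -tE t1t (leq_trans (leq_pred _) tt2).
  have du1 : mdist (sigma t.-1) (f u) <= Rb.
    by apply: (le_trans du); apply: le_trans rRb; rewrite ler_nat.
  exists u; split.
    have [us|us] := leP u s; first by have /andP[-> _] := uab.
    suff : (t <= t.-1)%N by rewrite {1}tE ltnn.
    apply: tmin; apply/asboolP; split; first by rewrite -ltnS -tE.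
    by exists u => //; lra.
  have /andP[_ q] := qs _ _ (leqnSn t.-1).
  rewrite -natr1 (addrC _ 1) addrK -tE in q.
  have := metric_triangle (sigma t) (sigma t.-1) (f u).
  rewrite (metric_sym (sigma t) (sigma t.-1)); lra.
exists (sigma t); first by exists t.
have /andP[q1 _] := qf u u' ltac:(lra) ltac:(lra).
have /andP[_ q2] := qf s u' sab ltac:(lra).
have duu : mdist (f u) (f u') <= 2 * Rb + 2 * L.
  have := metric_triangle (f u) (sigma t) (f u').
  rewrite (metric_sym (f u) (sigma t)); lra.
rewrite distrC ger0_norm in q1; last lra.
rewrite distrC ger0_norm in q2; last lra.
have : u' - u <= C * (2 * Rb + 2 * L + C) by rewrite -ler_pdivrMl//; lra.
move=> hu; have : C * (u' - s) <= C * (C * (2 * Rb + 2 * L + C)).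
  by rewrite ler_pM2l//; lra.
have := metric_triangle (f s) (f u') (sigma t).
rewrite (metric_sym (f u') (sigma t)); lra.
Qed.

End DivergenceMorse.

(** * Word metrics *)

Section Words.
Context {G : groupType}.
Implicit Types (S H K : set G) (g h : G).

(** Word length at most [n], as a statement about naturals instead of a real infimum; [word_mdistP]
    relates the two. *)
Definition wle S (n : nat) g : Prop :=
  exists w, [/\ word_over S w, (size w <= n)%N & (\prod_(s <- w) s)%g = g].

Lemma wle_mono S n m g : (n <= m)%N -> wle S n g -> wle S m g.
Proof. by move=> nm [w [wS wn wg]]; exists w; split=> //; exact: leq_trans nm. Qed.

Lemma wle1 S n : wle S n 1%g.
Proof. by exists [::]; split=> //; rewrite big_nil. Qed.

Lemma wleM S n m g h : wle S n g -> wle S m h -> wle S (n + m) (g * h)%g.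
Proof.
move=> [w [wS wn <-]] [v [vS vm <-]]; exists (w ++ v); split.
- exact: word_over_cat.
- by rewrite size_cat leq_add.
- by rewrite prodg_cat.
Qed.

Lemma wleV S n g : wle S n g -> wle S n g^-1%g.
Proof.
move=> [w [wS wn <-]]; exists [seq s^-1%g | s <- rev w]; split.
- exact: word_over_inv.
- by rewrite size_map size_rev.
- by rewrite prodg_inv.
Qed.

Lemma wle_gen S g : S g \/ S g^-1%g -> wle S 1 g.
Proof.
move=> Sg; exists [:: g]; split=> //; last by rewrite big_cons big_nil mulg1.
by move=> s; rewrite inE => /eqP ->.
Qed.

Lemma wle_prod S n (w : seq G) : (forall s, s \in w -> wle S n s) ->
  wle S (size w * n) (\prod_(s <- w) s)%g.
Proof.
elim: w => [|s w IH] h; first by rewrite big_nil; exact: wle1.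
rewrite big_cons mulSn; apply: wleM; first by apply: h; rewrite mem_head.
by apply: IH => t tw; apply: h; rewrite inE tw orbT.
Qed.

Section Genset.
Variables (H : set G) (S : genset H).

Lemma genset1 : H 1%g.
Proof. exact/set_mem/(generates_group (gensP S)).1. Qed.

Lemma gensetM g h : H g -> H h -> H (g * h)%g.
Proof.
move=> Hg Hh; apply/set_mem.
by apply: (group_closedM (generates_group (gensP S))); exact/mem_set.
Qed.

Lemma gensetV g : H g -> H g^-1%g.
Proof.
move=> Hg; apply/set_mem.
by apply: (group_closedV (generates_group (gensP S))); exact/mem_set.
Qed.

Lemma genset_wle g : H g -> exists n, wle S n g.
Proof.
by move=> Hg; have [w [wS wg]] := generates_word (gensP S) Hg; exists (size w), w.
Qed.

Lemma genset_gen s : gens S s -> H s.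
Proof. by move=> Ss; have [_ <-] := gensP S; exact: sub_gen_smallest. Qed.

Lemma wle_genset n g : wle S n g -> H g.
Proof.
move=> [w [wS _ <-]]; elim: w wS => [|s w IH] wS.
  by rewrite big_nil; exact: genset1.
rewrite big_cons; apply: gensetM; last first.
  by apply: IH => t tw; apply: wS; rewrite inE tw orbT.
have [/genset_gen//|/genset_gen/gensetV] := wS s (mem_head _ _).
by rewrite invgK.
Qed.

Lemma finite_wle (F : set G) : finite_set F -> F `<=` H ->
  exists n, forall g, F g -> wle S n g.
Proof.
move=> /finite_seqP[s ->]; elim: s => [|g s IH] sH; first by exists 0%N.
have [|n hn] := IH; first by move=> h hs; apply: sH; rewrite /= inE (hs : h \in s) orbT.
have [|m hm] := genset_wle (g := g); first by apply: sH; rewrite /= mem_head.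
exists (n + m)%N => h /=; rewrite inE => /orP[/eqP ->|/hn].
  by apply: wle_mono hm; rewrite leq_addl.
by apply: wle_mono; rewrite leq_addr.
Qed.

End Genset.

Lemma wle_sub H K (SH : genset H) (SK : genset K) : H `<=` K ->
  exists c, forall n g, wle SH n g -> wle SK (n * c) g.
Proof.
move=> HK; have [fS _] := gensP SH.
have [||c hc] := @finite_wle K SK (gens SH `|` [set g | gens SH g^-1%g]).
- rewrite finite_setU; split=> //.
  rewrite (_ : [set _ | _] = [set g^-1%g | g in gens SH]); first exact: finite_image.
  apply/seteqP; split=> [g /= h|_ [g Sg <-]] /=; last by rewrite invgK.
  by exists g^-1%g => //; rewrite invgK.
- move=> g [/genset_gen/HK//|/genset_gen /(gensetV SH)].
  by rewrite invgK => /HK.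
exists c => n g [w [wS wn <-]]; apply: wle_mono (leq_mul wn (leqnn c)) _.
by apply: wle_prod => s /wS h; exact: hc.
Qed.

End Words.

Section WordSpaces.
Context {R : realType} {G : groupType} {H : set G} (S : genset H).
Local Notation X := (word_space R S).

Lemma word_exists (x y : X) :
  exists w, word_over S w /\ (\prod_(s <- w) s)%g = ((val x)^-1 * val y)%g.
Proof.
apply: (generates_word (gensP S)).
by apply: (gensetM S); [apply: (gensetV S)|]; apply/set_mem; exact: valP.
Qed.

(** The infimum is over a set of naturals: if no word has length at most [n], all of them have
    length at least [n.+1]. *)
Lemma word_mdistP (x y : X) n :
  mdist x y <= n%:R <-> wle S n ((val x)^-1 * val y)%g.
Proof.
split; last first.
  move=> [w [wS wn wg]]; apply: (@le_trans _ _ (size w)%:R); last by rewrite ler_nat.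
  by apply: ge_inf; [exists 0 => _ [v _ <-]; exact: ler0n|exists w].
move=> hn; apply: contrapT => hw.
suff : n.+1%:R <= mdist x y.
  by move=> h; have := le_trans h hn; rewrite ler_nat ltnn.
apply: lb_le_inf; first by have [w [wS wg]] := word_exists x y; exists (size w)%:R, w.
move=> _ [w [wS wg] <-]; rewrite ler_nat ltnNge; apply/negP => wn.
by apply: hw; exists w.
Qed.

Lemma word_mdist_nat (x y : X) : exists n, mdist x y = n%:R.
Proof.
have [w [wS wg]] := word_exists x y.
pose P m := `[< wle S m ((val x)^-1 * val y)%g >].
have exP : exists m, P m by exists (size w); apply/asboolP; exists w.
have [m /asboolP mP mmin] := ex_minnP exP.
exists m; apply/eqP; rewrite eq_le (word_mdistP _ _ _).2//=.
apply: lb_le_inf; first by exists (size w)%:R, w.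
move=> _ [v [vS vg] <-]; rewrite ler_nat; apply: mmin; apply/asboolP.
by exists v.
Qed.

Lemma word_graphlike : graphlike X.
Proof.
move=> x y n /word_mdistP [w [wS wn]].
move=> /(congr1 (fun g => (val x * g)%g)); rewrite mulVKg.
elim: w n x wS wn => [|s w IH] n x wS wn.
  by rewrite big_nil mulg1 => /val_inj ->; exact: walk_refl.
case: n wn => [//|n] wn; rewrite big_cons mulgA => xyE.
have sS : gens S s \/ gens S s^-1%g by apply: wS; rewrite mem_head.
have Hs : H s by apply: wle_genset (wle_gen sS).
have zH : H (val x * s)%g by apply: (gensetM S) => //; exact/set_mem/valP.
pose z : X := SigSub (mem_set zH).
have [|p [zp py pn _]] := IH n z _ wn xyE.
  by move=> t tw; apply: wS; rewrite inE tw orbT.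
exists (z :: p); split=> //=; rewrite zp andbT.
by apply/(word_mdistP x z 1); rewrite /= mulKg; exact: wle_gen.
Qed.

Definition word_mul (h : X) (x : X) : X := SigSub (mem_set
  (gensetM S (set_mem (valP h)) (set_mem (valP x)))).

Lemma word_mul_mdist (h x y : X) : mdist (word_mul h x) (word_mul h y) = mdist x y.
Proof.
rewrite {1}/mdist /= /word_dist /= invgM.
by rewrite -mulgA (mulgA (val h)^-1%g) mulVg mul1g.
Qed.

End WordSpaces.

(** * Excursions in the tree *)

(** Made simple, a path from [q] to [q'] that avoids [p] closes up through [p] to a cycle, which in
    a tree has at most two vertices. *)
Lemma tree_branch (T : conn_graph) (p q q' : T) (l : seq T) : is_tree T ->
  adj p q -> adj p q' -> path (@adj T) q l -> last q l = q' ->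
  p \notin q :: l -> q = q'.
Proof.
move=> tree pq pq' ql lq' pl; move: lq'; case: (shortenP ql) => l' ql' ul' sub lq'.
have : ucycle (@adj T) (p :: q :: l').
  rewrite /ucycle /= pq rcons_path ql' lq' adj_sym pq' /=.
  rewrite -[X in _ && X]/(uniq (q :: l')) ul' andbT.
  apply: contra pl; rewrite !inE => /orP[->//|/sub ->].
  by rewrite orbT.
move=> /tree; case: l' {ql' ul' sub} lq' => [//|? ?] /=.
by rewrite !ltnS ltn0.
Qed.

Section TreeChain.
Context {G : groupType} {T : conn_graph} (act : G -> T -> T) (p : T).
Variable SG : genset [set: G].
Hypothesis act_split : splitting act.
Local Notation V := (vertex_group act p).

Let tree : is_tree T. Proof. by case: act_split. Qed.
Let act1 q : act 1%g q = q. Proof. by case: act_split => _ [-> _ _]. Qed.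
Let actM g h q : act (g * h)%g q = act g (act h q).
Proof. by case: act_split => _ [_ -> _]. Qed.
Let act_adj g q r : adj (act g q) (act g r) = adj q r.
Proof. by case: act_split => _ [_ _ ->]. Qed.
Let actK g q : act g^-1%g (act g q) = q. Proof. by rewrite -actM mulVg act1. Qed.
Let actVK g q : act g (act g^-1%g q) = q. Proof. by rewrite -actM mulgV act1. Qed.

Lemma edge_groupP q g : adj p q ->
  edge_group act p q g <-> act g p = p /\ act g q = q.
Proof.
move=> pq; have [_ _ noinv _] := act_split; rewrite /edge_group /=; split; last first.
  by move=> [gp gq]; rewrite image_setU !image_set1 gp gq.
rewrite image_setU !image_set1 => h.
have hp : [set p; q] (act g p) by rewrite -h; left.
have hq : [set p; q] (act g q) by rewrite -h; right.
have pq' : p <> q by move=> e; move: pq; rewrite e adj_irr.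
have inj x y : act g x = act g y -> x = y by move=> /(congr1 (act g^-1%g)); rewrite !actK.
case: hp hq => /= gp [] /= gq //.
- by case: pq'; apply: inj; rewrite gp gq.
- by case: (noinv g p q pq).
- by case: pq'; apply: inj; rewrite gp gq.
Qed.

Lemma vertex_groupM g h : V g -> V h -> V (g * h)%g.
Proof. by rewrite /vertex_group /= actM => gp ->. Qed.

Lemma vertex_groupV g : V g -> V g^-1%g.
Proof. by rewrite /vertex_group /= => gp; rewrite -{1}gp actK. Qed.

Variables (C : set T) (k : T -> G).
Hypothesis kP : forall g, act (k (act g p)) p = act g p.

(* A flag [(g, c)] stands for the point [g c] of the tree. A letter [s] is followed from
   [(g, p)] by moving the second component along the path from [p] to [s p], and then
   passing from [(g, s p)] to [(g s, p)]. *)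
Definition flag_point (f : G * T) : T := act f.1 f.2.
(** The correction by [k] makes this an element of the vertex group when the flag lies over [p],
    close to [f.1] when [f.2] is in [C]. *)
Definition flag_elt (f : G * T) : G := (f.1 * k f.2)%g.

Definition letter (s : G) : Prop := gens SG s \/ gens SG s^-1%g.

Definition flag_step (f f' : G * T) : Prop :=
  f'.1 = f.1 /\ adj f.2 f'.2 \/
  exists s, [/\ letter s, f.2 = act s p, f'.1 = (f.1 * s)%g & f'.2 = p].

Inductive flag_walk (A : set G) : nat -> G * T -> G * T -> Prop :=
| flag_walk0 f : A f.1 -> C f.2 -> flag_walk A 0 f f
| flag_walkS f f' f'' n : A f.1 -> C f.2 -> flag_step f f' ->
    flag_walk A n f' f'' -> flag_walk A n.+1 f f''.

Lemma flag_walk_cat A n m f f' f'' :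
  flag_walk A n f f' -> flag_walk A m f' f'' -> flag_walk A (n + m) f f''.
Proof.
elim=> [//|{}f g {}f' {}n Af Cf fg _ IH] h; rewrite addSn.
exact: flag_walkS fg (IH h).
Qed.

Lemma flag_walk_start A n f f' : flag_walk A n f f' -> A f.1 /\ C f.2.
Proof. by case. Qed.

Lemma flag_step_wle f f' : flag_step f f' -> wle SG 1 (f.1^-1 * f'.1)%g.
Proof.
move=> [[-> _]|[s [sl _ -> _]]]; first by rewrite mulVg; exact: wle1.
by rewrite mulKg; exact: wle_gen.
Qed.

Lemma flag_step_point f f' : flag_step f f' ->
  flag_point f = flag_point f' \/ adj (flag_point f) (flag_point f').
Proof.
rewrite /flag_point => -[[-> ?]|[s [_ -> -> ->]]]; first by right; rewrite act_adj.
by left; rewrite actM.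
Qed.

Lemma flag_elt_vertex f : flag_point f = p -> V (flag_elt f).
Proof.
move=> fp; rewrite /vertex_group /flag_elt /= actM.
have -> : f.2 = act f.1^-1%g p by rewrite -{1}fp /flag_point actK.
by rewrite kP actVK.
Qed.

(** The flag [h'] is the first one back over [p], and [h] the one just before it. *)
Lemma excursion A n f f'' : flag_walk A n f f'' -> flag_point f'' = p ->
  flag_point f <> p -> exists m h h' l,
  [/\ (m < n)%N, path (@adj T) (flag_point f) l,
      last (flag_point f) l = flag_point h, p \notin flag_point f :: l &
  [/\ flag_step h h', flag_point h' = p, C h.2, wle SG m.+1 (f.1^-1 * h'.1)%g &
      flag_walk A (n - m.+1) h' f'']].
Proof.
elim=> [g Ag Cg -> //|{}f f' {}f'' {}n Af Cf ff' wf IH] f''p fp.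
have [f'p|/eqP f'p] := eqVneq (flag_point f') p.
  exists 0%N, f, f', [::]; split=> //.
    by rewrite inE eq_sym; exact/eqP.
  by rewrite subn1; split=> //; exact: flag_step_wle.
have [m [h [h' [l [mn fl lh pl [hh' h'p Ch hm wh]]]]]] := IH f''p f'p.
have wm : wle SG m.+2 (f.1^-1 * h'.1)%g.
  rewrite -[h'.1](mulVKg f'.1) mulgA -[m.+2]add1n.
  by apply: wleM hm; exact: flag_step_wle.
have pf : p \notin flag_point f :: flag_point f' :: l.
  by rewrite inE negb_or pl andbT eq_sym; exact/eqP.
have [e|e] := flag_step_point ff'.
  exists m.+1, h, h', l; rewrite e; split=> //.
by exists m.+1, h, h', (flag_point f' :: l); split=> //=; rewrite e.
Qed.

(** [E] contains the neighbours of [p] obtained by translating back the edges that flags cross. [F]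
    contains the elements of the vertex group that match two of them in one orbit, and the
    corrections of the letters that stay over [p]. *)
Variables (E : set T) (F : set G) (B : nat).
Hypothesis EP : forall c c', C c -> C c' ->
  adj p (act (k c)^-1%g c') -> E (act (k c)^-1%g c').
Hypothesis Ftr : forall q q', E q -> E q' ->
  (exists g, V g /\ act g q' = q) -> exists t, [/\ F t, V t & act t q' = q].
Hypothesis Fs : forall s, letter s -> V ((k (act s p))^-1 * s)%g ->
  F ((k (act s p))^-1 * s)%g.
Hypothesis k1 : k p = 1%g.
Hypothesis kB : forall c, C c -> wle SG B (k c).

Definition Gnear (A : set G) (v : G) : Prop := exists2 g, A g & wle SG B (g^-1 * v)%g.

Lemma flag_near A f : A f.1 -> C f.2 -> Gnear A (flag_elt f).
Proof. by move=> Af Cf; exists f.1 => //; rewrite mulKg; exact: kB. Qed.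

(** The relation [P] is left abstract because the decomposition serves twice: to measure elements of
    the vertex group by generators, and to build walks that avoid a ball. The summand [2 * B] pays
    for passing from flags to elements at both ends of a step. *)
Lemma flag_chain (A : set G) (P : G -> G -> nat -> Prop) :
  (forall x y z n m, P x y n -> P y z m -> P x z (n + m)%N) ->
  (forall x, V x -> Gnear A x -> P x x 0%N) ->
  (forall x e t n, V x -> Gnear A x -> Gnear A (x * (e * t))%g -> (0 < n)%N ->
     F t -> V t -> (e = 1%g \/ exists q, [/\ E q, adj p q & edge_group act p q e]) ->
     wle SG (n + 2 * B) (e * t)%g -> P x (x * (e * t))%g n) ->
  forall n f f', flag_walk A n f f' -> flag_point f = p -> flag_point f' = p ->
    P (flag_elt f) (flag_elt f') n.
Proof.
move=> Padd P0 Pstep; elim/ltn_ind => n IH f f'' wf fp f''p.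
have Vf := flag_elt_vertex fp; have [Af Cf] := flag_walk_start wf.
have {wf} : (exists2 f', flag_step f f' & exists2 m, n = m.+1 & flag_walk A m f' f'') \/
    n = 0%N /\ f = f''.
  case: wf {IH fp f''p Vf Af Cf} => [|{}f g {}f'' {}n _ _ fg wg]; first by right.
  by left; exists g => //; exists n.
case=> [[f' ff' [m nm wf]]|[-> <-]]; last by apply: P0 => //; exact: flag_near.
have [Af' Cf'] := flag_walk_start wf.
have [f'p|/eqP f'p] := eqVneq (flag_point f') p.
  have Vf' := flag_elt_vertex f'p.
  have PE := IH m _ _ _ wf f'p f''p; rewrite nm -add1n; apply: Padd (PE _); last first.
    by rewrite nm.
  have xE : flag_elt f' = (flag_elt f * (1 * ((flag_elt f)^-1 * flag_elt f')))%g.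
    by rewrite mul1g mulVKg.
  (* Two consecutive flags over [p] differ by a letter, since a step along a tree edge changes the
     point. *)
  have tE : exists2 s, letter s & C (act s p) /\
      ((flag_elt f)^-1 * flag_elt f' = (k (act s p))^-1 * s)%g.
    case: ff' => [[e a]|[s [sl f2 f'1 f'2]]].
      move: fp f'p; rewrite /flag_point e => fp f'p.
      by move: a; rewrite -(act_adj f.1) fp f'p adj_irr.
    exists s => //; split; first by rewrite -f2.
    rewrite /flag_elt f'1 f'2 f2 k1 mulg1 invgM -!mulgA.
    by rewrite mulKg.
  have Vt : V ((flag_elt f)^-1 * flag_elt f')%g.
    by apply: vertex_groupM => //; exact: vertex_groupV.
  rewrite xE; apply: Pstep => //; first exact: flag_near.
  - by rewrite -xE; exact: flag_near.
  - by case: tE => s sl [_ tE]; rewrite tE; apply: Fs => //; rewrite -tE.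
  - by left.
  - case: tE => s sl [Cs ->]; rewrite mul1g; apply: (@wle_mono _ _ (B + 1)); first by lia.
    by apply: wleM; [apply: wleV; exact: kB|exact: wle_gen].
have [m' [h [h' [l [m'm fl lh pl [hh' h'p Ch hm wh]]]]]] := excursion wf f''p f'p.
have [f'1 ffa] : f'.1 = f.1 /\ adj f.2 f'.2.
  case: ff' => [//|[s [_ f2 f'1 f'2]]]; case: f'p.
  by rewrite -fp /flag_point f'1 f'2 f2 actM.
have hp : flag_point h <> p.
  by move=> e; move: pl; rewrite -e -lh mem_last.
have [h'1 hha] : h'.1 = h.1 /\ adj h.2 h'.2.
  case: hh' => [//|[s [_ f2 e1 e2]]]; case: hp.
  by rewrite -h'p /flag_point e1 e2 f2 actM.
have [Ah' Ch'] := flag_walk_start wh.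
have pq : adj p (flag_point f') by rewrite -{1}fp /flag_point f'1 act_adj.
have pq' : adj p (flag_point h) by rewrite -{1}h'p /flag_point h'1 act_adj adj_sym.
have qq' := tree_branch tree pq pq' fl lh pl.
have Vh' := flag_elt_vertex h'p.
set x := flag_elt f in Vf *; set y := flag_elt h' in Vh' *.
have q1E : act x^-1%g (flag_point f') = act (k f.2)^-1%g f'.2.
  by rewrite /x /flag_elt /flag_point invgM f'1 actM actK.
have q2E : act y^-1%g (flag_point h) = act (k h'.2)^-1%g h.2.
  by rewrite /y /flag_elt /flag_point invgM -h'1 actM actK.
have adjV v q : V v -> adj p q -> adj p (act v^-1%g q).
  by move=> /vertex_groupV vp a; rewrite -{1}vp act_adj.
have pq1 := adjV _ _ Vf pq; have pq2 := adjV _ _ Vh' pq'.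
have Eq1 : E (act x^-1%g (flag_point f')) by rewrite q1E; apply: EP; rewrite -?q1E.
have Eq2 : E (act y^-1%g (flag_point h)) by rewrite q2E; apply: EP; rewrite -?q2E.
have Vxy : V (x^-1 * y)%g by apply: vertex_groupM => //; exact: vertex_groupV.
have [|t [Ft Vt tq]] := Ftr Eq1 Eq2.
  by exists (x^-1 * y)%g; split=> //; rewrite actM actVK qq'.
pose e := (x^-1 * y * t^-1)%g.
have yE : y = (x * (e * t))%g by rewrite /e mulgVK mulVKg.
have -> : n = (m'.+2 + (m - m'.+1))%N by rewrite nm addSn subnKC.
apply: Padd; last by apply: IH wh h'p f''p; rewrite nm; lia.
rewrite -/x -/y yE; apply: Pstep => //; first exact: flag_near.
- by rewrite -yE; exact: flag_near.
- right; exists (act x^-1%g (flag_point f')); split=> //.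
  apply/edge_groupP => //; split.
    by rewrite /e actM (vertex_groupV Vt) Vxy.
  by rewrite /e actM -{1}tq actK actM actVK qq'.
- rewrite /e mulgVK /x /y /flag_elt invgM -!mulgA (mulgA _ h'.1) -f'1.
  have hk := wleM hm (kB Ch'); have := wleM (wleV (kB Cf)) hk.
  rewrite -!mulgA; apply: wle_mono; lia.
Qed.

Lemma flag_path (A : set G) x c l : A x -> C c -> path (@adj T) c l ->
  (forall c', c' \in l -> C c') -> flag_walk A (size l) (x, c) (x, last c l).
Proof.
move=> Ax; elim: l c => [|c' l IH] c Cc /=; first by move=> _ _; exact: flag_walk0.
move=> /andP[cc' c'l] hC; apply: (flag_walkS (f' := (x, c'))) => //; first by left.
apply: IH => //; first by apply: hC; rewrite mem_head.
by move=> d dl; apply: hC; rewrite inE dl orbT.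
Qed.

End TreeChain.

Lemma finite_nat_bound (I : Type) (A : set I) (f : I -> nat) : finite_set A ->
  exists D, forall a, A a -> (f a <= D)%N.
Proof.
move=> fA; have : finite_set (f @` A) by exact: finite_image.
move=> /finite_seqP[s sE]; exists (\max_(i <- s) i)%N => a Aa.
have : f a \in s by have : (f @` A) (f a) by [exists a]; rewrite sE.
by move=> fs; exact: (leq_bigmax_seq (F := id)).
Qed.

(** Only here is [G] finitely generated: the paths from [p] to [s p], for the finitely many letters
    [s], yield the finite sets [C], [E] and [F]. *)
Lemma tree_chain (G : groupType) (T : conn_graph) (act : G -> T -> T) (p : T)
    (SG : genset [set: G]) : splitting act ->
  let V := vertex_group act p in
  exists (Q : set T) (F : set G) (B D : nat),
  [/\ finite_set Q, finite_set F, Q `<=` [set q | adj p q], F `<=` V &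
  forall (A : set G) (P : G -> G -> nat -> Prop),
  (forall x y z n m, P x y n -> P y z m -> P x z (n + m)%N) ->
  (forall x, V x -> Gnear SG B A x -> P x x 0%N) ->
  (forall x e t n, V x -> Gnear SG B A x -> Gnear SG B A (x * (e * t))%g ->
     (0 < n)%N -> F t ->
     (e = 1%g \/ exists2 q, Q q & edge_group act p q e) ->
     wle SG (n + 2 * B) (e * t)%g -> P x (x * (e * t))%g n) ->
  forall l x, path (fun g h => `[< wle SG 1 (g^-1 * h)%g >]) x l ->
    V x -> V (last x l) -> (forall g, g \in x :: l -> A g) ->
    exists2 m, (m <= size l * D)%N & P x (last x l) m].
Proof.
move=> split_act V; have [tree [act1 actM act_adj] noinv nofix] := split_act.
(* Outside of the orbit of [p] the value is the default 1. The value at [p] is fixed to be 1 so that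
   the flag [(x, p)] has the element [x]. *)
pose k c := if c == p then 1%g else xget 1%g [set g | act g p = c].
have k1 : k p = 1%g by rewrite /k eqxx.
have kP g : act (k (act g p)) p = act g p.
  rewrite /k; case: eqVneq => [->|_]; first by rewrite act1.
  by case: xgetP => [h _ //|/(_ g)]; case.
pose Lt := [set s | letter SG s].
have fLt : finite_set Lt.
  have [fS _] := gensP SG.
  have -> : Lt = gens SG `|` [set s^-1%g | s in gens SG].
    apply/seteqP; split=> [s [|h]|s [|[t St <-]]]; [by left| |by left|].
      by right; exists s^-1%g => //; rewrite invgK.
    by right; rewrite invgK.
  by rewrite finite_setU; split=> //; exact: finite_image.
have /choice [l lP] : forall s, exists l, path (@adj T) p l /\ last p l = act s p.
  by move=> s; have [l h1 h2] := adj_conn p (act s p); exists l.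
pose C := [set p] `|` \bigcup_(s in Lt) [set` l s].
have fC : finite_set C.
  rewrite finite_setU; split=> //; exact: bigcup_finite.
pose E := [set act (k cc.1)^-1%g cc.2 | cc in C `*` C] `&` [set q | adj p q].
have fE : finite_set E by apply/finite_setIl/finite_image; exact: finite_setX.
pose tr (qq : T * T) := xget 1%g [set t | V t /\ act t qq.2 = qq.1].
pose F := ((tr @` (E `*` E)) `|` [set ((k (act s p))^-1 * s)%g | s in Lt]) `&` V.
have fF : finite_set F.
  apply: finite_setIl; rewrite finite_setU; split; last exact: finite_image.
  by apply: finite_image; exact: finite_setX.
have [||B hB] := @finite_wle _ _ SG (k @` C); [exact: finite_image|by []|].
have [D hD] := finite_nat_bound (fun s => size (l s)) fLt.
(* A letter costs a path of at most [D] edges and one step that changes the group element. *)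
exists E, F, B, D.+1; split=> //; [by move=> q []|by move=> g []|].
move=> A P Padd P0 Pstep.
have Cp : C p by left.
have walkA (ll : seq G) x : path (fun g h => `[< wle SG 1 (g^-1 * h)%g >]) x ll ->
    (forall g, g \in x :: ll -> A g) ->
    exists2 m, (m <= size ll * D.+1)%N &
      flag_walk act p SG C A m (x, p) (last x ll, p).
  elim: ll x => [|y ll IH] x /=.
    by move=> _ hA; exists 0%N => //; apply: flag_walk0 => //; apply: hA; rewrite mem_head.
  move=> /andP[/asboolP xy yll] hA.
  have [|m mD wm] := IH y yll; first by move=> g gl; apply: hA; rewrite inE gl orbT.
  have Ax : A x by apply: hA; rewrite mem_head.
  have Ay : A y by apply: hA; rewrite !inE eqxx orbT.
  have [s [sl sw]] : exists s, (letter SG s \/ s = 1%g) /\ (x^-1 * y)%g = s.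
    case: xy => [[|s [|? ?]] [wS // _ <-]]; first by exists 1%g; rewrite big_nil; split=> //; right.
    by exists s; rewrite big_cons big_nil mulg1; split=> //; left; apply: wS; rewrite mem_head.
  have yE : y = (x * s)%g by rewrite -sw mulVKg.
  case: sl => [sl|s1]; last first.
    by exists m; [rewrite (leq_trans mD)// mulSn leq_addl|rewrite -[x]mulg1 -s1 -yE].
  have [pl lpl] := lP s.
  have wl : flag_walk act p SG C A (size (l s)) (x, p) (x, act s p).
    rewrite -lpl; apply: flag_path => // c cl; right; exists s => //.
  have Cl : C (act s p).
    have := mem_last p (l s); rewrite lpl inE => /orP[/eqP ->//|cl].
    by right; exists s.
  exists (size (l s) + m.+1)%N.
    by rewrite mulSn addnS -addSn leq_add// ltnS hD.
  apply: flag_walk_cat wl _; apply: flag_walkS wm => //.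
  by right; exists s; split=> //=.
move=> ll x xl Vx Vy hA; have [m mD wm] := walkA ll x xl hA.
exists m => //.
have elE y : flag_elt k (y, p) = y by rewrite /flag_elt /= k1 mulg1.
suff : P (flag_elt k (x, p)) (flag_elt k (last x ll, p)) m by rewrite !elE.
apply: (flag_chain split_act kP (E := E) (F := F)) wm _ _ => //.
- move=> c c' Cc Cc' a; split=> //; exists (c, c') => //.
- move=> q q' Eq Eq' [g [Vg gq]].
  have [Vt tq] : V (tr (q, q')) /\ act (tr (q, q')) q' = q.
    by rewrite /tr /=; case: xgetP => [t _ //|/(_ g)]; case.
  by exists (tr (q, q')); split=> //; split=> //; left; exists (q, q').
- by move=> s sl Vs; split=> //; right; exists s.
- by move=> c Cc; apply: hB; exists c.
- exact: P0.
- move=> z e t n Vz nz nz' n0 Ft _ he; apply: Pstep => //.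
  by case: he => [->|[q [Eq _ eq]]]; [left|right; exists q].
Qed.

(** * Detours from relative wideness *)

Lemma open_mdist_ball (R : realType) (X : metricType R) (x : X) (r : R) :
  open [set y | mdist x y < r].
Proof.
rewrite openE => y /= xyr; apply/nbhs_ballP; exists (r - mdist x y) => /=.
  by rewrite subr_gt0.
by move=> z; rewrite ballEmdist /= => yz; have := metric_triangle x y z; lra.
Qed.

Lemma nat_ultrafilter : exists w : set_system nat,
  [/\ UltraFilter w, forall n, ~ w [set n] & \oo `<=` w].
Proof.
have [w [wU woo]] := @ultraFilterLemma nat \oo _.
exists w; split=> // n wn.
have : w (~` [set n]).
  by apply: woo; exists n.+1 => // m /= nm mn; move: nm; rewrite mn ltnn.
move=> wn'; have wP : ProperFilter w by exact: (@ultra_proper _ w wU).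
have : w ([set n] `&` ~` [set n]) by exact: filterI.
by rewrite setICr; move: (@filter_not_empty _ w wP).
Qed.

Section ConeFacts.
Context {R : realType} {X : metricType R} (D : cone_data X).
Local Notation w := (cultra D).
Local Notation adm := (set_type (admissible D)).

Lemma cone_scale_ge (M : R) : \forall n \near w, M <= Defs.cscale D n.
Proof. exact: (cvgry_ge (cscale_infty D)). Qed.

Lemma cone_dist_lt (a b : adm) (r : R) : cone_dist a b < r ->
  \forall n \near w, mdist (val a n) (val b n) <= r * Defs.cscale D n.
Proof.
move=> abr; have h := cvgr_lt _ (@cone_dist_cvg _ _ D a b) _ abr.
near=> n; have s0 : 0 < Defs.cscale D n.
  suff : 1 <= Defs.cscale D n by lra.
  by near: n; exact: cone_scale_ge.
by rewrite -ler_pdivrMr//; apply: ltW; near: n; exact: h.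
Unshelve. all: by end_near. Qed.

Lemma cone_dist_gt (a b : adm) (r : R) : r < cone_dist a b ->
  \forall n \near w, r * Defs.cscale D n <= mdist (val a n) (val b n).
Proof.
move=> abr; have h := cvgr_gt _ (@cone_dist_cvg _ _ D a b) _ abr.
near=> n; have s0 : 0 < Defs.cscale D n.
  suff : 1 <= Defs.cscale D n by lra.
  by near: n; exact: cone_scale_ge.
by rewrite -ler_pdivlMr//; apply: ltW; near: n; exact: h.
Unshelve. all: by end_near. Qed.

Definition cone_repr (q : asymptotic_cone D) : adm :=
  repr (q : {eq_quot (cone_equiv D)}%qT).

Lemma cone_reprK (a : adm) (r : R) : 0 < r -> \forall n \near w,
  mdist (val (cone_repr (cone_pt a)) n) (val a n) <= r * Defs.cscale D n.
Proof.
move=> r0; apply: cone_dist_lt.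
suff /eqP -> : cone_eq (cone_repr (cone_pt a)) a by [].
exact/(@eqquotP _ _ {eq_quot (cone_equiv D)}%qT)/(reprK (cone_pt a : {eq_quot (cone_equiv D)}%qT)).
Qed.

End ConeFacts.

Section Reach.
Context {R : realType} {X : metricType R}.
Hypothesis gX : graphlike X.
Variables (w : set_system nat) (l : nat -> R) (o : X) (m : nat -> X).
Context {wU : UltraFilter w}.
Hypothesis l_infty : forall M : R, \forall n \near w, M <= l n.

(* Away from the limit of [m], this condition defines an open and closed set of points
   of the cone. *)
Definition reached (a : nat -> X) : Prop := exists K : nat,
  \forall n \near w, exists2 k : nat, k%:R <= K%:R * l n &
    walk [set z | l n <= K%:R * mdist (m n) z] k o (a n).

(** A short walk from [a n] to [b n] stays at distance at least [r * l n] from [m n]: of the margin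
    [3 * r], one part is the distance travelled and one is the rounding. The constant grows by about
    [r + 1 + r^-1]. *)
Lemma reached_near (a b : nat -> X) (r : R) : 0 < r -> reached a ->
  (\forall n \near w, mdist (a n) (b n) <= r * l n) ->
  (\forall n \near w, 3 * r * l n <= mdist (m n) (a n)) -> reached b.
Proof.
move=> r0 [K hK] ab am; pose K1 := (Num.truncn r).+2; pose K2 := (Num.truncn r^-1).+1.
have rK1 : r + 1 <= K1%:R.
  by have /andP[_] := truncn_itv (ltW r0); rewrite /K1 -!natr1; lra.
have rK2 : r^-1 <= K2%:R.
  by have /andP[_ /ltW] := truncn_itv (ltW (x := 0) (y := r^-1) ltac:(by rewrite invr_gt0)).
exists (K + K1 + K2)%N; near=> n.
have ln1 : 1 <= l n by near: n; exact: l_infty.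
have ln0 : 0 <= l n by lra.
have lnr : r^-1 <= l n by near: n; exact: l_infty.
have rl : 1 <= r * l n by rewrite -ler_pdivrMl ?mulr1.
have [k kK wk] : exists2 k : nat, k%:R <= K%:R * l n &
    walk [set z | l n <= K%:R * mdist (m n) z] k o (a n) by near: n.
have abn : mdist (a n) (b n) <= r * l n by near: n.
have amn : 3 * r * l n <= mdist (m n) (a n) by near: n.
have [j jr wj] := walk_near gX abn.
exists (k + j)%N.
  rewrite !natrD; have : 0 <= K2%:R * l n by rewrite mulr_ge0.
  have : (r + 1) * l n <= K1%:R * l n by rewrite ler_wpM2r.
  lra.
apply: walk_cat (walk_sub _ (leqnn _) wk) (walk_sub _ (leqnn _) wj) => z /= hz.
  apply: (le_trans hz); apply: ler_wpM2r; first exact: mdist_ge0.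
  by rewrite ler_nat -addnA leq_addr.
have mz : r * l n <= mdist (m n) z.
  have := metric_triangle (m n) z (a n); rewrite (metric_sym z); lra.
have : r^-1 * (r * l n) <= (K + K1 + K2)%:R * mdist (m n) z.
  apply: ler_pM => //; [by rewrite invr_ge0 ltW|lra|].
  by apply: (le_trans rK2); rewrite ler_nat leq_addl.
by rewrite mulKf// gt_eqF.
Unshelve. all: by end_near. Qed.

End Reach.

Section Detour.
Context {R : realType} {G : groupType} (E V : set G) (S : genset V).
Local Notation X := (word_space R S).

(** One constant [K] serves as the least length of the chord, the length of the detour and its
    proximity to [m]. If every [K] fails, the failures give a sequence with chords tending to
    infinity; in the cone scaled by the chords, the limit of the points [m] would be a cut point. *)
Lemma wide_detour : E 1%g -> relatively_wide R E V -> forall (delta : R), 0 < delta ->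
  exists K : nat, forall (o e m : X), val o = 1%g -> E (val e) ->
    K%:R <= mdist o e -> delta * mdist o e <= mdist m o ->
    delta * mdist o e <= mdist m e ->
    exists2 k : nat, k%:R <= K%:R * mdist o e &
      walk [set z | mdist o e <= K%:R * mdist m z] k o e.
Proof.
move=> E1 wide delta d0; apply: contrapT => /forallNP hK.
pose o : X := SigSub (mem_set (genset1 S)).
have /choice [em hem] : forall K : nat, exists em : X * X, [/\ E (val em.1),
    K%:R <= mdist o em.1, delta * mdist o em.1 <= mdist em.2 o,
    delta * mdist o em.1 <= mdist em.2 em.1 &
    ~ exists2 k : nat, k%:R <= K%:R * mdist o em.1 &
      walk [set z | mdist o em.1 <= K%:R * mdist em.2 z] k o em.1].
  move=> K; apply: contrapT => /forallNP h; apply: (hK K) => o' e m o'1 Ee h1 h2 h3.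
  have o'o : o' = o by apply: val_inj.
  by apply: contrapT => h4; apply: (h (e, m)); rewrite -o'o; split.
pose e n := (em n).1; pose m n := (em n).2; pose l n := mdist o (e n).
have gX := word_graphlike (R := R) (S := S).
have ln n : n%:R <= l n by have [] := hem n.
(* If [m n] were farther away, a geodesic from [o] to [e n] would already be a detour. Hence [m] is
   admissible and has a limit in the cone. *)
have mo n : (2 <= n)%N -> mdist o (m n) <= 3 * l n.
  move=> n2; have [_ _ _ _ neg] := hem n; rewrite leNgt; apply/negP => hlt.
  apply: neg; have [k kl wk] := walk_near gX (lexx (l n)).
  have n2' : 2 <= n%:R :> R by rewrite (ler_nat _ 2).
  have l2 : 2 <= l n by exact: le_trans (ln n).
  have l2n : 2 * l n <= n%:R * l n by rewrite ler_wpM2r//; lra.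
  exists k; first by rewrite -/(e n) -/(l n); lra.
  apply: walk_sub wk => // z /= hz; rewrite -/(e n) -/(m n) -/(l n).
  have := metric_triangle o z (m n); rewrite (metric_sym z) => tr.
  have : 1 * mdist (m n) z <= n%:R * mdist (m n) z.
    by apply: ler_wpM2r; [exact: mdist_ge0|lra].
  lra.
have [w [wU wn woo]] := nat_ultrafilter.
have linf : l @ w --> +oo.
  apply/cvgryPge => A; apply: woo; exists (Num.truncn `|A|).+1 => // n /= An.
  apply: le_trans (ln n); have /andP[_ h] := truncn_itv (normr_ge0 A).
  by apply: (le_trans (ler_norm A)); apply: (le_trans (ltW h)); rewrite ler_nat.
pose D := ConeData wU wn (fun=> o) linf.
have admo : admissible D (fun=> o).
  by exists 0; apply: filterE => n; rewrite /= mdistxx mul0r.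
have adme : admissible D e.
  by exists 1; apply: filterE => n; rewrite /= mul1r.
have large k : \forall n \near w, (k <= n)%N.
  by apply: woo; exists k.
have admm : admissible D m.
  by exists 3; apply: filterS (large 2%N) => n; exact: mo.
pose x := cone_pt (SigSub (mem_set admo) : set_type (admissible D)).
pose y := cone_pt (SigSub (mem_set adme) : set_type (admissible D)).
pose z := cone_pt (SigSub (mem_set admm) : set_type (admissible D)).
have reprx r : 0 < r -> \forall n \near w, mdist (val (cone_repr x) n) o <= r * l n.
  by move=> r0; exact: (cone_reprK (SigSub (mem_set admo) : set_type (admissible D)) r0).
have repry r : 0 < r -> \forall n \near w, mdist (val (cone_repr y) n) (e n) <= r * l n.
  by move=> r0; exact: (cone_reprK (SigSub (mem_set adme) : set_type (admissible D)) r0).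
have reprz r : 0 < r -> \forall n \near w, mdist (val (cone_repr z) n) (m n) <= r * l n.
  by move=> r0; exact: (cone_reprK (SigSub (mem_set admm) : set_type (admissible D)) r0).
have l_ge (M : R) : \forall n \near w, M <= l n by exact: (cvgry_ge linf).
have ed n : delta * l n <= mdist (m n) (e n) by have [_ _ _] := hem n.
have od n : delta * l n <= mdist (m n) o by have [_ _ ] := hem n.
have d4 : 0 < delta / 4 by lra.
have zx : z <> x.
  move=> zx; have h1 := reprx _ d4; have h2 := reprz _ d4; rewrite zx in h2.
  have [n [[h3 h4] h5]] := filter_ex (filterI (filterI h1 h2) (l_ge 1)).
  have := metric_triangle (m n) (val (cone_repr x) n) o.
  rewrite (metric_sym (m n) (val _ _)); have := od n.
  have : 0 < delta * l n by rewrite mulr_gt0//; rewrite /= in h5; lra.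
  lra.
have zy : z <> y.
  move=> zy; have h1 := repry _ d4; have h2 := reprz _ d4; rewrite zy in h2.
  have [n [[h3 h4] h5]] := filter_ex (filterI (filterI h1 h2) (l_ge 1)).
  have := metric_triangle (m n) (val (cone_repr y) n) (e n).
  rewrite (metric_sym (m n) (val _ _)); have := ed n.
  have : 0 < delta * l n by rewrite mulr_gt0//; rewrite /= in h5; lra.
  lra.
(* [Acc] contains [x]. It does not contain [y]: its constant would eventually be below [n], against
   the choice of [e n] and [m n]. *)
pose Acc (q : asymptotic_cone D) := reached w l o m (val (cone_repr q)).
have Accx : Acc x.
  have ro : reached w l o m (fun=> o).
    pose K := (Num.truncn delta^-1).+1; exists K; apply: filterE => n.
    exists 0%N; first by rewrite mulr_ge0// (le_trans _ (ln n)).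
    apply: walk_refl => /=.
    have hdK : delta^-1 <= K%:R.
      by have /andP[_ /ltW] := truncn_itv (ltW (x := 0) (y := delta^-1) ltac:(by rewrite invr_gt0)).
    have : delta^-1 * (delta * l n) <= K%:R * mdist (m n) o.
      apply: ler_pM => //; first by rewrite invr_ge0 ltW.
      by rewrite mulr_ge0 ?(ltW d0)// (le_trans _ (ln n)).
    by rewrite mulKf// gt_eqF.
  apply: (reached_near gX l_ge d4 ro).
    by apply: filterS (reprx _ d4) => n; rewrite metric_sym.
  apply: filterE => n; apply: le_trans (od n); apply: ler_wpM2r; last lra.
  by rewrite (le_trans _ (ln n)).
have Accy : Acc y -> False.
  move=> ry; have : reached w l o m e.
    apply: (reached_near gX l_ge d4 ry); first exact: repry.
    near=> n; have h1 : mdist (val (cone_repr y) n) (e n) <= delta / 4 * l n.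
      by near: n; exact: repry.
    have := metric_triangle (m n) (val (cone_repr y) n) (e n).
    have := ed n; lra.
  move=> [K hwK]; have [n [[k kK wk] Kn]] := filter_ex (filterI hwK (large K)).
  have [_ _ _ _] := hem n; apply; exists k.
    apply: (le_trans kK); apply: ler_wpM2r; first exact: mdist_ge0.
    by rewrite ler_nat.
  apply: walk_sub wk => // v /= hv; apply: (le_trans hv).
  by apply: ler_wpM2r; [exact: mdist_ge0|rewrite ler_nat].
(* A quarter of the distance to [z] leaves the margin 3 for [reached_near] and room for the
   representative of [z]. *)
have spread q q' : Acc q -> mdist q q' < mdist q z / 4 -> Acc q'.
  move=> Aq qq'; set r := mdist q z / 4 in qq'.
  have r0 : 0 < r by apply: le_lt_trans qq'; exact: mdist_ge0.
  have r2 : 0 < r / 2 by lra.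
  apply: (reached_near gX l_ge (r := r) r0 Aq); first exact: (cone_dist_lt qq').
  have h1 : 3 * r + r / 2 < cone_dist (cone_repr q) (cone_repr z).
    by rewrite -[cone_dist _ _]/(mdist q z); clear - r0; rewrite /r in r0 *; lra.
  have h2 := cone_dist_gt h1; have h3 := reprz _ r2.
  near=> n.
  have h4 : (3 * r + r / 2) * l n <= mdist (val (cone_repr q) n) (val (cone_repr z) n).
    by near: n.
  have h5 : mdist (val (cone_repr z) n) (m n) <= r / 2 * l n by near: n.
  have := metric_triangle (val (cone_repr q) n) (m n) (val (cone_repr z) n).
  rewrite (metric_sym (val _ _) (m n)) (metric_sym (m n) (val (cone_repr z) n)); lra.
apply: (wide S D x y).
- exists (SigSub (mem_set admo)) => //= n; exact: E1.
- by exists (SigSub (mem_set adme)) => //= n; have [] := hem n.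
exists z; split=> // -[B [Bx BA Bc] By]; apply: Accy.
have BAcc : B `&` Acc = B.
  apply: Bc; first by exists x.
    exists (\bigcup_(q in B `&` Acc) [set q' | mdist q q' < mdist q z / 4]).
      by apply: bigcup_open => q _; exact: open_mdist_ball.
    apply/seteqP; split=> [q [Bq Aq]|q [Bq [q0 [_ Aq0] h]]]; split=> //.
      exists q => //=; rewrite mdistxx divr_gt0// mdist_gt0.
      by apply/eqP => qz; have := BA _ Bq; rewrite qz; exact.
    exact: spread Aq0 h.
  (* With one eighth, the ball around a point that is not reached contains no reached [q], since the
     distance from [q] to [z] is still large enough for [spread] to go back. *)
  exists (~` \bigcup_(q in B `&` ~` Acc) [set q' | mdist q q' < mdist q z / 8]).
    by apply: open_closedC; apply: bigcup_open => q _; exact: open_mdist_ball.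
  apply/seteqP; split=> [q [Bq Aq]|q [Bq h]]; split=> //.
    move=> [q0 [Bq0 nA] /= h]; apply: nA; apply: (spread q) => //.
    move: h (metric_triangle q0 q z) (mdist_ge0 q0 q); rewrite (metric_sym q q0).
    by move: (mdist q0 q) (mdist q0 z) (mdist q z) => a b c; clear; lra.
  apply: contrapT => nA; apply: h; exists q => //=.
  rewrite mdistxx divr_gt0// mdist_gt0.
  by apply/eqP => qz; have := BA _ Bq; rewrite qz; exact.
by rewrite -BAcc in By; case: By.
Unshelve. all: by end_near. Qed.

End Detour.

(** * The vertex group *)

Lemma wle_subset (G : groupType) (S S' : set G) n g :
  S `<=` S' -> wle S n g -> wle S' n g.
Proof.
move=> SS' [w [wS wn wg]]; exists w; split=> // s /wS [/SS'|/SS']; by [left|right].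
Qed.

Lemma generates_of_wle (G : groupType) (S H : set G) : finite_set S ->
  S `<=` H -> group_closed (mem H) -> (forall g, H g -> exists n, wle S n g) ->
  generates S H.
Proof.
move=> fS SH gH hw; split=> //; apply/seteqP; split; first exact: smallest_sub.
move=> g /hw [n [w [wS _ <-]]] K [gK SK]; apply/set_mem.
elim: w wS => [|s w IH] wS; first by rewrite big_nil; exact: gK.1.
rewrite big_cons; apply: (group_closedM gK); last first.
  by apply: IH => t tw; apply: wS; rewrite inE tw orbT.
have [/SK Ks|/SK Ks] := wS s (mem_head _ _); first exact/mem_set.
by rewrite -[s]invgK; apply: (group_closedV gK); exact/mem_set.
Qed.

Lemma wle_path (G : groupType) (S : set G) n g x : wle S n g ->
  exists l, [/\ path (fun g h => `[< wle S 1 (g^-1 * h)%g >]) x l,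
    last x l = (x * g)%g & (size l <= n)%N].
Proof.
move=> [w [wS wn <-]]; elim: w n x wS wn => [|s w IH] n x wS wn.
  by exists [::]; rewrite big_nil mulg1.
case: n wn => [//|n] wn.
have [|l [xl ll ln]] := IH n (x * s)%g _ wn.
  by move=> t tw; apply: wS; rewrite inE tw orbT.
exists ((x * s)%g :: l); split=> //=; last by rewrite big_cons mulgA.
by rewrite xl andbT; apply/asboolP; rewrite mulKg; apply: wle_gen; exact: wS (mem_head _ _).
Qed.

(** Undistortion for natural numbers; the factor [n.+1] absorbs the additive constants, since
    [C * (n + C)] is at most [(C + C * C) * (n + 1)]. *)
Lemma qie_wle (R : realType) (G : groupType) (H K : set G) (HK : H `<=` K)
    (SH : genset H) (SK : genset K) :
  quasi_isometric_embedding (sub_incl HK : word_space R SH -> word_space R SK) ->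
  exists c, forall n g, H g -> wle SK n g -> wle SH (c * n.+1) g.
Proof.
move=> [C C1 h]; have C0 : 0 <= C by lra.
have /andP[_ hc] := truncn_itv (mulr_ge0 C0 C0).
have /andP[_ hd] := truncn_itv C0.
set c1 := (Num.truncn _).+1 in hc; set c2 := (Num.truncn C).+1 in hd.
exists (c1 + c2)%N => n g Hg gn.
pose o : word_space R SH := SigSub (mem_set (genset1 SH)).
pose x : word_space R SH := SigSub (mem_set Hg).
have : mdist (sub_incl HK o : word_space R SK) (sub_incl HK x) <= n%:R.
  by apply/word_mdistP; rewrite /= invg1 mul1g.
have /andP[h1 _] := h o x; move=> h2.
have : mdist o x <= ((c1 + c2) * n.+1)%N%:R.
  have : C^-1 * mdist o x <= n%:R + C by lra.
  rewrite ler_pdivrMl; last lra.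
  move=> h3; apply: (le_trans h3); rewrite natrM natrD -natr1.
  have : C * n%:R <= c2%:R * n%:R by rewrite ler_wpM2r// ltW.
  have : 0 <= c1%:R * n%:R :> R by rewrite mulr_ge0.
  have : 0 <= c2%:R :> R by []. lra.
by move=> /word_mdistP; rewrite /= invg1 mul1g.
Qed.

Section VertexGroup.
Context {R : realType} {G : groupType} {T : conn_graph} (act : G -> T -> T) (p : T).
Hypothesis act_split : splitting act.
Hypothesis edges_undistorted :
  forall q, adj p q -> undistorted R (edge_group act p q) [set: G].
Local Notation V := (vertex_group act p).

(** Generators of the finitely many edge groups involved, together with [F], suffice. A step of
    length [j] has an edge part of length at most [j + 2 * B + BF] in [G], hence of linear length in
    the edge group by undistortion. *)
Lemma vertex_gens (SG : genset [set: G]) : exists (S0 : set G) c,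
  [/\ finite_set S0, S0 `<=` V &
   forall n v, V v -> wle SG n v -> wle S0 (n * c) v].
Proof.
have [Q [F [B [D [fQ fF Qp FV chain]]]]] := tree_chain p SG act_split.
have /choice [Sc hSc] : forall q, exists Sc : set G * nat, Q q ->
    [/\ finite_set Sc.1, Sc.1 `<=` edge_group act p q & forall n e,
        edge_group act p q e -> wle SG n e -> wle Sc.1 (Sc.2 * n.+1) e].
  move=> q; have [Qq|nQ] := pselect (Q q); last by exists (set0, 0%N).
  have [[S Sgen] [HK hq]] := edges_undistorted (Qp _ Qq).
  pose SE := GenSet Sgen; have [c hc] := qie_wle (hq SE SG).
  exists (S, c) => _; split=> //; first exact: Sgen.1.
  by move=> s Ss; exact: (@genset_gen _ _ SE).
pose S0 := F `|` \bigcup_(q in Q) (Sc q).1.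
have S0V : S0 `<=` V.
  move=> s [/FV//|[q Qq sS]]; have [_ h _] := hSc q Qq.
  by have [] := (edge_groupP act_split s (Qp _ Qq)).1 (h _ sS).
have [BF hBF] := finite_wle SG fF (fun _ _ => I).
have [c hc] := finite_nat_bound (fun q => (Sc q).2) fQ.
pose c1 := (c * (2 * B + BF + 2) + 1)%N.
exists S0, (D * c1)%N; split=> //.
  rewrite finite_setU; split=> //; apply: bigcup_finite => // q Qq.
  by have [] := hSc q Qq.
move=> n v Vv nv; have [l [xl lv ln]] := wle_path 1%g nv.
rewrite mul1g in lv.
have [||||||m mD] := chain setT (fun x y n => wle S0 (c1 * n) (x^-1 * y)%g) _ _ _ l 1%g xl.
- move=> x y z i j h1 h2; rewrite mulnDr.
  by have := wleM h1 h2; rewrite -mulgA mulVKg.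
- by move=> x _ _; rewrite mulVg; exact: wle1.
- move=> x e t j _ _ _ j0 Ft he et; rewrite mulKg.
  have we : wle SG (j + 2 * B + BF) e.
    by rewrite -[e](mulgK t); apply: wleM et _; apply: wleV; exact: hBF.
  apply: (@wle_mono _ _ (c * (j + 2 * B + BF).+1 + 1)).
    rewrite /c1; case: j j0 {et we} => [//|j] _.
    have : (c * (2 * B + BF + 2) <= c * (2 * B + BF + 2) * j.+1)%N by rewrite leq_pmulr.
    have : (c * j <= c * (2 * B + BF + 2) * j)%N.
      by rewrite -mulnA leq_mul2l (leq_pmull _ (n := 2 * B + BF + 2)) ?orbT// addn2.
    rewrite mulnS; lia.
  apply: wleM; last by apply: wle_gen; left; left.
  case: he => [->|[q Qq qe]]; first exact: wle1.
  have [_ _ h] := hSc q Qq.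
  apply: (@wle_mono _ _ ((Sc q).2 * (j + 2 * B + BF).+1)).
    by rewrite leq_mul2r hc ?orbT.
  apply: (@wle_subset _ (Sc q).1); last exact: h.
  by move=> s Ss; right; exists q.
- by rewrite /vertex_group /=; case: act_split => _ [-> _ _].
- by rewrite lv.
- by [].
rewrite lv invg1 mul1g; apply: wle_mono.
rewrite mulnA [leqRHS]mulnC leq_mul2l (leq_trans mD) ?orbT// leq_mul2r ln orbT//.
Qed.

Hypothesis G_fg : finitely_generated [set: G].

Lemma vertex_group_closed : group_closed (mem V).
Proof.
have [_ [act1 actM _] _ _] := act_split; split.
  by apply/mem_set; exact: act1.
move=> x y /set_mem Vx /set_mem Vy; apply/mem_set.
by apply: vertex_groupM => //; exact: vertex_groupV.
Qed.

Lemma vertex_fg : finitely_generated V.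
Proof.
have [S Sgen] := G_fg; pose SG := GenSet Sgen.
have [S0 [c [fS0 S0V h]]] := vertex_gens SG; exists S0.
apply: generates_of_wle => //; first exact: vertex_group_closed.
move=> v Vv; have [n nv] := genset_wle SG (I : [set: G] v).
by exists (n * c)%N; exact: h.
Qed.

Lemma vertex_wle (SV : genset V) (SG : genset [set: G]) :
  exists c, (forall n v, V v -> wle SG n v -> wle SV (n * c) v) /\
            (forall n v, wle SV n v -> wle SG (n * c) v).
Proof.
have [S0 [c [fS0 S0V h]]] := vertex_gens SG.
have gen0 : generates S0 V.
  apply: generates_of_wle => //; first exact: vertex_group_closed.
  move=> v Vv; have [n nv] := genset_wle SG (I : [set: G] v).
  by exists (n * c)%N; exact: h.
have [a ha] := wle_sub (GenSet gen0) SV (fun _ => id).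
have [b hb] := wle_sub SV SG (fun _ _ => I).
exists (c * a + b)%N; split=> n v.
  move=> Vv /(h _ _ Vv) /ha; apply: wle_mono.
  by rewrite mulnDr mulnA leq_addr.
by move=> /hb; apply: wle_mono; rewrite mulnDr leq_addl.
Qed.

Definition vincl (SV : genset V) (SG : genset [set: G]) :
  word_space R SV -> word_space R SG := sub_incl (@subsetT _ V).

(** There is no additive constant because [vertex_wle] is purely multiplicative. *)
Lemma vertex_bilip (SV : genset V) (SG : genset [set: G]) :
  exists2 C : R, 1 <= C & forall x y : word_space R SV,
    mdist x y <= C * mdist (vincl SG x) (vincl SG y) /\
    mdist (vincl SG x) (vincl SG y) <= C * mdist x y.
Proof.
have [c [h1 h2]] := vertex_wle SV SG; exists c.+1%:R; first by rewrite ler1n.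
move=> x y; split.
  have [n nE] := word_mdist_nat (vincl SG x) (vincl SG y).
  rewrite nE -natrM; apply/word_mdistP; apply: (@wle_mono _ _ (n * c)); first by lia.
  apply: h1; last by apply/(word_mdistP (vincl SG x) (vincl SG y)); rewrite nE.
  by apply: vertex_groupM => //; [apply: vertex_groupV => //|]; apply/set_mem; exact: valP.
have [n nE] := word_mdist_nat x y.
rewrite nE -natrM; apply/word_mdistP; apply: (@wle_mono _ _ (n * c)); first by lia.
by apply: h2; apply/word_mdistP; rewrite nE.
Qed.

Lemma vertex_undistorted : undistorted R V [set: G].
Proof.
split; first exact: vertex_fg.
exists (@subsetT _ V) => SV SG; have [C C1 h] := vertex_bilip SV SG.
exists C => // x y; have [h1 h2] := h x y; rewrite /vincl in h1 h2.
apply/andP; split; last by lra.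
have : C^-1 * mdist x y <= mdist (sub_incl (@subsetT _ V) x : word_space R SG)
    (sub_incl (@subsetT _ V) y) by rewrite ler_pdivrMl//; lra.
by lra.
Qed.

End VertexGroup.

(** * Estimates for the transfer of divergence *)

Lemma diverges_leq (R : realType) (X : metricType R) (K K' r0 : R) (sigma : nat -> X) :
  0 <= r0 -> K <= K' -> diverges_at K' r0 sigma -> diverges_at K r0 sigma.
Proof.
move=> r00 KK' h t1 t0 t2 r n tt wk nK; have [|rp] := leP r 0; first lra.
by apply: h tt wk _; apply: (le_trans nK); rewrite ler_wpM2r// ltW.
Qed.

(** [r / (2 * C)] is the radius left in [V] after distortion, and a further factor [4 * k] is lost
    to the detours. *)
Lemma scaled_radius (R : realFieldType) (C b k r : R) : 1 <= C -> 0 <= b -> 1 <= k ->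
  2 * C * (4 + 2 * b + 2 * k) < r ->
  [/\ 4 + 2 * b < r / (2 * C), k < r / (2 * C) / 2,
      r / (8 * C * k) = r / (2 * C) / (4 * k) & r / (8 * C * k) <= r / (2 * C)].
Proof.
move=> C1 b0 k1 h; have C0 : 0 < 2 * C by lra.
have h1 : 4 + 2 * b + 2 * k < r / (2 * C) by rewrite ltr_pdivlMr// mulrC.
have E : r / (8 * C * k) = r / (2 * C) / (4 * k) by field; rewrite !gt_eqF//; lra.
split=> //; [lra|lra|].
by rewrite E ler_pdivrMr ?ler_peMr//; lra.
Qed.

Lemma far_bound (R : realFieldType) (C b B r d d' : R) : 1 <= C -> 0 <= b ->
  2 * B + 2 * C * b < r -> r <= d + B -> d <= C * d' -> r / (2 * C) + b <= d'.
Proof.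
move=> C1 b0 h h1 h2; have C0 : 0 < 2 * C by lra.
rewrite -lerBrDr ler_pdivrMr//; lra.
Qed.

Lemma step_bound (R : realFieldType) (C b B j d d1 d2 : R) : 0 <= C -> 0 <= b ->
  0 <= B -> 1 <= j -> d1 <= C * (j + 2 * B) -> d2 <= b -> d <= d1 + d2 ->
  d <= (C * (1 + 2 * B) + b) * j.
Proof.
move=> C0 b0 B0 j1 h1 h2 h.
have : C * (2 * B) <= C * (2 * B) * j by rewrite ler_peMr// !mulr_ge0.
have : b <= b * j by rewrite ler_peMr.
lra.
Qed.

(** Here [u] is the end of the edge part of a step and [y] differs from it by a bounded correction.
    A chord of length at most [rho / 2] cannot come near [m]; a longer one is replaced by a detour,
    whose distance from [m] is at least [rho / (2 * K)]. *)
Lemma join_walk (R : realType) (X : metricType R) (m x u y : X) (rho b K c : R) :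
  graphlike X -> 1 <= K -> 0 <= b -> 4 + 2 * b < rho ->
  rho + b <= mdist m x -> rho + b <= mdist m y -> mdist u y <= b ->
  mdist x u <= c ->
  (rho / 2 < mdist x u -> exists2 k : nat, k%:R <= K * mdist x u &
    walk [set z | mdist x u <= K * mdist m z] k x u) ->
  exists2 k : nat, k%:R <= K * c + b + 2 &
    walk [set z | rho / (4 * K) <= mdist m z] k x y.
Proof.
move=> gX K1 b0 rb mx my uy xu det.
have Kc : mdist x u <= K * c.
  by apply: (le_trans xu); rewrite ler_peMl//; apply: le_trans xu; exact: mdist_ge0.
have K4 : 0 < 4 * K by lra.
have radle : rho / (4 * K) <= rho / 4.
  by rewrite ler_pdivrMr// mulrA divfK ?ler_peMr//; lra.
have mu : rho <= mdist m u by have := metric_triangle m u y; lra.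
have [k1 k1l w1] : exists2 k : nat, k%:R <= K * c + 1 &
    walk [set z | rho / (4 * K) <= mdist m z] k x u.
  have [lr|lr] := leP (mdist x u) (rho / 2).
    have [k kl wk] := walk_near gX (lexx (mdist x u)).
    exists k; first lra.
    apply: walk_sub wk => // z /= hz.
    by have := metric_triangle m z x; rewrite (metric_sym z); lra.
  have [k kl wk] := det lr; exists k.
    have : K * mdist x u <= K * c by rewrite ler_wpM2l//; lra.
    lra.
  apply: walk_sub wk => // z /= hz; rewrite ler_pdivrMr//.
  have := mdist_ge0 m z; lra.
have [k2 k2l w2] := walk_near gX uy.
exists (k1 + k2)%N; first by rewrite natrD; lra.
apply: walk_cat w1 _; apply: walk_sub w2 => // z /= hz.
have := metric_triangle m z u; rewrite (metric_sym z); lra.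
Qed.

Section VertexMorse.
Context {R : realType} {G : groupType} {T : conn_graph} (act : G -> T -> T) (p : T).
Hypothesis act_split : splitting act.
Hypothesis G_fg : finitely_generated [set: G].
Hypothesis edges_undistorted :
  forall q, adj p q -> undistorted R (edge_group act p q) [set: G].
Hypothesis edges_wide :
  forall q, adj p q -> relatively_wide R (edge_group act p q) (vertex_group act p).
Local Notation V := (vertex_group act p).
Variables (SV : genset V) (SG : genset [set: G]).
Local Notation X := (word_space R SV).
Local Notation Y := (word_space R SG).
Local Notation iota := (@vincl R G T act p SV SG).

(** Left translation moves [x] to the identity, where [wide_detour] applies. *)
Lemma edge_detours (Q : set T) (delta : R) : finite_set Q ->
  Q `<=` [set q | adj p q] -> 0 < delta ->
  exists K : nat, (0 < K)%N /\ forall q (x y m : X), Q q ->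
    edge_group act p q ((val x)^-1 * val y)%g -> K%:R <= mdist x y ->
    delta * mdist x y <= mdist m x -> delta * mdist x y <= mdist m y ->
    exists2 k : nat, k%:R <= K%:R * mdist x y &
      walk [set z | mdist x y <= K%:R * mdist m z] k x y.
Proof.
move=> fQ Qp d0.
have E1 q : adj p q -> edge_group act p q 1%g.
  by move=> pq; apply/(edge_groupP act_split 1%g pq); case: act_split => _ [a _ _].
have /choice [Kq hKq] : forall q, exists K : nat, Q q ->
    forall (o e m : X), val o = 1%g -> edge_group act p q (val e) ->
    K%:R <= mdist o e -> delta * mdist o e <= mdist m o ->
    delta * mdist o e <= mdist m e ->
    exists2 k : nat, k%:R <= K%:R * mdist o e &
      walk [set z | mdist o e <= K%:R * mdist m z] k o e.
  move=> q; have [Qq|nQ] := pselect (Q q); last by exists 0%N.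
  have [K hK] := wide_detour SV (E1 q (Qp _ Qq)) (edges_wide (Qp _ Qq)) d0.
  by exists K.
have [K hK] := finite_nat_bound Kq fQ.
exists K.+1; split=> // q x y m Qq qe Kl dx dy.
have KqK : (Kq q)%:R <= K.+1%:R :> R by rewrite ler_nat leqW// hK.
pose g : X := SigSub (mem_set (gensetV SV (set_mem (valP x)))).
have gx : val (word_mul g x) = 1%g by rewrite /= mulVg.
have h u v : mdist (word_mul g u) (word_mul g v) = mdist u v by exact: word_mul_mdist.
have [||||k kl wk] := hKq q Qq (word_mul g x) (word_mul g y) (word_mul g m) gx.
- by [].
- by rewrite h; exact: le_trans Kl.
- by rewrite !h.
- by rewrite !h.
exists k; first by apply: (le_trans kl); rewrite h ler_wpM2r// mdist_ge0.
have back u : word_mul x (word_mul g u) = u by apply: val_inj; rewrite /= mulVKg.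
have := walk_map (f := word_mul x) (B := [set z | mdist x y <= K.+1%:R * mdist m z]) _ _ wk.
rewrite !back; apply=> [u v|z]; first by rewrite word_mul_mdist.
rewrite /= h -{2}(back m) word_mul_mdist => hz; apply: (le_trans hz).
by rewrite ler_wpM2r// mdist_ge0.
Qed.

(** The rate [K'] comes before [r0] because the divergence of [sigma] in [V] is available for every
    rate, with a radius that depends on the rate. *)
Lemma diverges_transfer (K : R) : exists K' : R, forall r0, exists r1,
  forall sigma : nat -> X, diverges_at K' r0 sigma ->
    diverges_at K r1 (iota \o sigma).
Proof.
have [Q [F [B [D [fQ fF Qp FV chain]]]]] := tree_chain p SG act_split.
have [C C1 bil] := vertex_bilip act_split edges_undistorted SV SG.
have C0 : 0 < C by lra.
have [BF hBF] := finite_wle SV fF FV.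
pose K0 := `|K| + 1; have K01 : 1 <= K0 by rewrite /K0 lerDr.
have KK0 : K <= K0 by rewrite /K0; have := ler_norm K; lra.
pose c5 : R := C * (1 + 2 * B%:R) + BF%:R.
have B0 : 0 <= B%:R :> R by []. have BF0 : 0 <= BF%:R :> R by [].
have D0 : 0 <= D%:R :> R by [].
have c50 : 0 < c5 by rewrite /c5; nra.
(* Chosen so that a chord made by at most [D * K0 * r] steps satisfies
   [delta * chord <= r / (2 * C)], which is what its ends are known to keep from [m]. *)
pose delta := (2 * C)^-1 / (c5 * (D%:R * K0) + 1).
have den0 : 0 < c5 * (D%:R * K0) + 1.
  by have : 0 <= c5 * (D%:R * K0); [rewrite !mulr_ge0//; lra|lra].
have d0 : 0 < delta by rewrite divr_gt0// invr_gt0; lra.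
have [Kd [Kd0 detour]] := edge_detours fQ Qp d0.
have Kd1 : 1 <= Kd%:R :> R by rewrite ler1n.
pose K3 : R := Kd%:R * c5 + 1 + BF%:R + 1.
have K30 : 0 <= K3 by rewrite /K3; nra.
pose K4 : R := 8 * C * Kd%:R.
have K40 : 0 < K4 by rewrite /K4 !mulr_gt0//; lra.
(* [K3] is the cost in [V] of a unit step, [D * K0 * r] bounds the number of steps, and [K4]
   converts [r] into the smaller radius [rad]. *)
exists (K3 * D%:R * K0 * K4) => r0.
pose rC := 2 * C * (4 + 2 * BF%:R + 2 * Kd%:R); pose rB := 2 * B%:R + 2 * C * BF%:R.
(* The first term makes [rad] exceed [r0]; the other two make [r] large compared with the additive
   constants [B], [BF] and the detour threshold [Kd]. *)
pose r1 := Num.max (K4 * `|r0|) (Num.max rC rB).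
have r10 : 0 <= r1 by rewrite /r1 le_max mulr_ge0// ltW.
exists r1 => sigma dv; apply: (diverges_leq r10 KK0).
move=> t1 t0 t2 r n tt wk nK; rewrite leNgt; apply/negP => rr1.
have r0' : 0 < r by exact: le_lt_trans r10 rr1.
move: rr1; rewrite !gt_max => /and3P[rK rrC rrB].
set m := sigma t0; pose rho := r / (2 * C).
have [rho0 Kdrho radE rad_rho] := scaled_radius C1 BF0 Kd1 rrC.
rewrite -/rho -/K4 in rho0 Kdrho radE rad_rho.
pose rad := r / K4; rewrite -/rad in radE rad_rho.
pose pt (g : G) : Y := SigSub (mem_set (I : [set: G] g)).
pose A := [set g | r <= mdist (iota m) (pt g)].
have rhop : 0 < rho by rewrite divr_gt0// mulr_gt0.
have pt_val (g : G) (x : X) : val x = g -> iota x = pt g.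
  by move=> xg; apply: val_inj.
have near_far (x : X) : Gnear SG B A (val x) -> rho + BF%:R <= mdist m x.
  move=> [g Ag gx]; have h : mdist (pt g) (iota x) <= B%:R by apply/word_mdistP.
  have [_ h2] := bil m x; apply: far_bound C1 BF0 rrB _ h2; apply: (le_trans Ag).
  rewrite (le_trans (metric_triangle _ (iota x) _))// lerD2l.
  by rewrite metric_sym.
(* The bound on [j] is what keeps chords linear in [r]. It passes to the summands of a
   concatenation, so [P] is additive. *)
pose P (x y : G) (j : nat) : Prop := j%:R <= D%:R * K0 * r ->
  exists vx vy : X, [/\ val vx = x, val vy = y & exists2 k : nat, k%:R <= K3 * j%:R &
    walk [set z | rad <= mdist m z] k vx vy].
move: wk => [l [xl lx ln lA]].
have mV (x : X) : V (val x) by exact/set_mem/valP.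
have Nr : 0 <= D%:R * K0 * r by rewrite !mulr_ge0 ?(ltW r0') ?(le_trans ler01 K01).
have [|||||||j jD] := chain A P _ _ _ (map val l) (val (iota (sigma t1))).
- move=> x y z i j Pxy Pyz ijN; rewrite natrD in ijN.
  have [|vx [vy [xE yE [k1 k1l w1]]]] := Pxy.
    by apply: le_trans ijN; rewrite lerDl.
  have [|vy' [vz [yE' zE [k2 k2l w2]]]] := Pyz.
    by apply: le_trans ijN; rewrite lerDr.
  have vyE : vy' = vy by apply: val_inj; rewrite yE yE'.
  exists vx, vz; split=> //; exists (k1 + k2)%N.
    by rewrite !natrD mulrDr lerD.
  by apply: walk_cat w1 _; rewrite -vyE.
- move=> x Vx nx _; pose vx : X := SigSub (mem_set Vx); exists vx, vx; split=> //.
  exists 0%N; first by rewrite mulr0.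
  apply: walk_refl => /=; apply: (le_trans rad_rho).
  by apply: le_trans (near_far vx nx); rewrite lerDl.
- move=> x e t j Vx nx nxet j0 Ft he et jN.
  have Ve : V e.
    case: he => [->|[q Qq qe]]; first exact: (genset1 SV).
    by have [] := (edge_groupP act_split e (Qp _ Qq)).1 qe.
  pose vx : X := SigSub (mem_set Vx).
  pose u : X := SigSub (mem_set (gensetM SV Vx Ve)).
  pose y : X := SigSub (mem_set (gensetM SV Vx (gensetM SV Ve (FV _ Ft)))).
  have j1 : 1 <= j%:R :> R by rewrite ler1n.
  have uy : mdist u y <= BF%:R.
    by apply/word_mdistP; rewrite /= invgM -!mulgA mulKg mulKg; exact: hBF.
  have xy : mdist vx y <= C * (j%:R + 2 * B%:R).
    have [h _] := bil vx y; apply: (le_trans h); rewrite ler_pM2l//.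
    rewrite -natrM -natrD; apply/word_mdistP; rewrite /= mulKg; exact: et.
  have lj : mdist vx u <= c5 * j%:R.
    apply: step_bound (ltW C0) BF0 B0 j1 xy uy _.
    by rewrite (metric_sym u) metric_triangle.
  have mx := near_far vx nx; have my := near_far y nxet.
  have [|k kl wk] := join_walk (@word_graphlike R G V SV) Kd1 BF0 rho0 mx my uy lj.
    move=> lr; case: he => [e1|[q Qq qe]].
      have uE : u = vx by apply: val_inj; rewrite /= e1 mulg1.
      by move: lr; rewrite uE mdistxx ltNge => /negP[]; rewrite divr_ge0// ltW.
    have dl : delta * mdist vx u <= rho.
      have h2 : delta * (c5 * (D%:R * K0) + 1) * r = rho.
        by rewrite /delta divfK ?gt_eqF// mulrC.
      rewrite -h2 -[leRHS]mulrA ler_pM2l//; apply: (le_trans lj).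
      rewrite [leRHS]mulrDl mul1r -[leRHS]addrC -mulrA -[leLHS]add0r; apply: lerD (ltW r0') _.
      by rewrite ler_pM2l.
    apply: (detour q) => //.
    - by rewrite /= mulKg.
    - exact: le_trans (ltW Kdrho) (ltW lr).
    - by apply: (le_trans dl); apply: le_trans mx; rewrite lerDl.
    - apply: (le_trans dl); have := metric_triangle m u y.
      by move=> /(le_trans my); rewrite -lerBlDr; apply: le_trans; rewrite lerBrDr lerD2l.
  exists vx, y; split=> //; exists k; last first.
    by apply: walk_sub wk => // z /=; rewrite radE.
  apply: (le_trans kl).
  have -> : K3 * j%:R = Kd%:R * (c5 * j%:R) + (BF%:R + 2) * j%:R.
    by rewrite /K3; ring.
  by rewrite -addrA lerD2l ler_peMr// addr_ge0.
- rewrite path_map; apply: sub_path xl => a b; rewrite /step => ab.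
  by apply/asboolP/(word_mdistP a b 1).
- exact: mV.
- by rewrite last_map lx; exact: mV.
- move=> g /(mapP (s := iota (sigma t1) :: l)) [z zl ->]; have := lA _ zl.
  by rewrite /A /= (_ : pt (val z) = z)//; exact: val_inj.
have nN : (size l * D)%:R <= D%:R * K0 * r.
  rewrite natrM mulrC -mulrA ler_wpM2l//; apply: le_trans nK.
  by rewrite ler_nat.
rewrite size_map in jD; move=> Pj; have [|vx [vy [xE yE [k kl wk]]]] := Pj.
  by apply: le_trans nN; rewrite ler_nat.
have vxE : vx = sigma t1 by apply: val_inj; rewrite xE.
have vyE : vy = sigma t2 by apply: val_inj; rewrite yE last_map lx.
rewrite vxE vyE in wk.
have : rad <= r0.
  apply: dv tt wk _; apply: (le_trans kl).
  have -> : K3 * D%:R * K0 * K4 * rad = K3 * (D%:R * K0 * r).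
    by rewrite /rad; field; rewrite gt_eqF.
  by rewrite ler_wpM2l//; apply: le_trans nN; rewrite ler_nat.
rewrite /rad ler_pdivrMr// mulrC leNgt => /negP; apply.
by apply: le_lt_trans rK; rewrite ler_pM2l// ler_norm.
Qed.

(** For each [C], the Morse property in [G] demands a rate [K], the transfer turns it into a rate
    [K'] in [V], and the gauge [N] supplies the radius for [K']. None of these depends on
    [sigma]. *)
Lemma vertex_morse (L : R) (N : R -> R) : 1 <= L -> morse_gauge N ->
  exists2 N', morse_gauge N' & forall sigma : nat -> X, qg_seq L sigma ->
    morse_set N (range sigma) -> morse_set N' (range (iota \o sigma)).
Proof.
move=> L1 gN.
have [C0 C01 bil] := vertex_bilip act_split edges_undistorted SV SG.
have L'1 : 1 <= C0 * L by rewrite mulr_ege1.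
have /choice [N' hN'] : forall C, exists n, 1 <= C -> 0 <= n /\
    forall sigma : nat -> X, qg_seq L sigma -> morse_set N (range sigma) ->
      morse_at C n (range (iota \o sigma)).
  move=> C; have [C1|] := leP 1 C; last by exists 0.
  have [K hK] := diverges_morse (@word_graphlike R G _ SG) L'1 C1.
  have [K' hK'] := diverges_transfer K.
  have [r0 hr0] := morse_diverges (@word_graphlike R G _ SV) L1 gN K'.
  have [r1 hr1] := hK' r0; have [n n0 hn] := hK r1.
  exists n => _; split=> // sigma qs ms; apply: hn; last first.
    by apply: hr1; exact: hr0.
  move=> i j ij; have /andP[h1 h2] := qs i j ij; have [b1 b2] := bil (sigma i) (sigma j).
  have C00 : 0 < C0 by lra.
  rewrite /=; apply/andP; split.
    have h : C0^-1 * (L^-1 * (j%:R - i%:R) - L) <= mdist (iota (sigma i)) (iota (sigma j)).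
      by rewrite ler_pdivrMl//; lra.
    have : C0^-1 * L <= C0 * L.
      rewrite ler_pM2r; last lra.
      by apply: (@le_trans _ _ 1) => //; rewrite invf_le1.
    rewrite invfM -mulrA; lra.
  have : C0 * mdist (sigma i) (sigma j) <= C0 * (L * (j%:R - i%:R) + L).
    by rewrite ler_pM2l.
  lra.
exists N' => [C C1|sigma qs ms C C1]; first by have [] := hN' C C1.
by have [_] := hN' C C1; exact.
Qed.

End VertexMorse.

(** * Cayley graphs *)

Section Interpolation.
Context {R : realType} {Gr : conn_graph}.
Implicit Types (a b c d v : Gr) (f : Gr -> R).
Local Notation Y := (realisation R Gr).

Lemma sum_edge_point f a b (t : R) (r : seq Gr) : uniq r -> a \in r -> b \in r ->
  \sum_(v <- r) edge_point a b t v * f v = (1 - t) * f a + t * f b.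
Proof.
move=> ur ar br; under eq_bigr do rewrite mulrDl.
rewrite big_split/=; congr (_ + _).
  rewrite (bigD1_seq a)//= eqxx mulr1 big1 ?addr0// => v /negbTE ->.
  by rewrite mulr0 mul0r.
rewrite (bigD1_seq b)//= eqxx mulr1 big1 ?addr0// => v /negbTE ->.
by rewrite mulr0 mul0r.
Qed.

(** The affine extension of [f] to the realisation is well defined: it is the sum of coordinate
    times [f], taken over a finite list that contains all four endpoints. *)
Lemma edge_point_interp f a b c d (t s : R) : edge_point a b t = edge_point c d s ->
  (1 - t) * f a + t * f b = (1 - s) * f c + s * f d.
Proof.
move=> e; pose r := undup [:: a; b; c; d].
rewrite -(@sum_edge_point f a b t r) ?undup_uniq ?mem_undup ?inE ?eqxx ?orbT//.
by rewrite e (@sum_edge_point f c d s r) ?undup_uniq ?mem_undup ?inE ?eqxx ?orbT.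
Qed.

(** The affine extension of a 1-Lipschitz function on vertices is 1-Lipschitz along chains, which
    gives lower bounds for the length metric. *)
Lemma chain_interp f (x y : Y) l : (forall a b, adj a b -> `|f a - f b| <= 1) ->
  chain x y l -> forall a b c d (t s : R),
  val x = edge_point a b t -> val y = edge_point c d s ->
  `|(1 - t) * f a + t * f b - ((1 - s) * f c + s * f d)| <= l.
Proof.
move=> f1; elim=> [{}x|{}x {}y z {}l a0 b0 [ab0 [t0 t01 xe]] [_ [s0 s01 ye]] _ IH] a b c d t s xt zs.
  by rewrite (edge_point_interp f (etrans (esym xt) zs)) subrr normr0.
have {}IH := IH a0 b0 c d s0 s ye zs.
rewrite (edge_point_interp f (etrans (esym xt) xe)).
apply: (le_trans (ler_distD ((1 - s0) * f a0 + s0 * f b0) _ _)); apply: lerD => //.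
rewrite xe ye /edge_point eqxx; have [->|ne] := eqVneq a0 b0.
  by rewrite !mulr1 (_ : _ - _ = 0) ?normr0//; ring.
rewrite !mulr1 !mulr0 !addr0.
have -> : (1 - t0) * f a0 + t0 * f b0 - ((1 - s0) * f a0 + s0 * f b0) =
    (1 - t0 - (1 - s0)) * (f a0 - f b0) by ring.
rewrite normrM ler_piMr// f1//.
by move: ab0; rewrite (negbTE ne).
Qed.

Lemma chain_ge0 (x y : Y) l : chain x y l -> 0 <= l.
Proof. by elim=> // {}x {}y z {}l a b _ _ _ l0; rewrite addr_ge0. Qed.

Lemma mdist_le_chain (x y : Y) l : chain x y l -> mdist x y <= l.
Proof. by move=> xy; apply: ge_inf => //; exists 0 => m; exact: chain_ge0. Qed.

Lemma edge_mdist a b (x y : Y) : on_edge a b (val x) -> on_edge a b (val y) ->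
  mdist x y <= `|val x a - val y a|.
Proof.
move=> xe ye; rewrite -[leRHS]addr0; apply: mdist_le_chain.
exact: chain_step xe ye (chain_refl _).
Qed.

Lemma vertex_near (x : Y) : exists a, mdist x (vertex_point a) <= 1.
Proof.
have [a [b [ab [t t01 xe]]]] := set_mem (valP x); exists a.
apply: (@le_trans _ _ `|val x a - edge_point a a 0 a|).
  apply: (@edge_mdist a b); first by split=> //; exists t.
  split=> //; exists 0; first by rewrite lexx ler01.
  by apply/funext => v; rewrite /= /edge_point !mul0r.
move: t01 => /andP[t0 t1]; rewrite xe /edge_point eqxx ler_norml.
by case: (a == b) => /=; lra.
Qed.

Lemma chain_mdist_ge (f : Gr -> R) (x y : Y) a b c d t s :
  (forall a b, adj a b -> `|f a - f b| <= 1) ->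
  val x = edge_point a b t -> val y = edge_point c d s ->
  (exists l, chain x y l) ->
  `|(1 - t) * f a + t * f b - ((1 - s) * f c + s * f d)| <= mdist x y.
Proof.
move=> f1 xe ye [l0 xy]; apply: lb_le_inf; first by exists l0.
by move=> l h; exact: chain_interp f1 h _ _ _ _ _ _ xe ye.
Qed.

Definition clip (t : R) : R := Num.min 1 (Num.max 0 t).

Lemma clip01 t : 0 <= clip t <= 1.
Proof. by rewrite le_min ler01 le_max lexx ge_min lexx. Qed.

Lemma clipE t : 0 <= t <= 1 -> clip t = t.
Proof. by rewrite /clip => /andP[/max_idPr -> /min_idPr ->]. Qed.

Lemma clip_lip t s : `|clip t - clip s| <= `|t - s|.
Proof.
have clipP u : [\/ u <= 0 /\ clip u = 0, 0 <= u <= 1 /\ clip u = u | 1 <= u /\ clip u = 1].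
  have [u0|u0] := leP u 0.
    by apply: Or31; rewrite /clip (max_idPl u0) min_r.
  have [u1|u1] := leP u 1; first by apply: Or32; rewrite clipE//; lra.
  by apply: Or33; rewrite /clip (max_idPr (ltW u0)) min_l ltW.
wlog st : t s / s <= t.
  move=> W; have [/W//|/ltW/W] := leP s t.
  by rewrite distrC (distrC t).
rewrite [leRHS]ger0_norm ?subr_ge0// ler_norml.
by case: (clipP t) => -[? ->]; case: (clipP s) => -[? ->]; lra.
Qed.

(* The edge from [a] to [b], extended by constants outside of [0, 1]. *)
Lemma edge_map_subproof a b (t : R) : (a == b) || adj a b ->
  exists c d, on_edge c d (edge_point a b (clip t)).
Proof. by move=> ab; exists a, b; split=> //; exists (clip t) => //; exact: clip01. Qed.

Definition edge_map a b (ab : (a == b) || adj a b) (t : R) : Y :=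
  SigSub (mem_set (edge_map_subproof t ab)).

Lemma edge_map_on a b (ab : (a == b) || adj a b) t : on_edge a b (val (edge_map ab t)).
Proof. by split=> //; exists (clip t) => //; exact: clip01. Qed.

Lemma edge_map_lip a b (ab : (a == b) || adj a b) t s :
  mdist (edge_map ab t) (edge_map ab s) <= `|t - s|.
Proof.
apply: (le_trans (edge_mdist (edge_map_on ab t) (edge_map_on ab s))).
apply: le_trans (clip_lip t s); rewrite /= /edge_point eqxx ler_norml.
have := ler_norm (clip t - clip s); have := ler_norm (clip s - clip t).
by rewrite distrC; case: (a == b) => /=; have := normr_ge0 (clip t - clip s); lra.
Qed.

Lemma edge_map0 a b (ab : (a == b) || adj a b) : edge_map ab 0 = vertex_point a.
Proof.
apply: val_inj; apply/funext => v; rewrite /= clipE ?lexx ?ler01//.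
by rewrite /edge_point !mul0r.
Qed.

Lemma edge_map1 a b (ab : (a == b) || adj a b) : edge_map ab 1 = vertex_point b.
Proof.
apply: val_inj; apply/funext => v; rewrite /= clipE ?lexx ?ler01//.
by rewrite /edge_point subrr !mul0r subr0 add0r addr0.
Qed.

Lemma edge_map_surj a b (x : Y) : on_edge a b (val x) ->
  exists (ab : (a == b) || adj a b) t, 0 <= t <= 1 /\ x = edge_map ab t.
Proof.
move=> [ab [t t01 xe]]; exists ab, t; split=> //.
by apply: val_inj; rewrite xe /= clipE.
Qed.

End Interpolation.

Section CayleySpace.
Context {R : realType} {G : groupType} {H : set G} (S : genset H).
Local Notation X := (word_space R S).
Local Notation Y := (cayley_space R S).

Definition nu (x : X) : Y := vertex_point (x : cayley S).

Lemma cayley_adj_mdist (x y : X) : adj (x : cayley S) (y : cayley S) -> mdist x y <= 1.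
Proof.
move=> /andP[_ /asboolP h]; apply/(word_mdistP x y 1); exact: wle_gen.
Qed.

Lemma mdist_cayley_adj (x y : X) : mdist x y <= 1 ->
  ((x : cayley S) == y) || adj (x : cayley S) y.
Proof.
move=> /(word_mdistP x y 1) [w [wS w1 wE]].
have [->|xy] := eqVneq (x : cayley S) y; first by [].
rewrite /= /adj /= /cayley_adj xy /=; apply/asboolP.
case: w wS w1 wE => [|s [|//]] wS _; rewrite ?big_cons big_nil ?mulg1.
  move=> e; case/eqP: xy; apply: val_inj.
  by rewrite -[RHS](mulVKg (val x)) -e mulg1.
by move=> <-; apply: wS; rewrite mem_head.
Qed.

Lemma word_interp_lip (o a b : X) : adj (a : cayley S) b ->
  `|mdist o a - mdist o b| <= 1.
Proof.
move=> /cayley_adj_mdist ab; rewrite ler_norml.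
have := metric_triangle o a b; have := metric_triangle o b a.
by rewrite (metric_sym b a); lra.
Qed.

(** The edges of the walk are laid end to end, and the curve stays at its end if the walk has fewer
    than [n] steps. Only nonnegative parameters are controlled. *)
Lemma segment n (x y : X) : walk setT n x y -> exists c : R -> Y,
  [/\ c 0 = nu x, c n%:R = nu y & forall s t, 0 <= s -> 0 <= t ->
     mdist (c s) (c t) <= `|s - t|].
Proof.
move=> [p [xp py pn _]]; elim: p n x xp py pn => [|z p IH] n x /=.
  move=> _ -> _; exists (fun=> nu y); split=> // s t _ _.
  by rewrite mdistxx.
case: n => [//|n] /andP[/mdist_cayley_adj xz zp] py pn.
have [c [c0 cn cl]] := IH n z zp py pn.
have e0 := edge_map0 (R := R) xz; have e1 := edge_map1 (R := R) xz.
exists (fun t => if t <= 1 then edge_map xz t else c (t - 1)); split.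
- by rewrite ler01 e0.
- case: n cn {IH pn} => [|n] cn; first by rewrite lexx e1 -[RHS]cn c0.
  by rewrite ifF ?[n.+2%:R]mulrSr ?addrK// gerDr lt_geF.
move=> s t; wlog st : s t / s <= t.
  move=> W s0 t0; have [/W|/ltW/W] := leP s t; first exact.
  by rewrite metric_sym distrC; exact.
move=> s0 t0; have [t1|t1] := leP t 1.
  by rewrite ifT; [exact: edge_map_lip|lra].
have [s1|s1] := leP s 1; last first.
  by rewrite (le_trans (cl _ _ _ _))//; [lra|lra|]; rewrite opprB addrA subrK.
apply: (le_trans (metric_triangle _ (nu z) _)).
have h1 : mdist (edge_map xz s : Y) (nu z) <= 1 - s.
  have h := edge_map_lip (R := R) xz s 1; rewrite e1 in h; apply: (le_trans h).
  by rewrite distrC ger0_norm//; lra.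
have h2 : mdist (nu z) (c (t - 1)) <= t - 1.
  rewrite -c0; apply: (le_trans (cl _ _ _ _)); [lra|lra|].
  by rewrite distrC subr0 ger0_norm//; lra.
by rewrite distrC ger0_norm; lra.
Qed.

Lemma walk_chain n (x y : X) : walk setT n x y ->
  exists2 l : R, l <= n%:R & chain (nu x) (nu y) l.
Proof.
move=> [p [xp py pn _]]; elim: p n x xp py pn => [|z p IH] n x /=.
  by move=> _ -> _; exists 0 => //; exact: chain_refl.
case: n => [//|n] /andP[/mdist_cayley_adj xz zp] py pn.
have [l ln zl] := IH n z zp py pn.
have ex := edge_map_on (R := R) xz 0; rewrite edge_map0 in ex.
have ez := edge_map_on (R := R) xz 1; rewrite edge_map1 in ez.
eexists; last exact: chain_step ex ez zl.
rewrite -natr1 addrC lerD//= /edge_point !eqxx.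
by case: (_ == _) => /=; rewrite ler_norml; lra.
Qed.

(** The upper bound is a walk; the lower bound is the extension of the distance function from
    [x]. *)
Lemma nu_mdist (x y : X) : mdist (nu x) (nu y) = mdist x y.
Proof.
have [n nE] := word_mdist_nat x y.
have [l ln xy] : exists2 l : R, l <= n%:R & chain (nu x) (nu y) l.
  by apply/walk_chain/word_graphlike; rewrite nE.
apply/eqP; rewrite eq_le nE (le_trans (mdist_le_chain xy) ln) /= -nE.
have := @chain_mdist_ge R (cayley S) (fun a => mdist x (a : X)) (nu x) (nu y)
  x x y y 0 0 (@word_interp_lip x) erefl erefl (ex_intro _ l xy).
rewrite !mul0r !subr0 !mul1r !addr0 mdistxx sub0r normrN ger0_norm//.
exact: mdist_ge0.
Qed.

Lemma nu_qie : qie 1 nu.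
Proof.
by move=> x y; rewrite nu_mdist invr1 !mul1r; lra.
Qed.

Lemma nu_near (y : Y) : exists x, mdist y (nu x) <= 1.
Proof. by have [a h] := vertex_near y; exists a. Qed.

Lemma word_ball_finite n : finite_set [set g : G | wle S n g].
Proof.
elim: n => [|n IH].
  apply: (sub_finite_set (B := [set 1%g])) => // g [w [_ w0 <-]].
  by case: w w0 => //= _; rewrite big_nil.
have fL : finite_set (gens S `|` [set g^-1%g | g in gens S]).
  by have [fS _] := gensP S; rewrite finite_setU; split=> //; exact: finite_image.
apply: (sub_finite_set (B := [set 1%g] `|`
  [set (s * g)%g | s in gens S `|` [set g^-1%g | g in gens S] & g in [set g | wle S n g]])).
  move=> g [[|s w] [wS wn <-]]; first by left; rewrite big_nil.
  right; exists s.
    have [?|?] := wS s (mem_head _ _); first by left.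
    by right; exists s^-1%g => //; rewrite invgK.
  exists (\prod_(t <- w) t)%g; last by rewrite big_cons.
  by exists w; split=> // t tw; apply: wS; rewrite inE tw orbT.
by rewrite finite_setU; split=> //; exact: finite_image2.
Qed.

Lemma word_mdist_ball_finite (o : X) (r : R) : finite_set [set x | mdist o x <= r].
Proof.
pose n := (Num.truncn `|r|).+1.
have h : finite_set ((fun x : X => (val o)^-1 * val x)%g @^-1` [set g : G | wle S n g]).
  apply: finite_preimage; last exact: word_ball_finite.
  by move=> x y _ _ /(congr1 (fun g => val o * g)%g); rewrite !mulVKg => /val_inj.
apply: sub_finite_set h => x /= xr; apply/(word_mdistP o x n).
apply: (le_trans xr); have /andP[_ /ltW] := truncn_itv (normr_ge0 r).
by apply: le_trans; exact: ler_norm.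
Qed.

Lemma edge_compact (a b : cayley S) : compact [set y : Y | on_edge a b (val y)].
Proof.
have [ab|nab] := boolP ((a == b) || adj a b); last first.
  rewrite (_ : [set _ | _] = set0); first exact: compact0.
  by apply/seteqP; split=> // y [ab _]; rewrite ab in nab.
have -> : [set y : Y | on_edge a b (val y)] = edge_map ab @` `[0, 1]%classic.
  apply/seteqP; split=> [y /edge_map_surj[ab' [t [t01 ->]]]|_ [t _ <-]].
    by exists t; [rewrite /= in_itv|rewrite (bool_irrelevance ab' ab)].
  exact: edge_map_on.
apply: continuous_compact; last exact: segment_compact.
apply: continuous_subspaceT => t A /nbhs_ballP[e e0 eA].
apply/nbhs_ballP; exists e => // s ts; apply: eA; rewrite ballEmdist /=.
exact: le_lt_trans (edge_map_lip _ _ _) ts.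
Qed.

(** A ball meets only finitely many edges, and each of them is compact. *)
Lemma cayley_ball_compact (o : X) (r : R) :
  exists2 K : set Y, compact K & [set y | mdist (nu o) y <= r] `<=` K.
Proof.
pose B := [set x : X | mdist o x <= r + 2].
exists (\bigcup_(ab in B `*` B) [set y : Y | on_edge (ab.1 : cayley S) ab.2 (val y)]).
  have : finite_set (B `*` B) by apply: finite_setX; exact: word_mdist_ball_finite.
  move=> /finite_seqP[s ->]; rewrite bigcup_seq; apply: big_ind => //.
  - exact: compact0.
  - by move=> ? ? ? ?; exact: compactU.
  - by move=> ab _; exact: edge_compact.
move=> y /= yr; have [a [b yab]] := set_mem (valP y).
have [ab [t [t01 yE]]] := edge_map_surj yab.
exists (a, b) => //; split; rewrite /B /= -nu_mdist.
  have := edge_map_lip (R := R) ab t 0; rewrite edge_map0 -yE subr0 ger0_norm; last lra.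
  by have := metric_triangle (nu o) y (nu a); rewrite /nu; lra.
have := edge_map_lip (R := R) ab t 1; rewrite edge_map1 -yE distrC ger0_norm; last lra.
by have := metric_triangle (nu o) y (nu b); rewrite /nu; lra.
Qed.

End CayleySpace.

(** * Rays *)

Section Rays.
Context {R : realType}.

Lemma hl_subproof (t : R) : Num.max 0 t \in (`[0, +oo[%classic : set R).
Proof. by apply/mem_set; rewrite /= in_itv /= andbT le_max lexx. Qed.

Definition hl (t : R) : halfline R := SigSub (hl_subproof t).

Lemma val_hl t : 0 <= t -> val (hl t) = t.
Proof. by move=> t0; rewrite /= (max_idPr t0). Qed.

Lemma halfline_ge0 (t : halfline R) : 0 <= val t.
Proof. by have /set_mem := valP t; rewrite /= in_itv /= andbT. Qed.

Lemma hlK (t : halfline R) : hl (val t) = t.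
Proof. by apply: val_inj; rewrite val_hl// halfline_ge0. Qed.

Lemma hl0 : hl 0 = halfline0.
Proof. by apply: val_inj; rewrite val_hl. Qed.

Definition quasi_ray (X : metricType R) (L : R) (a : halfline R -> X) : Prop :=
  forall s t, L^-1 * `|val s - val t| - L <= mdist (a s) (a t)
    <= L * `|val s - val t| + L.

(** One-sided and without comparison of parameters; [fellow_sym] recovers the other side. *)
Definition fellow (X : metricType R) (D : R) (a b : halfline R -> X) : Prop :=
  forall s, exists t, mdist (a s) (b t) <= D.

Lemma quasi_ray_dist0 (X : metricType R) L (a : halfline R -> X) t : quasi_ray L a ->
  L^-1 * val t - L <= mdist (a halfline0) (a t) <= L * val t + L.
Proof.
move=> qa; have := qa halfline0 t.
by rewrite sub0r normrN ger0_norm// halfline_ge0.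
Qed.

Lemma fellow_sym (X : metricType R) (L D : R) : 1 <= L -> 0 <= D ->
  exists2 D', 0 <= D' & forall a b : halfline R -> X, quasi_ray L a -> quasi_ray L b ->
    a halfline0 = b halfline0 -> fellow D a b -> fellow D' b a.
Proof.
move=> L1 D0; have L0 : 0 < L by lra.
pose J := L * (2 * L + 2 * D + L) + L * (D + L).
have J0 : 0 <= J by rewrite /J; nra.
exists (L * J + L + D); first by rewrite !addr_ge0// ?mulr_ge0// ltW.
move=> a b qa qb ab fab u.
have /choice [tt htt] : forall n : nat, exists t, mdist (a (hl n%:R)) (b t) <= D.
  by move=> n; exact: fab.
(* The points [tt n] advance along [b] by bounded jumps, from near 0 to infinity, so one of them is
   near [u]. [J] adds the bound on a jump to the bound on [tt 0]. *)
pose P n := val u <= val (tt n).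
have exP : exists n, P n.
  exists (Num.truncn (L * (L * val u + 2 * L + D))).+1; set n := _.+1.
  have u0 := halfline_ge0 u.
  have nu : L * (L * val u + 2 * L + D) < n%:R.
    have x0 : 0 <= L * (L * val u + 2 * L + D).
      by rewrite mulr_ge0 ?addr_ge0 ?mulr_ge0// ltW.
    by have /andP[_ h] := truncn_itv x0.
  rewrite /P leNgt; apply/negP => ltu.
  have /andP[q1 _] := quasi_ray_dist0 (hl n%:R) qa; rewrite val_hl// in q1.
  have /andP[_ q2] := quasi_ray_dist0 (tt n) qb.
  have tr := metric_triangle (b halfline0) (b (tt n)) (a (hl n%:R)).
  rewrite (metric_sym (b (tt n))) in tr; have := htt n; rewrite ab in q1 => h.
  have : L * val (tt n) <= L * val u by rewrite ler_pM2l// ltW.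
  have : L^-1 * (L * (L * val u + 2 * L + D)) < L^-1 * n%:R by rewrite ltr_pM2l ?invr_gt0.
  rewrite mulKf ?gt_eqF//; lra.
have [n Pn nmin] := ex_minnP exP.
suff [m hm] : exists m, `|val u - val (tt m)| <= J.
  exists (hl m%:R); have /andP[_ q] := qb u (tt m).
  have tr := metric_triangle (b u) (b (tt m)) (a (hl m%:R)).
  rewrite (metric_sym (b (tt m)) (a _)) in tr; have := htt m.
  have : L * `|val u - val (tt m)| <= L * J by rewrite ler_pM2l.
  lra.
case: n Pn nmin => [|n] Pn nmin.
  exists 0%N; have /andP[q _] := quasi_ray_dist0 (tt 0%N) qb.
  have h := htt 0%N; rewrite hl0 ab in h.
  have : val (tt 0%N) <= L * (D + L) by rewrite -ler_pdivrMl//; lra.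
  have : 0 <= L * (2 * L + 2 * D + L) by rewrite mulr_ge0//; lra.
  rewrite /P in Pn; have := halfline_ge0 u; rewrite ler_norml /J; lra.
exists n.+1; have nPn : val (tt n) < val u.
  by rewrite ltNge; apply/negP => /nmin; rewrite ltnn.
have /andP[_ qa1] := qa (hl n%:R) (hl n.+1%:R).
rewrite !val_hl// -natr1 opprD addrA subrr sub0r normrN normr1 mulr1 natr1 in qa1.
have /andP[qb1 _] := qb (tt n) (tt n.+1).
have t1 := metric_triangle (b (tt n)) (a (hl n%:R)) (b (tt n.+1)).
have t2 := metric_triangle (a (hl n%:R)) (a (hl n.+1%:R)) (b (tt n.+1)).
rewrite (metric_sym (b (tt n)) (a _)) in t1.
have h1 := htt n; have h2 := htt n.+1.
have : `|val (tt n) - val (tt n.+1)| <= L * (2 * L + 2 * D + L).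
  by rewrite -ler_pdivrMl//; lra.
have : 0 <= L * (D + L) by rewrite mulr_ge0//; lra.
by rewrite /P in Pn; rewrite !ler_norml /J; lra.
Qed.

Lemma fellow_hausdorff (X : metricType R) (D D' : R) (a b : halfline R -> X) :
  fellow D a b -> fellow D' b a -> hausdorff_le (Num.max D D') (range a) (range b).
Proof.
move=> ab ba; split=> _ [s _ <-].
  by have [t h] := ab s; exists (b t); [exists t|rewrite le_max h].
have [t h] := ba s; exists (a t); first by exists t.
by rewrite metric_sym le_max h orbT.
Qed.

(** Larger than the set of geodesic rays, so that it also contains geodesic segments continued by a
    constant. *)
Definition based_lip (X : metricType R) (o : X) : set (halfline R -> X) :=
  [set g | g halfline0 = o /\ forall s t, mdist (g s) (g t) <= `|val s - val t|].

Lemma halfline_near (t : halfline R) (e : R) : 0 < e ->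
  \forall s \near t, `|val t - val s| < e.
Proof.
move=> e0; have : continuous (set_val : halfline R -> R) by exact: initial_continuous.
by move=> /(_ t) /cvgrPdist_lt /(_ e e0).
Qed.

Lemma ultra_fmap (I J : Type) (f : I -> J) (F : set_system I) :
  UltraFilter F -> UltraFilter (f @ F).
Proof.
move=> FU; have FP : ProperFilter F by exact: (@ultra_proper _ F FU).
split; first exact: fmap_proper_filter.
move=> H HF fH; apply/seteqP; split=> // A HA.
have [//|hA] := in_ultra_setVsetC (f @^-1` A) FU.
have /fH HCA : (f @ F) (~` A) by [].
have : H (A `&` ~` A) by exact: filterI.
by rewrite setICr => /filter_not_empty.
Qed.

(** Arzela-Ascoli for an ultrafilter: compact balls give pointwise limits, and the common Lipschitz
    constant upgrades them to convergence in the compact-open topology. *)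
Lemma ray_limit (X : metricType R) (o : X) (F : set_system {compact-open, halfline R -> X}) :
  (forall r, exists2 K : set X, compact K & [set y | mdist o y <= r] `<=` K) ->
  UltraFilter F -> F (based_lip o) ->
  exists g : {compact-open, halfline R -> X}, [/\ based_lip o g, F --> g &
    forall t e, 0 < e -> \forall h \near F, mdist (h t) (g t) < e].
Proof.
move=> cpt FU Fo; have FP : ProperFilter F by exact: (@ultra_proper _ F FU).
have ptcvg : forall t, exists y : X, (fun h : halfline R -> X => h t) @ F --> y.
  move=> t; have [K cK ballK] := cpt (val t).
  have FtU := ultra_fmap (fun h : halfline R -> X => h t) FU.
  have FK : ((fun h : halfline R -> X => h t) @ F) K.
    apply: (@filterS _ F _ _ _ _ Fo) => h [h0 hl]; apply: ballK => /=.
    by rewrite -h0 (le_trans (hl _ _))// sub0r normrN ger0_norm// halfline_ge0.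
  by have := cK; rewrite compact_ultra => /(_ _ FtU FK) [y [_ hy]]; exists y.
have [g hg] := choice ptcvg.
have ptw t e : 0 < e -> \forall h \near F, mdist (h t) (g t) < e.
  move=> e0; have : nbhs (g t) [set y | mdist (g t) y < e].
    by apply: open_nbhs_nbhs; split; [exact: open_mdist_ball|rewrite /= mdistxx].
  move=> nb; have h2 : F [set h | mdist (g t) (h t) < e] := hg t _ nb.
  by apply: (@filterS _ F _ _ _ _ h2) => h /=; rewrite metric_sym.
have gl : based_lip o g.
  split.
    apply: mdist_positivity; apply/eqP; rewrite eq_le mdist_ge0 andbT.
    apply/ler_addgt0Pl => e e0; rewrite addr0.
    have [h [[h0 _] hh]] := filter_ex (filterI Fo (ptw halfline0 e e0)).
    by rewrite -h0 metric_sym ltW.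
  move=> s t; apply/ler_addgt0Pl => e e0; have e2 : 0 < e / 2 by lra.
  have [h [[[_ hl] h1] h2]] := filter_ex (filterI (filterI Fo (ptw s _ e2)) (ptw t _ e2)).
  have := metric_triangle (g s) (h s) (g t); have := metric_triangle (h s) (h t) (g t).
  have := hl s t; rewrite (metric_sym (g s) (h s)) /= in h1 h2 *; lra.
exists g; split=> //; apply/compact_open_cvgP => K O cK oO gKO.
have [_ gL] := gl.
suff : \forall h \near F, K `<=` (fun t => O (h t)).
  by apply: filterS => h hK _ [t Kt <-]; exact: hK.
move/compact_near_coveringP : cK => cK; apply: (cK _ F) => t Kt.
have : nbhs (g t) O by apply: open_nbhs_nbhs; split=> //; apply: gKO; exists t.
move=> /nbhs_ballP[e e0 eO]; have e2 : 0 < e / 2 by have : 0 < e by []; lra.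
near=> s h; apply: eO; rewrite ballEmdist /=.
have h1 : mdist (h t) (g t) < e / 2 by near: h; exact: ptw.
have h2 : `|val t - val s| < e / 2 by near: s; exact: halfline_near.
have [_ hl] : based_lip o h by near: h; exact: Fo.
have := metric_triangle (g t) (h t) (h s); have := hl t s.
rewrite (metric_sym (g t) (h t)); lra.
Unshelve. all: by end_near. Qed.

Lemma compact_open_eval (X : metricType R) (g : {compact-open, halfline R -> X}) t (e : R) :
  0 < e -> nbhs g [set h : {compact-open, halfline R -> X} | mdist (h t) (g t) < e].
Proof.
move=> e0; have := compact_open_open (@compact_set1 _ t) (open_mdist_ball (g t) e).
move=> oC; have : nbhs g [set h : {compact-open, halfline R -> X} |
    h @` [set t] `<=` [set y | mdist (g t) y < e]].
  apply: open_nbhs_nbhs; split => // _ [_ -> <-] /=; by rewrite mdistxx.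
by apply: filterS => h hO; rewrite /= metric_sym; apply: hO; exists t.
Qed.

Lemma geodesic_limit (X : metricType R) (I : Type) (F : set_system I) {FF : ProperFilter F}
    (gamma : I -> halfline R -> X) (g : halfline R -> X) :
  (forall t e, 0 < e -> \forall j \near F, mdist (gamma j t) (g t) < e) ->
  (forall s t, \forall j \near F, mdist (gamma j s) (gamma j t) = `|val s - val t|) ->
  geodesic_ray g.
Proof.
move=> ptw geo s t; apply/eqP; rewrite eq_le; apply/andP; split;
  apply/ler_addgt0Pl => e e0; have e2 : 0 < e / 2 by lra.
  have [j [[h1 h2] h3]] := filter_ex (filterI (filterI (ptw s _ e2) (ptw t _ e2)) (geo s t)).
  have := metric_triangle (g s) (gamma j s) (g t).
  have := metric_triangle (gamma j s) (gamma j t) (g t).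
  rewrite (metric_sym (g s) (gamma j s)) /= in h1 h2 h3 *; lra.
have [j [[h1 h2] h3]] := filter_ex (filterI (filterI (ptw s _ e2) (ptw t _ e2)) (geo s t)).
have := metric_triangle (gamma j s) (g s) (gamma j t).
have := metric_triangle (g s) (g t) (gamma j t).
rewrite (metric_sym (g t) (gamma j t)) /= in h1 h2 h3 *; lra.
Qed.

(** The map [i] need not be continuous, so the images [i \o gamma j] need not converge. Instead the
    parameters of the nearby points converge, and the coarse bound for [i] at two points at distance
    at most 2 adds [3 * L]. *)
Lemma fellow_limit (X Y : metricType R) (L D : R) (i : X -> Y) (o : X) (I : Type)
    (F : set_system I) (gamma : I -> halfline R -> X) (eta : I -> halfline R -> Y)
    (g : halfline R -> X) (h : halfline R -> Y) : UltraFilter F -> 1 <= L -> qie L i ->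
  (\forall j \near F, [/\ based_lip o (gamma j), geodesic_ray (gamma j),
      based_lip (i o) (eta j) & fellow D (eta j) (i \o gamma j)]) ->
  (forall t e, 0 < e -> \forall j \near F, mdist (gamma j t) (g t) < e) ->
  (forall t e, 0 < e -> \forall j \near F, mdist (eta j t) (h t) < e) ->
  fellow (D + 1 + 3 * L) h (i \o g).
Proof.
move=> FU L1 qi Fj pg ph s; have FP : ProperFilter F by exact: (@ultra_proper _ F FU).
(* A point of [i \o gamma j] within [D] of [eta j s] cannot have a larger parameter, as both start
   at [i o]. *)
pose S := L * (val s + D + L).
have /choice [u hu] : forall j, exists t, fellow D (eta j) (i \o gamma j) ->
    mdist (eta j s) (i (gamma j t)) <= D.
  move=> j; have [fe|nf] := pselect (fellow D (eta j) (i \o gamma j)); last by exists halfline0.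
  by have [t ht] := fe s; exists t.
have FuU := ultra_fmap (fun j => val (u j)) FU.
have FuS : ((fun j => val (u j)) @ F) `[0, S]%classic.
  apply: (@filterS _ F _ _ _ _ Fj) => j [[g0 gl] geo [e0 el] fe] /=.
  rewrite in_itv /= halfline_ge0 /=.
  have h1 := hu j fe; have := geo halfline0 (u j).
  rewrite sub0r normrN ger0_norm ?halfline_ge0// => <-.
  have /andP[q _] := qi (gamma j halfline0) (gamma j (u j)).
  have := el halfline0 s; rewrite sub0r normrN ger0_norm ?halfline_ge0// => h2.
  have := metric_triangle (eta j halfline0) (eta j s) (i (gamma j (u j))).
  rewrite e0 -g0 => tr; rewrite /S -ler_pdivrMl; last lra.
  rewrite e0 -g0 in h2; lra.
have := @segment_compact R 0 S; rewrite compact_ultra => /(_ _ FuU FuS) [us [us0S cus]].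
have us0 : 0 <= us by move: us0S; rewrite /= in_itv => /andP[].
exists (hl us).
have c1 : \forall j \near F, `|us - val (u j)| < 1.
  by have /cvgrPdist_lt/(_ 1 ltr01) := cus.
have [j [[[[[g0 gl] geo _ fe] h1] h2] h3]] := filter_ex (filterI (filterI (filterI Fj c1)
  (pg (hl us) 1 ltr01)) (ph s 1 ltr01)).
have h4 := hu j fe; have h5 := geo (u j) (hl us); rewrite val_hl// distrC in h5.
have tr1 := metric_triangle (h s) (eta j s) (i (g (hl us))).
have tr2 := metric_triangle (eta j s) (i (gamma j (u j))) (i (g (hl us))).
have tr3 := metric_triangle (gamma j (u j)) (gamma j (hl us)) (g (hl us)).
have /andP[_ q] := qi (gamma j (u j)) (g (hl us)).
have : L * mdist (gamma j (u j)) (g (hl us)) <= L * 2.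
  by rewrite ler_pM2l; rewrite /= in h1 h2; lra.
rewrite (metric_sym (h s) (eta j s)) /= in tr1 *; rewrite /= in h3; lra.
Qed.

End Rays.

(** * Uniform distance between Morse rays and quasi-rays *)

Section MorseRays.
Context {R : realType} {G : groupType} {H : set G} (S : genset H).
Local Notation X := (word_space R S).
Local Notation Y := (cayley_space R S).

Lemma segment_geodesic (c : R -> Y) (n : nat) :
  (forall s t, 0 <= s -> 0 <= t -> mdist (c s) (c t) <= `|s - t|) ->
  mdist (c 0) (c n%:R) = n%:R ->
  forall s t, 0 <= s <= n%:R -> 0 <= t <= n%:R -> mdist (c s) (c t) = `|s - t|.
Proof.
move=> cl cn s t; wlog st : s t / s <= t.
  move=> W hs ht; have [/W|/ltW/W] := leP s t; first exact.
  by rewrite metric_sym distrC; exact.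
move=> /andP[s0 sn] /andP[t0 tn]; apply/eqP; rewrite eq_le cl//=.
have h1 : mdist (c 0) (c s) <= s.
  by rewrite (le_trans (cl _ _ _ _))// distrC subr0 ger0_norm.
have h2 : mdist (c t) (c n%:R) <= n%:R - t.
  by rewrite (le_trans (cl _ _ _ _))// distrC ger0_norm ?subr_ge0.
have := metric_triangle (c 0) (c s) (c n%:R).
have := metric_triangle (c s) (c t) (c n%:R).
by rewrite distrC ger0_norm ?subr_ge0// cn; lra.
Qed.

Lemma geodesic_quasi_ray (Z : metricType R) (L : R) (h : halfline R -> Z) :
  1 <= L -> geodesic_ray h -> quasi_ray L h.
Proof.
move=> L1 gh s t; rewrite gh; set x := `|_|; have x0 : 0 <= x by exact: normr_ge0.
have : L^-1 * x <= 1 * x by apply: ler_wpM2r => //; rewrite invf_le1//; lra.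
have : 1 * x <= L * x by exact: ler_wpM2r.
by move=> h1 h2; apply/andP; split; lra.
Qed.

(* Going along [a] up to a nearest point to [h S] and then straight to [h S] is
   a quasi-geodesic, with constants that do not depend on [S]. *)
Lemma nearest_point_concat (L : R) (a : halfline R -> Y) (c : R -> Y) (tau : R)
    (n : nat) : 1 <= L -> quasi_ray L a -> 0 <= tau ->
  (forall s t, 0 <= s -> 0 <= t -> mdist (c s) (c t) <= `|s - t|) ->
  mdist (c 0) (c n%:R) = n%:R -> mdist (a (hl tau)) (c 0) <= 1 ->
  (forall t, n%:R - 4 <= mdist (a t) (c n%:R)) ->
  qg_on (L ^+ 2 + 7 * L + 10) 0 (tau + n%:R)
    (fun u => if u <= tau then a (hl u) else c (u - tau)).
Proof.
move=> L1 qa tau0 cl cn atau far; have geo := segment_geodesic cl cn.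
have L2 : L <= L ^+ 2 by rewrite expr2 ler_peMl//; lra.
set C := L ^+ 2 + 7 * L + 10; have C1 : 1 <= C by rewrite /C; lra.
have CL : L <= C by rewrite /C; lra.
have C0 : 0 < C by lra. have L0 : 0 < L by lra.
have Ci (x : R) : 0 <= x -> C^-1 * x <= x.
  by move=> x0; rewrite ler_piMl// invf_le1.
have CiL (x : R) : 0 <= x -> C^-1 * x <= L^-1 * x.
  by move=> x0; rewrite ler_wpM2r// lef_pV2.
move=> s t; wlog st : s t / s <= t.
  move=> W hs ht; have [/W|/ltW/W] := leP s t; first exact.
  by rewrite metric_sym distrC; exact.
move=> /andP[s0 sn] /andP[t0 tn]; rewrite distrC ger0_norm ?subr_ge0//.
have ts0 : 0 <= t - s by lra.
have [tt|tt] := leP t tau.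
  rewrite ifT; last lra.
  have /andP[q1 q2] := qa (hl s) (hl t).
  rewrite !val_hl// distrC ger0_norm// in q1 q2.
  have := CiL _ ts0; have : L * (t - s) <= C * (t - s) by rewrite ler_wpM2r.
  by move=> h1 h2; apply/andP; split; lra.
have [ss|ss] := leP s tau; last first.
  rewrite geo; [|lra|lra].
  rewrite opprB addrA subrK distrC ger0_norm//.
  have := Ci _ ts0; have : t - s <= C * (t - s) by rewrite ler_peMl.
  by move=> h1 h2; apply/andP; split; lra.
set w := t - tau; have w0 : 0 <= w by rewrite /w; lra.
have wn : w <= n%:R by rewrite /w; lra.
set d := mdist (a (hl s)) (c w).
have d0 : 0 <= d by exact: mdist_ge0.
have dw : mdist (c w) (c n%:R) = n%:R - w.
  by rewrite geo ?w0 ?wn ?lexx ?ler0n// distrC ger0_norm// subr_ge0.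
have d0w : mdist (c 0) (c w) = w.
  by rewrite geo ?w0 ?wn ?lexx ?ler0n// sub0r normrN ger0_norm.
have h1 : w - 4 <= d.
  by have := metric_triangle (a (hl s)) (c w) (c n%:R); have := far (hl s); rewrite -/d; lra.
have /andP[q1 q2] := qa (hl s) (hl tau).
rewrite !val_hl// distrC ger0_norm ?subr_ge0// in q1 q2.
have h2 : mdist (a (hl s)) (a (hl tau)) <= d + w + 1.
  have := metric_triangle (a (hl s)) (c w) (a (hl tau)).
  have := metric_triangle (c w) (c 0) (a (hl tau)).
  rewrite (metric_sym (c w) (c 0)) (metric_sym (c 0) (a _)) -/d; lra.
have h3 : tau - s <= L * (2 * d + 5 + L) by rewrite -ler_pdivrMl//; lra.
have tsE : t - s = (tau - s) + w by rewrite /w; ring.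
apply/andP; split.
  rewrite lerBlDr ler_pdivrMl// tsE.
  have h4 : 2 * L * d <= C * d by rewrite ler_wpM2r// /C; lra.
  have h5 : 5 * L * d <= C * d by rewrite ler_wpM2r// /C; lra.
  have h6 : L * (5 + L) + 4 <= C * C.
    rewrite (le_trans _ (ler_peMl _ C1))//; last lra.
    by rewrite /C; lra.
  have h7 : (2 * L + 1) * d <= C * d by rewrite ler_wpM2r// /C; lra.
  lra.
have h8 : d <= mdist (a (hl s)) (a (hl tau)) + 1 + w.
  have := metric_triangle (a (hl s)) (a (hl tau)) (c w).
  have := metric_triangle (a (hl tau)) (c 0) (c w); rewrite -/d; lra.
have h9 : L * (tau - s) <= C * (tau - s) by rewrite ler_wpM2r// subr_ge0.
have h10 : w <= C * w by rewrite ler_peMl.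
have CL' : L + 1 <= C by rewrite /C; lra.
rewrite tsE mulrDr; lra.
Qed.

(** [D] depends on [L] and [N] only. The unknown Hausdorff bound [r] merely decides how far out the
    auxiliary quasi-geodesic ends, while its constants come from [nearest_point_concat]. *)
Lemma uniform_fellow (L : R) (N : R -> R) : 1 <= L -> morse_gauge N ->
  exists2 D, 0 <= D & forall a h : halfline R -> Y, quasi_ray L a ->
    geodesic_ray h -> a halfline0 = h halfline0 -> morse_set N (range h) ->
    finite_hausdorff_distance (range h) (range a) -> fellow D a h /\ fellow D h a.
Proof.
move=> L1 gN; have [N' gN' hN'] := morse_close Y (ler0n R 2) gN.
set C := L ^+ 2 + 7 * L + 10.
have C1 : 1 <= C by rewrite /C; have := sqr_ge0 L; lra.
have D10 : 0 <= N' C + 2 by have := gN' C C1; lra.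
have [D2 D20 hD2] := @fellow_sym _ Y L _ L1 D10.
exists (Num.max (N' C + 2) D2); first by rewrite le_max D10.
move=> a h qa gh ah mh [r [hr _]].
suff fah : fellow (N' C + 2) a h.
  split; first by move=> s; have [t ht] := fah s; exists t; rewrite le_max ht.
  have := hD2 a h qa (geodesic_quasi_ray L1 gh) ah fah.
  by move=> f s; have [t ht] := f s; exists t; rewrite le_max ht orbT.
pose A' := [set y : Y | exists s, mdist y (h s) <= 2].
have mA' : morse_set N' A'.
  apply: hN' mh; split=> [_ [s _ <-]|y [s ys]].
    by exists (h s); [exists s|]; rewrite mdistxx.
  by exists (h s); [exists s|rewrite metric_sym].
move=> u; have u0 := halfline_ge0 u.
have r0 : 0 <= r.
  have [|_ [t _ <-]] := hr (h halfline0); first by exists halfline0.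
  exact: le_trans (mdist_ge0 _ _).
(* Far enough for a point of [a] nearest to [p] to have a parameter beyond [u]. *)
pose p := h (hl (L * val u + L + r + 2)).
have S0 : 0 <= L * val u + L + r + 2 by rewrite !addr_ge0// ?mulr_ge0//; lra.
(* The integer [k] is the distance from [p] to [a] rounded up. Moving both ends of the connecting
   segment to vertices costs the 4 in [nearest_point_concat], and is why [A'] is the 2-neighbourhood
   of [h]. *)
pose P k := `[< exists t, mdist p (a t) <= k%:R >].
have Pr : P (Num.truncn r).+1.
  apply/asboolP; have [|_ [t _ <-] pt] := hr p; first by exists (hl (L * val u + L + r + 2)).
  by exists t; apply: (le_trans pt); have /andP[_ /ltW] := truncn_itv r0.
have [k /asboolP[t0 kt0] kmin] := ex_minnP (ex_intro P _ Pr).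
have kr : k%:R <= r + 1.
  have : k%:R <= (Num.truncn r).+1%:R :> R by rewrite ler_nat kmin.
  by rewrite -natr1; have /andP[] := truncn_itv r0; lra.
have kfar t : k%:R - 1 <= mdist p (a t).
  rewrite leNgt; apply/negP => hlt; case: k {kr kt0} kmin hlt => [|k] kmin hlt.
    by have := mdist_ge0 p (a t); lra.
  suff : (k.+1 <= k)%N by rewrite ltnn.
  by apply: kmin; apply/asboolP; exists t; rewrite -natr1 addrK in hlt; exact: ltW.
have [b0 hb0] := nu_near (a t0); have [b1 hb1] := nu_near p.
have [n nE] := word_mdist_nat b0 b1.
have [c [c0 cn cl]] : exists c : R -> Y, [/\ c 0 = nu b0, c n%:R = nu b1 &
    forall s t, 0 <= s -> 0 <= t -> mdist (c s) (c t) <= `|s - t|].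
  by apply/segment/word_graphlike; rewrite nE.
have cnE : mdist (c 0) (c n%:R) = n%:R by rewrite c0 cn nu_mdist.
set tau := val t0; have tau0 : 0 <= tau by exact: halfline_ge0.
have nk : n%:R <= k%:R + 2 :> R.
  rewrite -nE -nu_mdist; have := metric_triangle (nu b0) (a t0) (nu b1).
  have := metric_triangle (a t0) p (nu b1).
  rewrite (metric_sym (nu b0) (a t0)) (metric_sym (a t0) p); lra.
have qf : qg_on C 0 (tau + n%:R) (fun u => if u <= tau then a (hl u) else c (u - tau)).
  apply: nearest_point_concat => //; first by rewrite hlK c0.
  move=> t; rewrite cn; have := metric_triangle p (nu b1) (a t).
  rewrite (metric_sym (nu b1) (a t)); have := kfar t; lra.
have utau : val u <= tau.
  have d1 : mdist (h halfline0) p = L * val u + L + r + 2.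
    by rewrite gh val_hl// sub0r normrN ger0_norm.
  have /andP[_ q] := quasi_ray_dist0 t0 qa; rewrite ah in q.
  have := metric_triangle (h halfline0) (a t0) p; rewrite (metric_sym (a t0) p) => tr.
  have : L * val u <= L * tau by rewrite -/tau in q; lra.
  by rewrite ler_pM2l//; lra.
have [||||x [s xs] fx] := mA' C C1 0 (tau + n%:R) _ _ qf _ _ (val u).
- by rewrite addr_ge0.
- by exists halfline0; rewrite tau0 hl0 ah mdistxx.
- have [n0|n0] := leP n%:R (0 : R).
    rewrite ifT; last lra.
    have nz : n%:R = 0 :> R by apply/eqP; rewrite eq_le n0 ler0n.
    rewrite nz addr0 hlK; exists (hl (L * val u + L + r + 2)); rewrite -/p.
    have b01 : mdist (nu b0) (nu b1) = 0 by rewrite nu_mdist nE.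
    have := metric_triangle (a t0) (nu b0) p.
    have := metric_triangle (nu b0) (nu b1) p; rewrite (metric_sym (nu b1) p); lra.
  rewrite ifF; last by apply/negbTE; rewrite -ltNge; lra.
  rewrite addrAC subrr add0r cn; exists (hl (L * val u + L + r + 2)).
  by rewrite metric_sym -/p; lra.
- by rewrite u0 (le_trans utau)// lerDl.
rewrite utau hlK in fx; exists s.
have := metric_triangle (a u) x (h s); lra.
Qed.

(** Geodesic segments from [o] to points far out on [a] are 1-quasi-geodesics, so they stay near [a]
    by the Morse property. An ultralimit of them is a geodesic ray. *)
Lemma exists_fellow_ray (L : R) (N : R -> R) (o : X) : 1 <= L -> morse_gauge N ->
  exists2 D, 0 <= D & forall a : halfline R -> Y, quasi_ray L a ->
    a halfline0 = nu o -> morse_set N (range a) ->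
    exists h : halfline R -> Y, [/\ geodesic_ray h, h halfline0 = nu o,
      fellow D a h & fellow D h a].
Proof.
move=> L1 gN; have [N' gN' hN'] := morse_close Y ler01 gN.
have D10 : 0 <= N' 1 + 2 by have := gN' 1 (lexx _); lra.
have [D2 D20 hD2] := @fellow_sym _ Y L _ L1 D10.
exists (Num.max (N' 1 + 2) D2); first by rewrite le_max D10.
move=> a qa a0 ma.
suff [h [gh h0 fha]] : exists h : halfline R -> Y,
    [/\ geodesic_ray h, h halfline0 = nu o & fellow (N' 1 + 2) h a].
  exists h; split=> //; last by move=> s; have [t ht] := fha s; exists t; rewrite le_max ht.
  have := hD2 h a (geodesic_quasi_ray L1 gh) qa (etrans h0 (esym a0)) fha.
  by move=> f s; have [t ht] := f s; exists t; rewrite le_max ht orbT.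
pose A' := [set y : Y | exists s, mdist y (a s) <= 1].
have mA' : morse_set N' A'.
  apply: hN' ma; split=> [_ [s _ <-]|y [s ys]].
    by exists (a s); [exists s|]; rewrite mdistxx.
  by exists (a s); [exists s|rewrite metric_sym].
have /choice [bl hbl] : forall n : nat, exists bl : X * nat,
    mdist (a (hl n%:R)) (nu bl.1) <= 1 /\ mdist o bl.1 = bl.2%:R.
  move=> n; have [b hb] := nu_near (a (hl n%:R)); have [l hl] := word_mdist_nat o b.
  by exists (b, l).
pose b n := (bl n).1; pose l n := (bl n).2.
have /choice [c hc] : forall n : nat, exists c : R -> Y,
    [/\ c 0 = nu o, c (l n)%:R = nu (b n) &
      forall s t, 0 <= s -> 0 <= t -> mdist (c s) (c t) <= `|s - t|].
  by move=> n; apply/segment/word_graphlike; have [_ ->] := hbl n.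
have geo n s t : 0 <= s <= (l n)%:R -> 0 <= t <= (l n)%:R ->
    mdist (c n s) (c n t) = `|s - t|.
  have [c0 cn cl] := hc n; apply: segment_geodesic => //.
  by rewrite c0 cn nu_mdist; have [] := hbl n.
(* Constant beyond the length [l n] of the segment; the limit is geodesic because [l n] tends to
   infinity. *)
pose gamma n : {compact-open, halfline R -> Y} :=
  fun s => c n (Num.min (val s) (l n)%:R).
have min0 (s : halfline R) n : 0 <= Num.min (val s) (l n)%:R.
  by rewrite le_min halfline_ge0 ler0n.
have gammal n : based_lip (nu o) (gamma n).
  have [c0 cn cl] := hc n; split.
    by rewrite /gamma /= min_l// c0.
  move=> s t; rewrite /gamma; apply: (le_trans (cl _ _ _ _)) => //.
  wlog st : s t / val s <= val t.
    move=> W; have [/W//|/ltW/W] := leP (val s) (val t).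
    by rewrite distrC (distrC (val t)).
  rewrite distrC [leRHS]distrC [leRHS]ger0_norm ?subr_ge0// ler_norml.
  have [h1|h1] := leP (val s) (l n)%:R; have [h2|h2] := leP (val t) (l n)%:R; lra.
have gammaA n s : val s <= (l n)%:R -> exists t, mdist (gamma n s) (a t) <= N' 1 + 1.
  move=> sl; have [c0 cn cl] := hc n.
  have [||||x [t xt] cx] := mA' 1 (lexx _) 0 (l n)%:R (c n) (ler0n _ _) _ _ _ (val s).
  - by move=> u v hu hv; rewrite geo// invr1 !mul1r; lra.
  - by exists halfline0; rewrite c0 a0 mdistxx.
  - exists (hl n%:R); rewrite cn metric_sym.
    by have [] := hbl n.
  - by rewrite halfline_ge0.
  exists t; rewrite /gamma min_l//.
  have := metric_triangle (c n (val s)) x (a t); lra.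
have [w [wU wn woo]] := nat_ultrafilter.
have wP : ProperFilter w by exact: (@ultra_proper _ w wU).
have llarge (M : R) : \forall n \near w, M <= (l n)%:R.
  have M0 : 0 <= L * (`|M| + L + 1) by rewrite mulr_ge0 ?addr_ge0//; lra.
  apply: woo; exists (Num.truncn (L * (`|M| + L + 1))).+1 => // n /= Mn.
  have /andP[_ h1] := truncn_itv M0.
  have h2 : L * (`|M| + L + 1) <= n%:R by apply: (le_trans (ltW h1)); rewrite ler_nat.
  have /andP[q _] := quasi_ray_dist0 (hl n%:R) qa; rewrite val_hl// a0 in q.
  have [e1 e2] := hbl n; rewrite -nu_mdist in e2.
  have := metric_triangle (nu o) (nu (b n)) (a (hl n%:R)).
  rewrite (metric_sym (nu (b n))) -/(b n) -/(l n) in e1 e2 *.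
  have : L^-1 * (L * (`|M| + L + 1)) <= L^-1 * n%:R by rewrite ler_wpM2l// invr_ge0; lra.
  rewrite mulKf; last by rewrite gt_eqF//; lra.
  have := ler_norm M; lra.
have FU := ultra_fmap gamma wU.
have Fb : w [set n | based_lip (nu o) (gamma n)] by exact: filterE.
have [h [hL _ ptw]] := ray_limit (cayley_ball_compact o) FU Fb.
have ptw' t e : 0 < e -> \forall n \near w, mdist (gamma n t) (h t) < e by exact: ptw.
exists h; split; last 2 first.
- by case: hL.
- move=> s; have [n [h1 h2]] := filter_ex (filterI (llarge (val s)) (ptw' s 1 ltr01)).
  have [t ht] := gammaA n s h1; exists t.
  have := metric_triangle (h s) (gamma n s) (a t).
  by rewrite (metric_sym (h s) (gamma n s)); lra.
apply: (geodesic_limit ptw') => s t.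
apply: (@filterS _ w _ _ _ _ (filterI (llarge (val s)) (llarge (val t)))) => n [h1 h2].
by rewrite /gamma !min_l// geo ?halfline_ge0.
Qed.

End MorseRays.

(** * Images of Morse rays under the inclusion *)

Lemma range_comp (I A B : Type) (f : I -> A) (g : A -> B) : range (g \o f) = g @` range f.
Proof. by rewrite image_comp. Qed.

Lemma hausdorff_le_image (R : realType) (X Y : metricType R) (L D : R) (i : X -> Y)
    (A B : set X) : 0 <= L -> qie L i -> hausdorff_le D A B ->
  hausdorff_le (L * D + L) (i @` A) (i @` B).
Proof.
move=> L0 qi [AB BA]; split=> _ [x xA <-].
  have [y By xy] := AB x xA; exists (i y); first by exists y.
  have /andP[_ q] := qi x y; apply: (le_trans q).
  by rewrite lerD2r ler_wpM2l.
have [y By xy] := BA x xA; exists (i y); first by exists y.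
have /andP[_ q] := qi y x; apply: (le_trans q).
by rewrite lerD2r ler_wpM2l.
Qed.

Lemma hausdorff_le_preimage (R : realType) (X Y : metricType R) (L D : R) (i : X -> Y)
    (A B : set X) : 0 < L -> qie L i -> hausdorff_le D (i @` A) (i @` B) ->
  hausdorff_le (L * (D + L)) A B.
Proof.
move=> L0 qi [AB BA]; split=> x xA.
  have [|_ [y By <-] xy] := AB (i x); first by exists x.
  exists y => //; have /andP[q _] := qi x y.
  by rewrite -ler_pdivrMl//; lra.
have [|_ [y By <-] xy] := BA (i x); first by exists x.
exists y => //; have /andP[q _] := qi y x.
by rewrite -ler_pdivrMl//; lra.
Qed.

Lemma quasi_ray_comp (R : realType) (X Y : metricType R) (L : R) (i : X -> Y)
    (g : halfline R -> X) : qie L i -> geodesic_ray g -> quasi_ray L (i \o g).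
Proof. by move=> qi gg s t; rewrite -gg; exact: qi. Qed.

Lemma morse_set_le (R : realType) (X : metricType R) (N N' : R -> R) (A : set X) :
  (forall C, N C <= N' C) -> morse_set N A -> morse_set N' A.
Proof.
move=> NN' mA C C1 a b f ab qf fa fb s sab.
by have [x Ax h] := mA C C1 a b f ab qf fa fb s sab; exists x => //; exact: le_trans h _.
Qed.

Section ImageMorse.
Context {R : realType} {G : groupType} {T : conn_graph} (act : G -> T -> T) (p : T).
Hypothesis act_split : splitting act.
Hypothesis edges_undistorted :
  forall q, adj p q -> undistorted R (edge_group act p q) [set: G].
Hypothesis edges_wide :
  forall q, adj p q -> relatively_wide R (edge_group act p q) (vertex_group act p).
Local Notation V := (vertex_group act p).
Variables (SV : genset V) (SG : genset [set: G]).
Variables (i : cayley_space R SV -> cayley_space R SG) (L : R).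
Hypotheses (L1 : 1 <= L) (qi : qie L i).
Hypothesis i_nu : forall x : word_space R SV, i (nu x) = nu (vincl SG x).

(** The ray is replaced by vertices near its integer times, [vertex_morse] is applied in the word
    metrics, and the result returns to the Cayley graph of [G]. The two descriptions agree at
    vertices, where [i] is the inclusion. *)
Lemma image_morse (N : R -> R) : morse_gauge N -> exists2 N', morse_gauge N' &
  forall g : halfline R -> cayley_space R SV, geodesic_ray g ->
    morse_set N (range g) -> morse_set N' (range (i \o g)).
Proof.
move=> gN.
have [Na gNa hNa] := morse_close (cayley_space R SV) (ler0n R 2) gN.
have [Nb gNb hNb] := morse_pullback (lexx 1) (@nu_qie R G V SV) gNa.
have [Nc gNc hNc] := @vertex_morse R G T act p act_split edges_undistorted edges_wide
  SV SG 2 Nb (ler1n _ 2) gNb.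
have [Nd gNd hNd] := morse_image (lexx 1) (@nu_qie R G _ SG) (@nu_near R G _ SG) gNc.
have L1' := L1; have D0 : 0 <= L * 2 + L by lra.
have [Ne gNe hNe] := morse_close (cayley_space R SG) D0 gNd.
exists Ne => // g gg mg.
have /choice [sigma hs] : forall n : nat, exists x : word_space R SV,
    mdist (g (hl n%:R)) (nu x) <= 1 by move=> n; exact: nu_near.
have close : hausdorff_le 2 (range g) (range (@nu R G V SV \o sigma)).
  split=> [_ [s _ <-]|_ [n _ <-]]; last first.
    by exists (g (hl n%:R)); [exists (hl n%:R)|have := hs n; rewrite /=; lra].
  set n := Num.truncn (val s); exists (nu (sigma n)); first by exists n.
  have /andP[h1 h2] := truncn_itv (halfline_ge0 s); rewrite -natr1 in h2.
  have := metric_triangle (g s) (g (hl n%:R)) (nu (sigma n)).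
  rewrite gg val_hl// ger0_norm; last by rewrite subr_ge0.
  by have := hs n; rewrite -/n in h1 h2 *; lra.
have qs : qg_seq 2 sigma.
  move=> m n mn; rewrite -nu_mdist.
  have mn' : m%:R <= n%:R :> R by rewrite ler_nat.
  have e : mdist (g (hl m%:R)) (g (hl n%:R)) = n%:R - m%:R.
    by rewrite gg !val_hl// distrC ger0_norm// subr_ge0.
  have t1 := metric_triangle (g (hl m%:R)) (nu (sigma m)) (g (hl n%:R)).
  have t2 := metric_triangle (nu (sigma m)) (nu (sigma n)) (g (hl n%:R)).
  have t3 := metric_triangle (nu (sigma m)) (g (hl m%:R)) (nu (sigma n)).
  have t4 := metric_triangle (g (hl m%:R)) (g (hl n%:R)) (nu (sigma n)).
  rewrite (metric_sym (nu (sigma n)) (g _)) in t2.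
  rewrite (metric_sym (nu (sigma m)) (g _)) in t3.
  by have := hs m; have := hs n; lra.
have : morse_set Nd (@nu R G _ SG @` range (@vincl R G T act p SV SG \o sigma)).
  by apply/hNd/hNc => //; apply: hNb; rewrite -range_comp; exact: hNa close mg.
apply: hNe; rewrite -range_comp.
have -> : @nu R G _ SG \o (@vincl R G T act p SV SG \o sigma) =
    i \o (@nu R G V SV \o sigma).
  by apply/funext => n /=; rewrite i_nu.
rewrite !(range_comp _ i); apply: hausdorff_le_image => //; first lra.
by case: close => c1 c2; split=> x /[dup] hx;
  [move=> /c2[y hy yx]|move=> /c1[y hy yx]]; exists y => //; rewrite metric_sym.
Qed.

End ImageMorse.

(** * The map of Morse boundaries *)

Section MorseRayFacts.
Context {R : realType} {X : metricType R} (o : X).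

Lemma ray_class_eq (g h : morse_ray o) : ray_class g = ray_class h <->
  finite_hausdorff_distance (range (morse_ray_fun g)) (range (morse_ray_fun h)).
Proof.
split=> [|gh].
  by move=> /(@eqquotP _ _ {eq_quot (asymptotic_equiv o)}%qT)/asboolP.
exact/(@eqquotP _ _ {eq_quot (asymptotic_equiv o)}%qT)/asboolP.
Qed.

Lemma ray_class_surj (c : morse_boundary o) : exists g, c = ray_class g.
Proof.
by exists (repr (c : {eq_quot (asymptotic_equiv o)}%qT)); rewrite /ray_class reprK.
Qed.

Lemma morse_rayP (g : morse_ray o) : [/\ geodesic_ray (morse_ray_fun g),
  morse_ray_fun g halfline0 = o & morse (morse_ray_fun g)].
Proof. exact: set_mem (valP g). Qed.

Lemma morse_ray_ex (h : {compact-open, halfline R -> X}) : geodesic_ray h ->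
  h halfline0 = o -> morse h -> exists g : morse_ray o, morse_ray_fun g = h.
Proof.
move=> h1 h2 h3.
have hin : h \in [set g : {compact-open, halfline R -> X} |
    [/\ geodesic_ray g, g halfline0 = o & morse g]] by apply/mem_set; split.
by exists (SigSub hin).
Qed.

Lemma morse_ray_lip (g : morse_ray o) : based_lip o (morse_ray_fun g).
Proof. by have [gg g0 _] := morse_rayP g; split=> // s t; rewrite gg. Qed.

End MorseRayFacts.

Lemma closure_ultra (X : topologicalType) (A : set X) x : closure A x ->
  exists F : set_system X, [/\ UltraFilter F, F --> x & F A].
Proof.
rewrite closureEcvg => -[F FP [Fx FA]].
have [F' [FU FF']] := ultraFilterLemma FP.
by exists F'; split=> //; [exact: subset_trans Fx FF'|apply: FF'; exact: FA].
Qed.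

Section BoundaryMap.
Context {R : realType} {G : groupType} {H K : set G} (SH : genset H) (SK : genset K).
Local Notation X := (cayley_space R SH).
Local Notation Y := (cayley_space R SK).
Local Notation oX := (vertex_point (cayley1 SH) : X).
Local Notation oY := (vertex_point (cayley1 SK) : Y).
Variables (i : X -> Y) (L : R).
Hypotheses (L1 : 1 <= L) (qi : qie L i) (i_base : i oX = oY).
Hypothesis image_morse : forall N, morse_gauge N -> exists2 N', morse_gauge N' &
  forall g : halfline R -> X, geodesic_ray g ->
    morse_set N (range g) -> morse_set N' (range (i \o g)).

Let L0 : 0 < L. Proof. exact: lt_le_trans ltr01 L1. Qed.

(** The gauge [N'] is common to all [N]-Morse rays: the images of a stratum lie in one stratum. *)
Lemma image_ray (N : R -> R) : morse_gauge N -> exists2 D, 0 <= D &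
  exists2 N', morse_gauge N' & forall g : morse_ray oX, morse_for N (morse_ray_fun g) ->
    exists h : morse_ray oY, [/\ morse_for N' (morse_ray_fun h),
      fellow D (i \o morse_ray_fun g) (morse_ray_fun h) &
      fellow D (morse_ray_fun h) (i \o morse_ray_fun g)].
Proof.
move=> gN; have [N1 gN1 hN1] := image_morse gN.
have [D D0 hD] := @exists_fellow_ray R G K SK L N1 (cayley1 SK) L1 gN1.
have [N2 gN2 hN2] := morse_close Y D0 gN1.
exists D => //; exists N2 => // g /morse_forP mg.
have [gg g0 _] := morse_rayP g; have mi := hN1 _ gg mg.
have [|h [gh h0 f1 f2]] := hD _ (quasi_ray_comp qi gg) _ mi.
  by rewrite /= g0 i_base.
have hle := fellow_hausdorff f1 f2; rewrite maxxx in hle.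
have mh := hN2 _ _ hle mi.
have [hr hrE] := @morse_ray_ex R Y oY h gh h0 (ex_intro2 _ _ N2 gN2 ((morse_forP _ _).2 mh)).
by exists hr; rewrite hrE; split=> //; apply/morse_forP.
Qed.

Lemma fellow_class (f : cayley_boundary R SH -> cayley_boundary R SK)
    (g : morse_ray oX) (h : morse_ray oY) D D' : boundary_inclusion i f ->
  fellow D (morse_ray_fun h) (i \o morse_ray_fun g) ->
  fellow D' (i \o morse_ray_fun g) (morse_ray_fun h) -> f (ray_class g) = ray_class h.
Proof.
move=> fi f1 f2; have [h' [-> hh']] := fi g; apply/ray_class_eq.
apply: fhd_trans hh' _; apply: fhd_sym.
by exists (Num.max D D'); exact: fellow_hausdorff f1 f2.
Qed.

Lemma boundary_inclusion_ex : exists f : cayley_boundary R SH -> cayley_boundary R SK,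
  boundary_inclusion i f.
Proof.
have /choice [hh hP] : forall g : morse_ray oX, exists h : morse_ray oY,
    finite_hausdorff_distance (range (morse_ray_fun h)) (range (ray_image i g)).
  move=> g; have [_ _ [N gN mg]] := morse_rayP g.
  have [D D0 [N' gN' /(_ g mg)[h [_ f1 f2]]]] := image_ray gN.
  by exists h, (Num.max D D); exact: fellow_hausdorff f2 f1.
have /choice [rep repP] : forall c : cayley_boundary R SH, exists g : morse_ray oX, c = ray_class g.
  exact: ray_class_surj.
exists (fun c => ray_class (hh (rep c))) => g; exists (hh (rep (ray_class g))); split=> //.
apply: fhd_trans (hP _) _.
have /ray_class_eq [D hD] := esym (repP (ray_class g)).
exists (L * D + L); rewrite /ray_image (range_comp (morse_ray_fun g) i).
rewrite (range_comp (morse_ray_fun (rep (ray_class g))) i).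
exact: (hausdorff_le_image (ltW L0) qi (hD : hausdorff_le D _ _)).
Qed.

Variable f : cayley_boundary R SH -> cayley_boundary R SK.
Hypothesis fi : boundary_inclusion i f.

Lemma boundary_inj : injective f.
Proof.
move=> c c'; have [g ->] := ray_class_surj c; have [g' ->] := ray_class_surj c'.
have [h [-> hg]] := fi g; have [h' [-> hg']] := fi g'.
move=> /ray_class_eq hh'; apply/ray_class_eq.
have [D] := fhd_trans (fhd_sym hg) (fhd_trans hh' hg').
rewrite /ray_image (range_comp (morse_ray_fun g) i) (range_comp (morse_ray_fun g') i) => hD.
exists (L * (D + L)).
exact: (hausdorff_le_preimage L0 qi (hD : hausdorff_le D _ _)).
Qed.

Lemma limit_fellow (D : R) : 0 <= D -> exists D1 D2, [/\ 0 <= D1, 0 <= D2 &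
  forall (I : Type) (F : set_system I) (gamma : I -> halfline R -> X)
    (eta : I -> halfline R -> Y) (g : halfline R -> X) (h : halfline R -> Y),
  UltraFilter F ->
  (\forall j \near F, [/\ based_lip oX (gamma j), geodesic_ray (gamma j),
      based_lip oY (eta j), geodesic_ray (eta j) & fellow D (eta j) (i \o gamma j)]) ->
  based_lip oX g -> based_lip oY h ->
  (forall t e, 0 < e -> \forall j \near F, mdist (gamma j t) (g t) < e) ->
  (forall t e, 0 < e -> \forall j \near F, mdist (eta j t) (h t) < e) ->
  [/\ geodesic_ray g, geodesic_ray h, fellow D1 h (i \o g) & fellow D2 (i \o g) h]].
Proof.
move=> D0; have D10 : 0 <= D + 1 + 3 * L by have := L1; lra.
have [D2 D20 hD2] := @fellow_sym R Y L _ L1 D10.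
exists (D + 1 + 3 * L), D2; split=> // I F gamma eta g h FU Fj [g0 _] [h0 _] pg ph.
have FP : ProperFilter F by exact: (@ultra_proper _ F FU).
have gg : geodesic_ray g.
  apply: (geodesic_limit pg) => s t.
  by apply: (@filterS _ F _ _ _ _ Fj) => j [_ gj _ _ _]; exact: gj.
have gh : geodesic_ray h.
  apply: (geodesic_limit ph) => s t.
  by apply: (@filterS _ F _ _ _ _ Fj) => j [_ _ _ gj _]; exact: gj.
have f1 : fellow (D + 1 + 3 * L) h (i \o g).
  apply: (fellow_limit (o := oX) FU L1 qi _ pg ph).
  by apply: (@filterS _ F _ _ _ _ Fj) => j [a b c _ d]; split=> //; rewrite i_base.
split=> //; apply: hD2 f1; first exact: geodesic_quasi_ray.
  exact: quasi_ray_comp.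
by rewrite /= g0 h0 i_base.
Qed.

(** Within a stratum, a ray of the preimage of [W] that is a limit of rays outside has images that
    accumulate, by Arzela-Ascoli, at a ray representing its own image. That ray lies in [W], and the
    accumulating images do not. *)
Lemma boundary_continuous : continuous f.
Proof.
apply/continuousP => W oW.
have bW : boundary_open W by exact: oW.
suff : boundary_open (f @^-1` W) by [].
move=> N gN; have [D D0 [N' gN' hN']] := image_ray gN.
have [D1 [D2 [D10 D20 lim]]] := limit_fellow D0.
have [N1 gN1 hN1] := image_morse gN.
have [N2 gN2 hN2] := morse_close Y D20 gN1.
have [N3 gN3 hN3] := morse_close Y D10 gN1.
have DD0 : 0 <= Num.max D2 D1 by rewrite le_max D20.
have [N4 gN4 hN4] := morse_close Y DD0 gN1.
(* One gauge for all the images and for their limit. The gauge of the limit comes from its closeness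
   to the image of [g], not from passing the Morse property to the limit. *)
pose M C := Num.max (N' C) (N4 C).
have gM : morse_gauge M by move=> C C1; rewrite le_max gN'.
pose B := [set x : {compact-open, halfline R -> X} | exists g : morse_ray oX,
  [/\ morse_for N (morse_ray_fun g), morse_ray_fun g = x & ~ W (f (ray_class g))]].
exists (~` closure B); first by apply: closed_openC; exact: closed_closure.
move=> g mg; split; last first.
  move=> nB; split; last by exists g.
  by apply: contrapT => nW; apply: nB; apply: subset_closure; exists g.
move=> [/= Wg _] /closure_ultra [F [FU Fg FB]].
have FP : ProperFilter F by exact: (@ultra_proper _ F FU).
have /choice [chi hchi] : forall x : {compact-open, halfline R -> X},
    exists y : {compact-open, halfline R -> Y}, B x -> exists (g' : morse_ray oX) (h : morse_ray oY),
    [/\ morse_ray_fun g' = x, morse_ray_fun h = y, morse_for N' (morse_ray_fun h),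
       fellow D y (i \o x) & ~ W (ray_class h)].
  move=> x; have [Bx|nB] := pselect (B x); last by exists (fun=> oY).
  have [g' [mg' g'x nW]] := Bx; have [h [mh f1 f2]] := hN' g' mg'.
  exists (morse_ray_fun h) => _; exists g', h; split=> //; first by rewrite -g'x.
  by rewrite -(fellow_class fi f2 f1).
have FcU := ultra_fmap chi FU.
have Fb : F [set x | based_lip oY (chi x)].
  apply: (@filterS _ F _ _ _ _ FB) => x /hchi [g' [h [_ hE _ _ _]]].
  by rewrite /= -hE; exact: (morse_ray_lip h).
have [h [hL Fh pth]] := ray_limit (cayley_ball_compact (cayley1 SK)) FcU Fb.
have ptg t e : 0 < e -> \forall x \near F, mdist (x t) (morse_ray_fun g t) < e.
  by move=> e0; apply: Fg; exact: compact_open_eval.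
have [gg g0 _] := morse_rayP g.
have Fgood : \forall x \near F, [/\ based_lip oX (id x), geodesic_ray (id x),
    based_lip oY (chi x), geodesic_ray (chi x) & fellow D (chi x) (i \o id x)].
  apply: (@filterS _ F _ _ _ _ FB) => x /hchi [g' [h' [<- <- _ fe _]]].
  have [? _ _] := morse_rayP g'; have [? _ _] := morse_rayP h'.
  by have l1 := morse_ray_lip g'; have l2 := morse_ray_lip h'; split.
have [_ gh f1 f2] := lim _ F id chi (morse_ray_fun g) h FU Fgood (morse_ray_lip g) hL ptg pth.
have mh : morse_set M (range h).
  apply: (@morse_set_le _ _ N4); first by move=> C; rewrite le_max lexx orbT.
  apply: hN4 (fellow_hausdorff f2 f1) _.
  by apply: hN1 => //; apply/morse_forP.
have [|hr hrE] := @morse_ray_ex R Y oY h gh hL.1.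
  by exists M => //; apply/morse_forP.
have Wh : W (ray_class hr).
  by rewrite -(@fellow_class f g hr D1 D2 fi) ?hrE.
have [Q oQ hQ] := bW M gM.
have Qh : Q h.
  rewrite -hrE; apply/hQ; first by rewrite hrE; apply/morse_forP.
  by split=> //; exists hr => //; rewrite /= hrE; apply/morse_forP.
have FQ : F [set x | Q (chi x)].
  by apply: Fh; apply: open_nbhs_nbhs.
have [x [Bx Qx]] := filter_ex (filterI FB FQ).
have [g' [h' [_ h'x mh' _ nW]]] := hchi x Bx; apply: nW.
have mh'M : morse_for M (morse_ray_fun h').
  apply/morse_forP; apply: (@morse_set_le _ _ N'); last exact/morse_forP.
  by move=> C; rewrite le_max lexx.
by have /(hQ h' mh'M) [] : Q (morse_ray_fun h') by rewrite h'x.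
Qed.

(** Thus [f] is a closed map. The argument mirrors continuity; the uniform gauge for preimages comes
    from [uniform_fellow], which bounds the distance between an [N]-Morse ray and the image of a ray
    representing its preimage. *)
Lemma boundary_image_open (U : set (cayley_boundary R SH)) :
  open U -> open (~` (f @` (~` U))).
Proof.
move=> oU; have bU : boundary_open U by exact: oU.
suff : boundary_open (~` (f @` (~` U))) by [].
move=> N gN; have [D D0 hD] := @uniform_fellow R G K SK L N L1 gN.
have [N1 gN1 hN1] := morse_close Y D0 gN.
have [N2 gN2 hN2] := morse_pullback L1 qi gN1.
have [D1 [D2 [D10 D20 lim]]] := limit_fellow D0.
have DD0 : 0 <= Num.max D1 D2 by rewrite le_max D10.
have [N3 gN3 hN3] := morse_close Y DD0 gN.
have [N4 gN4 hN4] := morse_pullback L1 qi gN3.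
pose M C := Num.max (N2 C) (N4 C).
have gM : morse_gauge M by move=> C C1; rewrite le_max gN2.
pose B := [set x : {compact-open, halfline R -> Y} | exists h : morse_ray oY,
  [/\ morse_for N (morse_ray_fun h), morse_ray_fun h = x &
     exists2 g : morse_ray oX, ~ U (ray_class g) & f (ray_class g) = ray_class h]].
exists (~` closure B); first by apply: closed_openC; exact: closed_closure.
move=> h mh; split; last first.
  move=> nB; split; last by exists h.
  move=> [c nUc fc]; apply: nB; apply: subset_closure; exists h; split=> //.
  by have [g cg] := ray_class_surj c; exists g; rewrite -cg.
move=> [/= Wh _] /closure_ultra [F [FU Fh FB]].
have FP : ProperFilter F by exact: (@ultra_proper _ F FU).
have /choice [chi hchi] : forall x : {compact-open, halfline R -> Y},
    exists y : {compact-open, halfline R -> X}, B x -> exists (g : morse_ray oX) (h' : morse_ray oY),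
    [/\ morse_ray_fun h' = x, morse_ray_fun g = y, morse_for N2 (morse_ray_fun g),
       fellow D x (i \o y) & ~ U (ray_class g)].
  move=> x; have [Bx|nB] := pselect (B x); last by exists (fun=> oX).
  have [h' [mh' h'x [g nUg fg]]] := Bx.
  have [gg g0 _] := morse_rayP g; have [gh h0 _] := morse_rayP h'.
  have hg : finite_hausdorff_distance (range (morse_ray_fun h')) (range (i \o morse_ray_fun g)).
    have [h2 [fg' h2g]] := fi g.
    by apply: fhd_trans h2g; apply/ray_class_eq; rewrite -fg -fg'.
  have [||f1 f2] := hD _ _ (quasi_ray_comp qi gg) gh _ _ hg.
  - by rewrite /= g0 h0 i_base.
  - exact/morse_forP.
  exists (morse_ray_fun g) => _; exists g, h'; split=> //; last by rewrite -h'x.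
  apply/morse_forP/hN2; rewrite -(range_comp (morse_ray_fun g) i).
  apply: hN1; last exact: (morse_forP _ _).1 mh'.
  by have := fellow_hausdorff f2 f1; rewrite maxxx.
have FcU := ultra_fmap chi FU.
have Fb : F [set x | based_lip oX (chi x)].
  apply: (@filterS _ F _ _ _ _ FB) => x /hchi [g [h' [_ gE _ _ _]]].
  by rewrite /= -gE; exact: (morse_ray_lip g).
have [g [gL Fg ptg]] := ray_limit (cayley_ball_compact (cayley1 SH)) FcU Fb.
have pth t e : 0 < e -> \forall x \near F, mdist (x t) (morse_ray_fun h t) < e.
  by move=> e0; apply: Fh; exact: compact_open_eval.
have Fgood : \forall x \near F, [/\ based_lip oX (chi x), geodesic_ray (chi x),
    based_lip oY (id x), geodesic_ray (id x) & fellow D (id x) (i \o chi x)].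
  apply: (@filterS _ F _ _ _ _ FB) => x /hchi [g' [h' [<- <- _ fe _]]].
  have [? _ _] := morse_rayP g'; have [? _ _] := morse_rayP h'.
  by have l1 := morse_ray_lip g'; have l2 := morse_ray_lip h'; split.
have [gg _ f1 f2] := lim _ F chi id g (morse_ray_fun h) FU Fgood gL (morse_ray_lip h) ptg pth.
have mg : morse_set M (range g).
  apply: (@morse_set_le _ _ N4); first by move=> C; rewrite le_max lexx orbT.
  apply: hN4; rewrite -(range_comp g i).
  by apply: hN3 (fellow_hausdorff f1 f2) _; apply/morse_forP.
have [|gr grE] := @morse_ray_ex R X oX g gg gL.1.
  by exists M => //; apply/morse_forP.
have Ug : U (ray_class gr).
  apply: contrapT => nU; apply: Wh; exists (ray_class gr) => //.
  by apply: (fellow_class (D := D1) (D' := D2) fi); rewrite grE.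
have [Q oQ hQ] := bU M gM.
have Qg : Q g.
  rewrite -grE; apply/hQ; first by rewrite grE; apply/morse_forP.
  by split=> //; exists gr => //; rewrite /= grE; apply/morse_forP.
have FQ : F [set x | Q (chi x)].
  by apply: Fg; apply: open_nbhs_nbhs.
have [x [Bx Qx]] := filter_ex (filterI FB FQ).
have [g' [h' [_ g'x mg' _ nU]]] := hchi x Bx; apply: nU.
have mg'M : morse_for M (morse_ray_fun g').
  apply/morse_forP; apply: (@morse_set_le _ _ N2); last exact/morse_forP.
  by move=> C; rewrite le_max lexx.
by have /(hQ g' mg'M) [] : Q (morse_ray_fun g') by rewrite g'x.
Qed.

Lemma boundary_embedding : topological_embedding f.
Proof.
split; [exact: boundary_inj|exact: boundary_continuous|move=> U oU].
exists (~` (f @` (~` U))); first exact: boundary_image_open.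
apply/seteqP; split=> [_ [u Uu <-]|_ [[u _ <-] h]].
  split; first by exists u.
  by move=> [u' nUu' /boundary_inj uu']; apply: nUu'; rewrite uu'.
by exists u => //; apply: contrapT => nU; apply: h; exists u.
Qed.

End BoundaryMap.

Theorem theorem3 (R : realType) (G : groupType) (T : conn_graph)
    (act : G -> T -> T) (p : T)
    (G_fg : finitely_generated [set: G])
    (T_splitting : splitting act)
    (edges_undistorted :
      forall q, adj p q -> undistorted R (edge_group act p q) [set: G])
    (edges_wide :
      forall q, adj p q ->
        relatively_wide R (edge_group act p q) (vertex_group act p)) :
  (undistorted R (vertex_group act p) [set: G] /\
   forall (SV : genset (vertex_group act p)) (SG : genset [set: G])
     (i : cayley_space R SV -> cayley_space R SG),
     quasi_isometric_embedding i ->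
     extends_inclusion (@subsetT _ (vertex_group act p)) i ->
     relative_morse_boundary i = [set: cayley_boundary R SV]) /\
  (forall (SV : genset (vertex_group act p)) (SG : genset [set: G])
     (i : cayley_space R SV -> cayley_space R SG),
     quasi_isometric_embedding i ->
     extends_inclusion (@subsetT _ (vertex_group act p)) i ->
     exists f : cayley_boundary R SV -> cayley_boundary R SG,
       boundary_inclusion i f /\ topological_embedding f).
Proof.
split; first split.
- exact: vertex_undistorted.
- move=> SV SG i [L L1 qi] ext; apply/seteqP; split=> // c _.
  have [g ->] := ray_class_surj c; exists g => //=.
  have [gg _ [N gN mg]] := morse_rayP g.
  (* [ext] is, by conversion, the hypothesis of [image_morse] on vertices, since [nu] is
     [vertex_point]. *)
  have [N' gN' hN'] := image_morse T_splitting edges_undistorted edges_wide L1 qi ext gN.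
  by exists N' => //; apply/morse_forP; apply: hN' => //; exact/morse_forP.
move=> SV SG i [L L1 qi] ext.
have im N gN := image_morse T_splitting edges_undistorted edges_wide L1 qi ext (N := N) gN.
have base : i (vertex_point (cayley1 SV)) = vertex_point (cayley1 SG).
  by rewrite ext; congr vertex_point; exact: val_inj.
have [f fi] := boundary_inclusion_ex L1 qi base im.
by exists f; split=> //; exact: (boundary_embedding L1 qi base im fi).
Qed.
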